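(* There exist absolute constants $0<c<C$ such that for all integers $n,k$ with $1\le k\le n/2$, \[ c\, k^{-\delta}(1+\log k)^{-3/2} \le i(n,k) \le C\, k^{-\delta}(1+\log k)^{-3/2}, \] where $\delta = 1 - \frac{1+\log\log 2}{\log 2}$.
   Context: For integers $1\le k\le n$, $i(n,k)$ denotes the proportion of permutations $\pi$ of $\{1,\dots,n\}$ (i.e. of $\pi\in S_n$) having an invariant set of size $k$, i.e. a set $A\subset\{1,\dots,n\}$ with $|A|=k$ and $\pi(A)=A$. Logarithms are natural. *)

(* Defs.v *)
From HB Require Import structures.
From mathcomp Require Import all_boot all_order all_algebra all_fingroup.
From mathcomp Require Import all_classical all_reals all_analysis.
Set Implicit Arguments. Unset Strict Implicit. Unset Printing Implicit Defensive.
Import Order.TTheory GRing.Theory Num.Theory.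
Local Open Scope ring_scope.

Definition has_invariant_set (n k : nat) (s : 'S_n) : bool :=
  [exists A : {set 'I_n}, (#|A| == k) && (s @: A == A)].

Definition iprop (R : realType) (n k : nat) : R :=
  (#|[set s : 'S_n | has_invariant_set k s]|)%:R / (n`!)%:R.

Definition delta (R : realType) : R := 1 - (1 + ln (ln 2)) / ln 2.

(* Main.v *)
(** Write [L(a)] for the set of subset sums of a list [a] of cycle lengths, so
    that [i(n,k)] is the proportion of permutations with [k] in [L(a)].

    Local to global.  A permutation with an invariant set of size [k] has a
    cycle inside the set and one outside it; marking them, with weight their
    lengths, costs a factor [k (n - k)] and leaves a cycle structure for which
    the first length lies in [k - L(a)].  Conversely, a short cycle structure
    [a], a cycle of length in [k - L(a)] and a remainder without short cycles
    make up a permutation with an invariant set of size [k].  So [i(n,k)] has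
    the order of [k^-2] times the sum of [#L(a)] over cycle structures with
    cycles of length at most [k], each weighted by the product over [j] of
    [1 / (j^c_j c_j!)].

    Global.  Group the cycles into dyadic blocks and let [y_t] be the number
    in the [t]-th one; each block has total weight about [rho = ln 2].  For
    every [t], [#L(a)] is at most [2 ^ (number of cycles after block t)] times
    the total length up to block [t].  Taking [t] to maximise the walk
    [W_t = y_1 + ... + y_t - t] splits the walk into two one-sided pieces.
    After the change of measure that makes the steps Poisson of mean one, such
    pieces are counted exactly by Abel's identity (parking functions and first
    passage times), so a piece of [u] steps contributes a factor
    [u^(-3/2)], and the convolution of two such factors is again
    [T^(-3/2)] with [T = log_2 k].  The exponential factor is
    [(2 e rho)^T = k^(2 - delta)].

    For the lower bound keep only the walks with [W_t <= 0] for all [t] and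
    [W_T = 0], and use Cauchy-Schwarz: [#L(a)] is at least [4^r] divided by
    the number of pairs of subsets of the [r] cycles having equal sums.  The
    largest cycle at which the subsets of such a pair differ is determined by
    the others, so the mean number of pairs is at most a constant times
    [2^r (1 + sum of 2 ^ W_t)], and the average of the last factor over those
    walks is bounded. *)
Require Import Defs.
From HB Require Import structures.
From mathcomp Require Import all_boot all_order all_algebra all_fingroup.
From mathcomp Require Import all_classical all_reals all_analysis.
From mathcomp Require Import zify ring lra.
Set Implicit Arguments. Unset Strict Implicit. Unset Printing Implicit Defensive.
Import Order.TTheory GRing.Theory Num.Theory.
Local Open Scope ring_scope.

(** * Averages over cycle structures *)

Section CycleMeasure.
Variable R : realFieldType.
Implicit Types (J : pred nat) (F G : seq nat -> R) (a b : seq nat).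

(** Such a function depends only on the multiset of lengths; the recursion lists them in an
    arbitrary order, and marking a cycle reorders them. *)
Definition symmetric_fun (T : Type) (F : seq nat -> T) :=
  forall a b, perm_eq a b -> F a = F b.

(** The argument [d] is fuel: any [d >= n] gives the same value. The factor [1 / n] is the chance
    that the cycle through a given point has a given length. *)
Fixpoint cycle_mean_rec J (d n : nat) F : R :=
  if n is 0 then F [::] else
  if d is d'.+1 then
    n%:R^-1 * \sum_(1 <= j < n.+1 | J j)
      cycle_mean_rec J d' (n - j) (fun a => F (j :: a))
  else 0.

(* For [J = predT] this is the average of [F] over the cycle lengths of a
   permutation of [n] points, computed by removing the cycle of a given point;
   in general permutations having a cycle length outside [J] are discarded. *)
Definition cycle_mean J n F := cycle_mean_rec J n n F.

Lemma cycle_mean_rec_fuel J d n F : (n <= d)%N ->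
  cycle_mean_rec J d n F = cycle_mean J n F.
Proof.
rewrite /cycle_mean; elim/ltn_ind: n d F => -[|n] IHn [|d] F //=.
rewrite ltnS => le_nd; congr (_ * _).
rewrite big_nat_cond [RHS]big_nat_cond.
apply: eq_bigr => j; case/andP => /andP[j1 jn] Jj.
rewrite IHn ?[RHS]IHn //; lia.
Qed.

Lemma cycle_mean0 J F : cycle_mean J 0 F = F [::].
Proof. by []. Qed.

Lemma cycle_meanS J n F : (0 < n)%N -> n%:R * cycle_mean J n F =
  \sum_(1 <= j < n.+1 | J j) cycle_mean J (n - j) (fun a => F (j :: a)).
Proof.
case: n => // n _; rewrite /cycle_mean /= mulrA mulfV ?pnatr_eq0 // mul1r.
rewrite big_nat_cond [RHS]big_nat_cond.
apply: eq_bigr => j /andP[/andP[j1 jn] Jj].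
by rewrite cycle_mean_rec_fuel //; lia.
Qed.

Definition cycle_list J (n : nat) a :=
  [&& all J a, all (fun j => (0 < j)%N) a & sumn a == n].

Lemma cycle_list_cons J n j a : J j -> (0 < j <= n)%N ->
  cycle_list J (n - j) a -> cycle_list J n (j :: a).
Proof.
move=> Jj /andP[j0 jn] /and3P[Ja a0 /eqP an]; apply/and3P; split=> /=.
- by rewrite Jj.
- by rewrite j0.
- by rewrite an; apply/eqP; lia.
Qed.

Lemma le_cycle_mean J n F G : (forall a, cycle_list J n a -> F a <= G a) ->
  cycle_mean J n F <= cycle_mean J n G.
Proof.
elim/ltn_ind: n F G => n IHn F G leFG.
have [n0|n0] := posnP n.
  by rewrite n0 in leFG *; rewrite !cycle_mean0; apply: leFG.
rewrite -(ler_pM2l (_ : 0 < n%:R)) ?ltr0n // !cycle_meanS //.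
rewrite big_nat_cond [leRHS]big_nat_cond.
apply: ler_sum => j /andP[/andP[j1 jn] Jj].
apply: IHn => [|a aP]; first by lia.
by apply: leFG; apply: cycle_list_cons; rewrite ?j1.
Qed.

Lemma eq_cycle_mean J n F G : (forall a, cycle_list J n a -> F a = G a) ->
  cycle_mean J n F = cycle_mean J n G.
Proof.
by move=> eFG; apply/eqP; rewrite eq_le !le_cycle_mean // => a /eFG ->.
Qed.

Lemma cycle_mean_sum J n (I : Type) (r : seq I) (Q : pred I)
    (F : I -> seq nat -> R) :
  cycle_mean J n (fun a => \sum_(i <- r | Q i) F i a) =
  \sum_(i <- r | Q i) cycle_mean J n (F i).
Proof.
elim/ltn_ind: n F => n IHn F.
have [->|n0] := posnP n; first by rewrite cycle_mean0.
apply: (mulfI (_ : n%:R != 0)); first by rewrite pnatr_eq0 -lt0n.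
rewrite cycle_meanS // mulr_sumr.
rewrite (eq_bigr _ (fun i _ => cycle_meanS J (F i) n0)) exchange_big /=.
rewrite big_nat_cond [RHS]big_nat_cond.
by apply: eq_bigr => j /andP[/andP[j1 jn] Jj]; apply: IHn; lia.
Qed.

Lemma cycle_meanZ J n c F :
  cycle_mean J n (fun a => c * F a) = c * cycle_mean J n F.
Proof.
elim/ltn_ind: n F => n IHn F.
have [->|n0] := posnP n; first by rewrite !cycle_mean0.
apply: (mulfI (_ : n%:R != 0)); first by rewrite pnatr_eq0 -lt0n.
rewrite cycle_meanS // mulrCA cycle_meanS // mulr_sumr.
rewrite big_nat_cond [RHS]big_nat_cond.
by apply: eq_bigr => j /andP[/andP[j1 jn] Jj]; apply: IHn; lia.
Qed.

Lemma cycle_meanD J n F G :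
  cycle_mean J n (fun a => F a + G a) = cycle_mean J n F + cycle_mean J n G.
Proof.
have /= := cycle_mean_sum J n [:: true; false] predT (fun e : bool => if e then F else G).
rewrite !big_cons !big_nil /= addr0 => <-.
by apply: eq_cycle_mean => a _; rewrite !big_cons !big_nil /= addr0.
Qed.

Lemma cycle_mean_ge0 J n F : (forall a, cycle_list J n a -> 0 <= F a) ->
  0 <= cycle_mean J n F.
Proof.
move=> F0; rewrite -(mul0r (cycle_mean J n F)) -cycle_meanZ.
by apply: le_cycle_mean => a /F0; rewrite mul0r.
Qed.

Lemma cycle_mean_eq0 J n F : (forall a, cycle_list J n a -> F a = 0) ->
  cycle_mean J n F = 0.
Proof.
move=> F0; rewrite -[RHS](mul0r (cycle_mean J n F)) -cycle_meanZ.
by apply: eq_cycle_mean => a /F0 ->; rewrite mul0r.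
Qed.

Lemma exchange_triangle (A B : pred nat) n (f : nat -> nat -> R) :
  \sum_(1 <= j < n.+1 | A j) \sum_(1 <= x < (n - j).+1 | B x) f j x =
  \sum_(1 <= x < n.+1 | B x) \sum_(1 <= j < (n - x).+1 | A j) f j x.
Proof.
have aux (A' B' : pred nat) (h : nat -> nat -> R) :
    \sum_(1 <= j < n.+1 | A' j) \sum_(1 <= x < (n - j).+1 | B' x) h j x =
    \sum_(1 <= j < n.+1) \sum_(1 <= x < n.+1)
      if [&& A' j, B' x & (j + x <= n)%N] then h j x else 0.
  rewrite big_mkcond /= big_nat_cond [RHS]big_nat_cond.
  apply: eq_bigr => j /andP[/andP[j1 jn] _].
  case: (A' j); last by rewrite big1.
  rewrite (big_nat_widen _ _ n.+1) /=; last by lia.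
  rewrite -big_mkcond /=; apply: eq_bigl => x.
  by case: (B' x) => //=; lia.
rewrite aux exchange_big /= aux; apply: eq_bigr => j _; apply: eq_bigr => x _.
by rewrite andbCA addnC.
Qed.

(* The Mecke formula: a marked cycle of length [x], weighted by [x], can be removed freely. *)
Lemma cycle_mean_mark J n (g : nat -> seq nat -> R) :
  (forall x, symmetric_fun (g x)) ->
  cycle_mean J n (fun a => \sum_(x <- a) x%:R * g x (rem x a)) =
  \sum_(1 <= j < n.+1 | J j) cycle_mean J (n - j) (g j).
Proof.
elim/ltn_ind: n g => n IHn g gsym.
have [->|n0] := posnP n.
  by rewrite cycle_mean0 big_nil big_geq.
apply: (mulfI (_ : n%:R != 0)); first by rewrite pnatr_eq0 -lt0n.
rewrite cycle_meanS //.
have step j a : \sum_(x <- j :: a) x%:R * g x (rem x (j :: a)) =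
  j%:R * g j a + \sum_(x <- a) x%:R * g x (j :: rem x a).
  rewrite big_cons [rem j _]/= eqxx; congr (_ + _).
  rewrite big_seq [RHS]big_seq; apply: eq_bigr => x xa.
  congr (_ * _); apply: gsym => /=; case: eqP => // ->.
  exact: perm_to_rem.
transitivity (\sum_(1 <= j < n.+1 | J j) (j%:R * cycle_mean J (n - j) (g j) +
   \sum_(1 <= x < (n - j).+1 | J x) cycle_mean J (n - j - x) (fun a => g x (j :: a)))).
  rewrite big_nat_cond [RHS]big_nat_cond.
  apply: eq_bigr => j /andP[/andP[j1 jn] _].
  rewrite -cycle_meanZ -(IHn (n - j)%N) ?subn_gt0; last 2 first.
  - lia.
  - by move=> x a b ab; apply: gsym; rewrite perm_cons.
  by rewrite -cycle_meanD; apply: eq_cycle_mean.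
rewrite big_split /= exchange_triangle -big_split /= mulr_sumr.
rewrite big_nat_cond [RHS]big_nat_cond.
apply: eq_bigr => x /andP[/andP[x1 xn] _].
have [nx|nx] := posnP (n - x)%N.
  have -> : x = n by lia.
  by rewrite subnn big_geq // addr0.
under eq_bigr => j _ do rewrite subnAC.
rewrite -(cycle_meanS J (g x) nx) -mulrDl -natrD.
by congr (_%:R * _); lia.
Qed.

Lemma exchange_shifted (A : pred nat) n (f : nat -> nat -> R) :
  \sum_(0 <= m < n.+1) \sum_(1 <= j < m.+1 | A j) f m j =
  \sum_(1 <= j < n.+1 | A j) \sum_(0 <= m < (n - j).+1) f (m + j)%N j.
Proof.
transitivity (\sum_(0 <= m < n.+1) \sum_(1 <= j < n.+1 | A j)
    if (j <= m)%N then f m j else 0).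
  apply: eq_big_nat => m /andP[_ mn].
  by rewrite (big_nat_widen _ _ n.+1) //= -big_mkcondr.
rewrite exchange_big /= big_nat_cond [RHS]big_nat_cond.
apply: eq_bigr => j /andP[/andP[j1 jn] _].
rewrite -big_mkcond /= (_ : (n - j).+1 = n.+1 - j)%N; last by lia.
rewrite -{2}[j]add0n -[in RHS](big_addn 0 n.+1 j predT (fun m => f m j)) add0n.
by rewrite [RHS](big_nat_widenl _ 0).
Qed.

Lemma exchange_lower (A : pred nat) n (f : nat -> nat -> R) :
  \sum_(0 <= m < n.+1) \sum_(1 <= j < (n - m).+1 | A j) f m j =
  \sum_(1 <= j < n.+1 | A j) \sum_(0 <= m < (n - j).+1) f m j.
Proof.
transitivity (\sum_(0 <= m < n.+1) \sum_(1 <= j < n.+1 | A j)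
    if (j + m <= n)%N then f m j else 0).
  apply: eq_big_nat => m /andP[_ mn].
  rewrite (big_nat_widen _ _ n.+1) /=; last by lia.
  rewrite -big_mkcondr; apply: eq_bigl => j; case: (A j) => //=; lia.
rewrite exchange_big /= big_nat_cond [RHS]big_nat_cond.
apply: eq_bigr => j /andP[/andP[j1 jn] _].
rewrite -big_mkcond /= [RHS](big_nat_widen _ _ n.+1) /=; last by lia.
by apply: eq_bigl => m; lia.
Qed.

(** In generating-function terms, the exponential of a sum factors. The proof writes
    [n = m + (n - m)]: the [m] share of the recursion removes a cycle in [J1], the other share one
    in [J2]. *)
Lemma cycle_mean_split J J1 J2 n F :
  (forall j, J j = J1 j || J2 j) -> (forall j, ~~ (J1 j && J2 j)) ->
  symmetric_fun F ->
  cycle_mean J n F = \sum_(0 <= m < n.+1)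
    cycle_mean J1 m (fun a => cycle_mean J2 (n - m) (fun b => F (b ++ a))).
Proof.
move=> JE J12; elim/ltn_ind: n F => n IHn F Fsym.
have [->|n0] := posnP n; first by rewrite big_nat1 !cycle_mean0.
apply: (mulfI (_ : n%:R != 0)); first by rewrite pnatr_eq0 -lt0n.
pose X m := cycle_mean J1 m (fun a => cycle_mean J2 (n - m) (fun b => F (b ++ a))).
pose h m j := cycle_mean J1 m
  (fun a => cycle_mean J2 (n - j - m) (fun b => F (j :: b ++ a))).
have symcons j : symmetric_fun (fun a => F (j :: a)).
  by move=> a b ab; apply: Fsym; rewrite perm_cons.
have nX : n%:R * \sum_(0 <= m < n.+1) X m =
    \sum_(0 <= m < n.+1) m%:R * X m + \sum_(0 <= m < n.+1) (n - m)%:R * X m.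
  rewrite -big_split mulr_sumr /=; apply: eq_big_nat => m /andP[_ mn].
  by rewrite -mulrDl -natrD; congr (_%:R * _); lia.
rewrite {}nX cycle_meanS //.
transitivity (\sum_(1 <= j < n.+1 | J j) \sum_(0 <= m < (n - j).+1) h m j).
  rewrite big_nat_cond [RHS]big_nat_cond.
  apply: eq_bigr => j /andP[/andP[j1 jn] _].
  rewrite IHn //; lia.
transitivity (\sum_(1 <= j < n.+1 | J1 j) \sum_(0 <= m < (n - j).+1) h m j +
              \sum_(1 <= j < n.+1 | J2 j) \sum_(0 <= m < (n - j).+1) h m j).
  rewrite big_mkcond [X in X + _]big_mkcond [X in _ + X]big_mkcond -big_split /=.
  apply: eq_bigr => j _; rewrite JE; have := J12 j.
  by case: (J1 j); case: (J2 j) => //= _; rewrite ?addr0 ?add0r.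
congr (_ + _).
  transitivity (\sum_(0 <= m < n.+1) \sum_(1 <= j < m.+1 | J1 j) h (m - j)%N j).
    rewrite exchange_shifted; apply: eq_bigr => j _; apply: eq_bigr => m _.
    by rewrite addnK.
  apply: eq_big_nat => m /andP[_ mn].
  have [->|m0] := posnP m; first by rewrite mul0r big_geq.
  rewrite /X cycle_meanS // big_nat_cond [RHS]big_nat_cond.
  apply: eq_bigr => j /andP[/andP[j1 jm] _].
  rewrite /h (_ : n - j - (m - j) = n - m)%N; last by lia.
  apply: eq_cycle_mean => a _; apply: eq_cycle_mean => b _.
  by apply: Fsym; rewrite -[j :: b ++ a]cat1s perm_catCA ?cat1s.
rewrite -exchange_lower; apply: eq_big_nat => m /andP[_ mn].
have [nm|nm] := posnP (n - m)%N; first by rewrite nm mul0r big_geq.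
rewrite /X -cycle_meanZ /h -cycle_mean_sum.
apply: eq_cycle_mean => a _; rewrite cycle_meanS //.
by apply: eq_bigr => j _; rewrite subnAC.
Qed.

Lemma cycle_mean_mark_unweighted J n (g : nat -> seq nat -> R) :
  (forall x, symmetric_fun (g x)) ->
  cycle_mean J n (fun a => \sum_(x <- a) g x (rem x a)) =
  \sum_(1 <= j < n.+1 | J j) j%:R^-1 * cycle_mean J (n - j) (g j).
Proof.
move=> gsym.
under eq_bigr => j _ do rewrite -cycle_meanZ.
rewrite -(cycle_mean_mark J n (g := fun x a => x%:R^-1 * g x a)); last first.
  by move=> x a b ab; rewrite (gsym x a b ab).
apply: eq_cycle_mean => a /and3P[_ /allP apos _].
rewrite big_seq [RHS]big_seq; apply: eq_bigr => x /apos x0.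
by rewrite mulrA mulfV ?mul1r // pnatr_eq0 -lt0n.
Qed.

(** The sum over all cycle structures of total length at most [M] with lengths in [J], each weighted
    by the product of [1 / (j^c_j c_j!)]. *)
Definition cycle_total J (M : nat) F := \sum_(0 <= m < M.+1) cycle_mean J m F.

Lemma cycle_total_mark J M (g : nat -> seq nat -> R) :
  (forall x, symmetric_fun (g x)) ->
  cycle_total J M (fun a => \sum_(x <- a) g x (rem x a)) =
  \sum_(1 <= j < M.+1 | J j) j%:R^-1 * cycle_total J (M - j) (g j).
Proof.
move=> gsym; rewrite /cycle_total.
under eq_bigr => m _ do rewrite cycle_mean_mark_unweighted //.
rewrite exchange_shifted; apply: eq_bigr => j _.
by rewrite mulr_sumr; apply: eq_bigr => m _; rewrite addnK.
Qed.

Lemma le_cycle_total J M F G :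
  (forall a, all J a -> all (fun j => (0 < j)%N) a -> (sumn a <= M)%N ->
    F a <= G a) ->
  cycle_total J M F <= cycle_total J M G.
Proof.
move=> FG; rewrite /cycle_total big_nat_cond [leRHS]big_nat_cond.
apply: ler_sum => m /andP[/andP[_ mM] _]; apply: le_cycle_mean.
by move=> a /and3P[Ja a0 /eqP am]; apply: FG; rewrite // am -ltnS.
Qed.

Lemma eq_cycle_total J M F G :
  (forall a, all J a -> all (fun j => (0 < j)%N) a -> (sumn a <= M)%N ->
    F a = G a) ->
  cycle_total J M F = cycle_total J M G.
Proof.
by move=> FG; apply/eqP; rewrite eq_le !le_cycle_total // => a *; rewrite FG.
Qed.

Lemma cycle_total_ge0 J M F : (forall a, 0 <= F a) -> 0 <= cycle_total J M F.
Proof. by move=> F0; apply: sumr_ge0 => m _; apply: cycle_mean_ge0. Qed.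

Lemma cycle_total_sum J M (I : Type) (r : seq I) (Q : pred I)
    (F : I -> seq nat -> R) :
  cycle_total J M (fun a => \sum_(i <- r | Q i) F i a) =
  \sum_(i <- r | Q i) cycle_total J M (F i).
Proof.
by rewrite /cycle_total exchange_big; apply: eq_bigr => m _; apply: cycle_mean_sum.
Qed.

Lemma cycle_totalZ J M c F :
  cycle_total J M (fun a => c * F a) = c * cycle_total J M F.
Proof.
by rewrite /cycle_total mulr_sumr; apply: eq_bigr => m _; apply: cycle_meanZ.
Qed.

Lemma cycle_total_mono J M M' F : (forall a, 0 <= F a) -> (M <= M')%N ->
  cycle_total J M F <= cycle_total J M' F.
Proof.
move=> F0 MM'; rewrite /cycle_total [leRHS](@big_cat_nat _ _ _ M.+1) //=.
by rewrite lerDl; apply: sumr_ge0 => m _; apply: cycle_mean_ge0.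
Qed.

Lemma size_rem_eq (a : seq nat) x n : x \in a ->
  (size (rem x a) == n) = (size a == n.+1).
Proof. by move=> xa; rewrite size_rem //; case: a xa. Qed.

(** A list of length [n.+1] has [n.+1] choices of a marked entry, each leaving a list of length
    [n]. *)
Lemma cycle_total_sizeS J M n F : symmetric_fun F ->
  n.+1%:R * cycle_total J M (fun a => (size a == n.+1)%:R * F a) =
  \sum_(1 <= j < M.+1 | J j)
    j%:R^-1 * cycle_total J (M - j) (fun a => (size a == n)%:R * F (j :: a)).
Proof.
move=> Fs; rewrite -cycle_total_mark; last first.
  move=> x a b ab; rewrite (perm_size ab); congr (_ * _).
  by apply: Fs; rewrite perm_cons.
rewrite -cycle_totalZ; apply: eq_cycle_total => a _ _ _.
transitivity (\sum_(x <- a) ((size a == n.+1)%:R * F a)).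
  rewrite big_const_seq count_predT iter_addr_0 -[_ *+ size a]mulr_natl.
  by case: eqP => [->|]; rewrite ?mul0r ?mulr0.
rewrite big_seq [RHS]big_seq; apply: eq_bigr => x xa.
rewrite size_rem_eq //; congr (_ * _); apply: Fs; exact: perm_to_rem.
Qed.

(** [cycle_total_sizeS] removes one cycle at a time, and lowering [M] to [M - j] only decreases the
    harmonic sum; the result is a Poisson weight. *)
Lemma cycle_total_size_le J M n (lam : R) :
  \sum_(1 <= j < M.+1 | J j) j%:R^-1 <= lam ->
  cycle_total J M (fun a => (size a == n)%:R) <= lam ^+ n / n`!%:R.
Proof.
elim: n M => [|n IHn] M leM.
  rewrite expr0 fact0 divr1 /cycle_total big_nat_recl // cycle_mean0 /=.
  rewrite big_nat_cond big1 ?addr0 // => m _.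
  apply: cycle_mean_eq0 => a /and3P[_ _ /eqP am].
  by case: a am.
have lam0 : 0 <= lam.
  by apply: le_trans leM; apply: sumr_ge0 => j _; rewrite invr_ge0 ler0n.
have n0 : 0 < n.+1%:R :> R by rewrite ltr0n.
rewrite -(ler_pM2l n0).
rewrite (@eq_cycle_total _ _ _ (fun a => (size a == n.+1)%:R * 1)); last first.
  by move=> a _ _ _; rewrite mulr1.
rewrite cycle_total_sizeS //.
have -> : n.+1%:R * (lam ^+ n.+1 / (n.+1)`!%:R) = lam * (lam ^+ n / n`!%:R).
  rewrite factS natrM invfM exprS.
  by field; rewrite pnatr_eq0 -lt0n fact_gt0 /= addrC natr1 pnatr_eq0.
apply: (@le_trans _ _
  (\sum_(1 <= j < M.+1 | J j) j%:R^-1 * (lam ^+ n / n`!%:R))); last first.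
  by rewrite -mulr_suml ler_wpM2r // divr_ge0 ?exprn_ge0 ?ler0n.
rewrite big_nat_cond [leRHS]big_nat_cond.
apply: ler_sum => j /andP[/andP[j1 jM] Jj].
apply: ler_wpM2l; first by rewrite invr_ge0 ler0n.
rewrite (@eq_cycle_total _ _ _ (fun a => (size a == n)%:R)); last first.
  by move=> a _ _ _; rewrite mulr1.
apply: IHn; apply: le_trans leM.
rewrite [leRHS](@big_cat_nat _ _ _ (M - j).+1) //=; last by lia.
by rewrite lerDl; apply: sumr_ge0 => i _; rewrite invr_ge0 ler0n.
Qed.

Lemma size_le_sumn (a : seq nat) : all (fun j => (0 < j)%N) a ->
  (size a <= sumn a)%N.
Proof. by elim: a => //= j a IHa /andP[j0 /IHa]; lia. Qed.

Lemma cycle_total_size J M (lam : R) (G : nat -> R) (K : nat) :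
  \sum_(1 <= j < M.+1 | J j) j%:R^-1 <= lam -> (forall n, 0 <= G n) ->
  (M < K)%N ->
  cycle_total J M (fun a => G (size a)) <=
  \sum_(0 <= n < K) lam ^+ n / n`!%:R * G n.
Proof.
move=> leM G0 MK.
rewrite (@eq_cycle_total _ _ _
  (fun a => \sum_(0 <= n < K) G n * (size a == n)%:R)); last first.
  move=> a _ /size_le_sumn sa aM.
  rewrite (bigD1_seq (size a)) ?iota_uniq //=; last by rewrite mem_iota; lia.
  rewrite eqxx mulr1 big1 ?addr0 // => i /negPf; rewrite eq_sym => ->.
  by rewrite mulr0.
rewrite cycle_total_sum; apply: ler_sum => n _.
by rewrite cycle_totalZ mulrC ler_wpM2r // cycle_total_size_le.
Qed.

(** The pairs of totals with sum at most [M] lie in the square of side [M]. *)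
Lemma cycle_total_split_le J J1 J2 M F :
  (forall j, J j = J1 j || J2 j) -> (forall j, ~~ (J1 j && J2 j)) ->
  symmetric_fun F -> (forall a, 0 <= F a) ->
  cycle_total J M F <=
  cycle_total J1 M (fun a => cycle_total J2 M (fun b => F (b ++ a))).
Proof.
move=> JE J12 Fs F0; rewrite /cycle_total.
under eq_bigr => n _ do rewrite (cycle_mean_split _ JE J12) //.
under [leRHS]eq_bigr => m _ do rewrite cycle_mean_sum.
apply: (@le_trans _ _ (\sum_(0 <= n < M.+1) \sum_(0 <= m < M.+1)
   if (m <= n)%N then cycle_mean J1 m (fun a => cycle_mean J2 (n - m) (fun b => F (b ++ a))) else 0)).
  rewrite big_nat_cond [leRHS]big_nat_cond.
  apply: ler_sum => n /andP[/andP[_ nM] _].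
  by rewrite (big_nat_widen _ _ M.+1) //= -big_mkcond.
rewrite exchange_big /= big_nat_cond [leRHS]big_nat_cond.
apply: ler_sum => m /andP[/andP[_ mM] _].
rewrite -big_mkcond /= -[X in X <= _](big_nat_widenl m 0 M.+1 predT) //.
rewrite -{1}[m]add0n big_addn.
under eq_bigr => n _ do rewrite addnK.
rewrite [leRHS](@big_cat_nat _ _ _ (M.+1 - m)) //=; last by lia.
rewrite lerDl; apply: sumr_ge0 => n _.
by apply: cycle_mean_ge0 => a _; apply: cycle_mean_ge0.
Qed.

(** The rectangle [M1] by [M2] lies in the triangle of pairs of totals with sum at most [M]. *)
Lemma cycle_total_split_ge J J1 J2 M M1 M2 F :
  (forall j, J j = J1 j || J2 j) -> (forall j, ~~ (J1 j && J2 j)) ->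
  symmetric_fun F -> (forall a, 0 <= F a) -> (M1 + M2 <= M)%N ->
  cycle_total J1 M1 (fun a => cycle_total J2 M2 (fun b => F (b ++ a))) <=
  cycle_total J M F.
Proof.
move=> JE J12 Fs F0 M12; rewrite /cycle_total.
under [leRHS]eq_bigr => n _ do rewrite (cycle_mean_split _ JE J12) //.
under [leLHS]eq_bigr => m _ do rewrite cycle_mean_sum.
have pos m n : 0 <= cycle_mean J1 m (fun a => cycle_mean J2 n (fun b => F (b ++ a))).
  by apply: cycle_mean_ge0 => a _; apply: cycle_mean_ge0.
apply: (@le_trans _ _ (\sum_(0 <= n < M.+1) \sum_(0 <= m < M.+1)
   if (m <= n)%N then cycle_mean J1 m (fun a => cycle_mean J2 (n - m) (fun b => F (b ++ a))) else 0)); last first.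
  rewrite [leLHS]big_nat_cond [leRHS]big_nat_cond.
  apply: ler_sum => n /andP[/andP[_ nM] _].
  by rewrite [leRHS](big_nat_widen _ _ M.+1) //= -big_mkcond.
rewrite [leRHS]exchange_big /=.
rewrite [leRHS](@big_cat_nat _ _ _ M1.+1) //=; last by lia.
apply: ler_wpDr; first by do 2!(apply: sumr_ge0 => ? _); case: ifP.
rewrite [leLHS]big_nat_cond [leRHS]big_nat_cond.
apply: ler_sum => m /andP[/andP[_ mM] _].
rewrite -big_mkcond /= -[X in _ <= X](big_nat_widenl m 0 M.+1 predT) //.
rewrite -[m in leRHS]add0n big_addn.
under [leRHS]eq_bigr => n _ do rewrite add0n addnK.
rewrite [leRHS](@big_cat_nat _ _ _ M2.+1) //=; last by lia.
by rewrite lerDl; apply: sumr_ge0 => n _.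
Qed.

End CycleMeasure.

(** * Long cycles, and sums over ordered lists from a block *)

Section MassAndBlocks.
Variable R : realFieldType.
Implicit Types (J : pred nat) (F G : seq nat -> R) (a b : seq nat).

Lemma long_cycles_meanS k m : (k < m)%N ->
  m%:R * cycle_mean (fun j => k < j)%N m (fun=> 1 : R) =
  \sum_(k.+1 <= j < m) cycle_mean (fun j => k < j)%N (m - j) (fun=> 1 : R) + 1.
Proof.
move=> km; rewrite cycle_meanS; last by lia.
rewrite [LHS](eq_bigl (fun j => predT j && (k.+1 <= j)%N)) //.
rewrite -(big_nat_widenl k.+1 1 m.+1 predT) // big_nat_recr //=.
by rewrite subnn cycle_mean0.
Qed.

(** By induction, for [m > k], [m] times the left side is at most
    [1 + (m - k - 1) / (k + 1) = m / (k + 1)]. *)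
Lemma long_cycles_le k m : (0 < m)%N ->
  cycle_mean (fun j => k < j)%N m (fun=> 1 : R) <= k.+1%:R^-1.
Proof.
elim/ltn_ind: m => m IHm m0.
have mR : 0 < m%:R :> R by rewrite ltr0n.
rewrite -(ler_pM2l mR).
have [mk|km] := leqP m k.
  rewrite cycle_meanS // big_nat_cond big1; last by move=> j; lia.
  by rewrite divr_ge0 ?ler0n.
rewrite long_cycles_meanS //.
apply: (@le_trans _ _ (\sum_(k.+1 <= j < m) k.+1%:R^-1 + 1)).
  rewrite lerD2r big_nat_cond [leRHS]big_nat_cond.
  by apply: ler_sum => j /andP[/andP[kj jm] _]; apply: IHm; lia.
rewrite sumr_const_nat -[_^-1 *+ _]mulr_natl natrB //.
by rewrite mulrBl mulfV ?subrK // pnatr_eq0.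
Qed.

Lemma long_cycles_ge k m : (k < m)%N ->
  (2 * k).+1%:R^-1 <= cycle_mean (fun j => k < j)%N m (fun=> 1 : R).
Proof.
elim/ltn_ind: m => m IHm km.
have mR : 0 < m%:R :> R by rewrite ltr0n; lia.
have kR : 0 < (2 * k).+1%:R :> R by rewrite ltr0n.
rewrite -(ler_pM2l mR) long_cycles_meanS //.
have pos j : 0 <= cycle_mean (fun j => k < j)%N j (fun=> 1 : R).
  by apply: cycle_mean_ge0 => a _.
have [mk|mk] := leqP m (2 * k).+1.
  apply: (@le_trans _ _ 1); first by rewrite ler_pdivrMr // mul1r ler_nat.
  by rewrite lerDr sumr_ge0.
(* For [j >= m - k] the remainder has between 1 and [k] points and no long cycle fits in it; these
   terms are dropped. The other [m - (2 k + 1)] terms suffice. *)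
apply: (@le_trans _ _ (\sum_(k.+1 <= j < m - k) (2 * k).+1%:R^-1 + 1)).
  rewrite sumr_const_nat -[_^-1 *+ _]mulr_natl.
  rewrite (_ : (m - k - k.+1) = m - (2 * k).+1)%N; last by lia.
  rewrite natrB; last by lia.
  by rewrite mulrBl mulfV ?subrK // lt0r_neq0.
rewrite lerD2r [leRHS](@big_cat_nat _ _ _ (m - k)) /=; [|lia|lia].
apply: ler_wpDr; first by rewrite sumr_ge0.
rewrite big_nat_cond [leRHS]big_nat_cond.
by apply: ler_sum => j /andP[/andP[kj jm] _]; apply: IHm; lia.
Qed.

Lemma long_cycles_total_le k n : (0 < k <= n)%N ->
  cycle_total (fun j => k < j)%N n (fun=> 1 : R) <= 2 * n%:R / k%:R.
Proof.
move=> /andP[k0 kn]; rewrite /cycle_total big_nat_recl // cycle_mean0.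
have kR : 0 < k%:R :> R by rewrite ltr0n.
apply: (@le_trans _ _ (1 + \sum_(0 <= i < n) k%:R^-1)).
  rewrite lerD2l; apply: ler_sum => i _.
  apply: le_trans (long_cycles_le _ _) _ => //.
  by rewrite lef_pV2 ?posrE ?ltr0n // ler_nat.
rewrite sumr_const_nat subn0 -[_ *+ n]mulr_natl mulrDl mul1r mulrDl lerD2r.
by rewrite ler_pdivlMr // mul1r ler_nat.
Qed.

(* Sum over all lists of length [x] with entries in [J], weighted by the inverse of the product of the entries. *)
Fixpoint block_sum J (w x : nat) F : R :=
  if x is y.+1
  then block_sum J w y (fun a => \sum_(1 <= j < w.+1 | J j) j%:R^-1 * F (j :: a))
  else F [::].

(** Counterpart of [cycle_total_size_le]: [x!] is the number of orderings, and [x * w <= M] ensures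
    that the truncation excludes none of the lists. *)
Lemma block_sum_le_total J w x M F : (forall j, J j -> (j <= w)%N) ->
  symmetric_fun F -> (forall a, 0 <= F a) -> (x * w <= M)%N ->
  block_sum J w x F / x`!%:R <= cycle_total J M (fun a => (size a == x)%:R * F a).
Proof.
move=> Jw; elim: x M F => [|x IHx] M F Fs F0 xM /=.
  rewrite fact0 divr1 /cycle_total big_nat_recl // cycle_mean0 eqxx mul1r.
  rewrite lerDl; apply: sumr_ge0 => m _; apply: cycle_mean_ge0 => a _.
  by rewrite mulr_ge0.
have x0 : 0 < x.+1%:R :> R by rewrite ltr0n.
rewrite -(ler_pM2l x0) cycle_total_sizeS //.
set F' := fun a => _.
have F's : symmetric_fun F'.
  move=> a b ab; apply: eq_bigr => j _; congr (_ * _).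
  by apply: Fs; rewrite perm_cons.
have F'0 a : 0 <= F' a.
  by apply: sumr_ge0 => j _; rewrite mulr_ge0 // invr_ge0 ler0n.
have -> : x.+1%:R * (block_sum J w x F' / (x.+1)`!%:R) = block_sum J w x F' / x`!%:R.
  rewrite factS natrM invfM.
  by field; rewrite pnatr_eq0 -lt0n fact_gt0 /= addrC natr1 pnatr_eq0.
apply: le_trans (IHx (M - w)%N F' F's F'0 _) _; first by lia.
rewrite (@eq_cycle_total _ _ _ _ (fun a => \sum_(1 <= j < w.+1 | J j)
    j%:R^-1 * ((size a == x)%:R * F (j :: a)))); last first.
  move=> a _ _ _; rewrite mulr_sumr; apply: eq_bigr => j _.
  by rewrite mulrCA.
rewrite cycle_total_sum.
rewrite [leRHS](@big_cat_nat _ _ _ w.+1) /=; [|lia|lia].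
apply: ler_wpDr.
  apply: sumr_ge0 => j _; rewrite mulr_ge0 ?invr_ge0 ?ler0n //.
  by apply: cycle_total_ge0 => a; rewrite mulr_ge0.
rewrite big_nat_cond [leRHS]big_nat_cond.
apply: ler_sum => j /andP[/andP[j1 jw] _].
rewrite cycle_totalZ ler_wpM2l ?invr_ge0 ?ler0n //.
by apply: cycle_total_mono => [a|]; [rewrite mulr_ge0|lia].
Qed.

Lemma eq_block_sum J w x F G : (forall a, size a = x -> F a = G a) ->
  block_sum J w x F = block_sum J w x G.
Proof.
elim: x F G => [|x IHx] F G FG /=; first by rewrite FG.
apply: IHx => a ax; apply: eq_bigr => j _; by rewrite FG //= ax.
Qed.

Lemma le_block_sum J w x F G : (forall a, size a = x -> F a <= G a) ->
  block_sum J w x F <= block_sum J w x G.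
Proof.
elim: x F G => [|x IHx] F G FG /=; first by rewrite FG.
apply: IHx => a ax; apply: ler_sum => j _.
by rewrite ler_wpM2l ?invr_ge0 ?ler0n // FG //= ax.
Qed.

Lemma block_sum_lin J w x c d F G :
  block_sum J w x (fun a => c * F a + d * G a) =
  c * block_sum J w x F + d * block_sum J w x G.
Proof.
elim: x F G => [|x IHx] F G //=; rewrite -IHx; apply: eq_block_sum => a _.
rewrite !mulr_sumr -big_split /=; apply: eq_bigr => j _; ring.
Qed.

Lemma block_sum_cst J w x c :
  block_sum J w x (fun=> c) = c * (\sum_(1 <= j < w.+1 | J j) j%:R^-1) ^+ x.
Proof.
elim: x c => [|x IHx] c /=; first by rewrite expr0 mulr1.
rewrite -mulr_suml IHx exprS; ring.
Qed.

End MassAndBlocks.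

(** * Subset sums *)

Section SubsetSums.
Implicit Types (a b c : seq nat).

(** One entry per subset, with repetition, so that multiplicities count the subsets with a given
    sum. *)
Fixpoint subset_sums a : seq nat :=
  if a is x :: a' then subset_sums a' ++ [seq (x + v)%N | v <- subset_sums a']
  else [:: 0%N].

Definition num_sums a := size (undup (subset_sums a)).

Lemma size_subset_sums a : size (subset_sums a) = (2 ^ size a)%N.
Proof. by elim: a => //= x a IHa; rewrite size_cat size_map IHa expnS; lia. Qed.

Lemma mem_subset_sums_cons x a v : (v \in subset_sums (x :: a)) =
  (v \in subset_sums a) || ((x <= v)%N && ((v - x)%N \in subset_sums a)).
Proof.
rewrite /= mem_cat; congr (_ || _); apply/mapP/andP => [[u uP ->]|[xv vP]].
  by rewrite leq_addr addKn.
by exists (v - x)%N => //; rewrite subnKC.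
Qed.

Lemma subset_sums_catP b a v :
  reflect (exists u w, [/\ u \in subset_sums b, w \in subset_sums a & v = (u + w)%N])
    (v \in subset_sums (b ++ a)).
Proof.
apply: (iffP idP).
  elim: b v => [|x b IHb] v; first by exists 0%N, v; split.
  rewrite [_ ++ a]/= mem_subset_sums_cons => /orP[/IHb[u [w [uP wP ->]]]|].
    by exists u, w; split=> //; rewrite mem_subset_sums_cons uP.
  move=> /andP[xv /IHb[u [w [uP wP E]]]]; exists (x + u)%N, w; split=> //.
    by rewrite mem_subset_sums_cons leq_addr addKn uP orbT.
  by rewrite -addnA -E subnKC.
case=> u [w [uP wP ->]]; elim: b u uP => [|x b IHb] u.
  by rewrite inE => /eqP ->; rewrite add0n.
rewrite mem_subset_sums_cons [_ ++ a]/= mem_subset_sums_cons.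
case/orP=> [/IHb -> //|/andP[xu /IHb uP]].
by rewrite -addnBAC // uP (leq_trans xu (leq_addr _ _)) orbT.
Qed.

Lemma perm_subset_sums a b : perm_eq a b -> subset_sums a =i subset_sums b.
Proof.
elim: a b => [|x a IHa] b; first by rewrite perm_sym => /perm_nilP ->.
move=> xab; have xb : x \in b by rewrite -(perm_mem xab) mem_head.
case/splitPr: xb xab => b1 b2 xab v.
have ab : perm_eq a (b1 ++ b2).
  by rewrite -(perm_cons x) (perm_trans xab) // -cat1s perm_catCA.
rewrite mem_subset_sums_cons !(IHa _ ab).
apply/orP/subset_sums_catP => [[|/andP[xv]]|[u [w [uP]]]].
- case/subset_sums_catP=> u [w [uP wP ->]]; exists u, w; split=> //.
  by rewrite mem_subset_sums_cons wP.
- case/subset_sums_catP=> u [w [uP wP E]]; exists u, (x + w)%N; split=> //.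
    by rewrite mem_subset_sums_cons leq_addr addKn wP orbT.
  by rewrite addnCA -E subnKC.
rewrite mem_subset_sums_cons => /orP[wP ->|/andP[xw wP] ->]; [left|right].
  by apply/subset_sums_catP; exists u, w.
rewrite (leq_trans xw (leq_addl _ _)) -addnBA //=.
by apply/subset_sums_catP; exists u, (w - x)%N.
Qed.

Lemma perm_num_sums a b : perm_eq a b -> num_sums a = num_sums b.
Proof.
move=> ab; apply: perm_size; apply: uniq_perm; rewrite ?undup_uniq // => v.
by rewrite !mem_undup; apply: perm_subset_sums.
Qed.

Lemma subset_sums_le a v : v \in subset_sums a -> (v <= sumn a)%N.
Proof.
elim: a v => [|x a IHa] v; first by rewrite inE => /eqP ->.
by rewrite mem_subset_sums_cons /= => /orP[/IHa|/andP[xv /IHa]]; lia.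
Qed.

Lemma mem_subset_sums0 a : 0%N \in subset_sums a.
Proof. by elim: a => //= x a IHa; rewrite mem_cat IHa. Qed.

Lemma subset_sums_split a v : v \in subset_sums a ->
  exists b c, perm_eq a (b ++ c) /\ sumn b = v.
Proof.
elim: a v => [|x a IHa] v; first by rewrite inE => /eqP ->; exists [::], [::].
rewrite mem_subset_sums_cons => /orP[/IHa|/andP[xv /IHa]] [b [c [abc bv]]].
  exists b, (x :: c); split=> //.
  by rewrite perm_sym -cat1s perm_catCA cat1s perm_cons perm_sym.
by exists (x :: b), c; split; rewrite ?perm_cons //= bv subnKC.
Qed.

Lemma mem_sumn_cat b c : sumn b \in subset_sums (b ++ c).
Proof.
apply/subset_sums_catP; exists (sumn b), 0%N.
rewrite addn0 mem_subset_sums0; split=> //.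
elim: b => //= x b IHb; rewrite mem_cat; apply/orP; right.
by apply/mapP; exists (sumn b).
Qed.

Lemma num_sums_cat b a : (num_sums (b ++ a) <= 2 ^ size b * num_sums a)%N.
Proof.
rewrite -size_subset_sums /num_sums -(size_allpairs addn).
apply: uniq_leq_size; first exact: undup_uniq.
move=> v; rewrite mem_undup => /subset_sums_catP[u [w [uP wP ->]]].
by apply: allpairs_f => //; rewrite mem_undup.
Qed.

Lemma num_sums_le_sumn a : (num_sums a <= (sumn a).+1)%N.
Proof.
rewrite /num_sums -[leqRHS](size_iota 0); apply: uniq_leq_size.
  exact: undup_uniq.
by move=> v; rewrite mem_undup => /subset_sums_le; rewrite mem_iota; lia.
Qed.

(** The additive energy: the number of pairs of subsets with equal sums. In the same way [sum_shift]
    counts the pairs whose sums differ by [x]. *)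
Definition sum_energy a := (\sum_(u <- subset_sums a) count_mem u (subset_sums a))%N.

Definition sum_shift a x :=
  (\sum_(u <- subset_sums a) count_mem (x + u)%N (subset_sums a))%N.

(** In a pair of subsets of [x :: a], either both or neither contain [x], or exactly one does: two
    cases of each kind. *)
Lemma sum_energy_cons x a :
  (sum_energy (x :: a) = 2 * sum_energy a + 2 * sum_shift a x)%N.
Proof.
rewrite /sum_energy /= big_cat /= big_map.
have cnt (u : nat) (s : seq nat) : count_mem u s = (\sum_(v <- s) (v == u))%N.
  by rewrite -sum1_count big_mkcond /=; apply: eq_bigr => v _; case: eqP.
under eq_bigr => u _ do rewrite count_cat.
under [X in (_ + X)%N]eq_bigr => u _ do rewrite count_cat.
rewrite !big_split /=.
rewrite -/(sum_shift a x).
have -> : (\sum_(u <- subset_sums a) count_mem (x + u) [seq x + v | v <- subset_sums a] = sum_energy a)%N.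
  apply: eq_bigr => u _; rewrite count_map; apply: eq_count => v /=.
  by rewrite eqn_add2l.
have -> : (\sum_(u <- subset_sums a) count_mem u [seq x + v | v <- subset_sums a] = sum_shift a x)%N.
  rewrite /sum_shift; under eq_bigr => u _ do rewrite count_map -sum1_count big_mkcond.
  rewrite exchange_big /=; apply: eq_bigr => u _.
  by rewrite cnt; apply: eq_bigr => v _; rewrite eq_sym; case: eqP.
rewrite -/(sum_energy a); lia.
Qed.

(** Each pair of subsets has a single difference of sums, so it is counted for at most one [x]. *)
Lemma sum_shift_range a (m n : nat) :
  (\sum_(m <= x < n) sum_shift a x <= 4 ^ size a)%N.
Proof.
rewrite /sum_shift exchange_big /=.
apply: (@leq_trans (\sum_(u <- subset_sums a) 2 ^ size a)).
  apply: leq_sum => u _.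
  under eq_bigr => x _ do rewrite -sum1_count.
  rewrite (exchange_big_dep predT) //= -size_subset_sums -sum1_size.
  apply: leq_sum => v _.
  have [xs|xs] := boolP (v - u \in index_iota m n)%N; last first.
    rewrite big1_seq // => x /andP[/eqP E xm].
    by move: xs; rewrite E addnK xm.
  rewrite big_mkcond (bigD1_seq (v - u)%N) ?iota_uniq //= big1 ?addn0.
    by case: ifP.
  move=> x xvu; case: eqP => // E; move: xvu; rewrite E; lia.
by rewrite big_const_seq count_predT iter_addn_0 size_subset_sums -expnMn.
Qed.

Variable R : realFieldType.

(* A linearised Cauchy-Schwarz inequality: each value taken [c] times costs [2 * al * c - al ^+ 2 * c ^+ 2 <= 1]. *)
Lemma num_sums_ge_energy a (al : R) :
  2 * al * (2 ^ size a)%:R - al ^+ 2 * (sum_energy a)%:R <= (num_sums a)%:R.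
Proof.
rewrite -size_subset_sums.
set s := subset_sums a.
have sumE (F : nat -> R) :
    \sum_(u <- s) F u = \sum_(v <- undup s) F v *+ count_mem v s.
  by rewrite -[LHS]big_undup_iterop_count.
rewrite -sum1_size natr_sum sumE /sum_energy natr_sum sumE.
rewrite !mulr_sumr -sumrB /num_sums -/s -sum1_size natr_sum.
apply: ler_sum => v _; rewrite -subr_ge0.
rewrite (_ : _ - _ = (1 - al * (count_mem v s)%:R) ^+ 2) ?sqr_ge0 //.
by rewrite -(mulr_natr (count_mem v s)%:R) -/s; ring.
Qed.

End SubsetSums.

(** * From invariant sets to the mean number of subset sums *)

Section LocalGlobal.
Variable R : realFieldType.
Implicit Types (J : pred nat) (F G : seq nat -> R) (a b c : seq nat).

Lemma perm_rem a b x : x \in a -> perm_eq (rem x a) b = perm_eq a (x :: b).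
Proof.
by move=> xa; rewrite -(perm_cons x) !(permPl (perm_to_rem xa)).
Qed.

Lemma perm_rem_catl x b c : x \in b -> perm_eq (rem x (b ++ c)) (rem x b ++ c).
Proof.
move=> xb; rewrite perm_rem ?mem_cat ?xb // -cat_cons perm_cat2r.
exact: perm_to_rem.
Qed.

Lemma perm_rem_catr x b c : x \in c -> perm_eq (rem x (b ++ c)) (b ++ rem x c).
Proof.
move=> xc; rewrite perm_rem ?mem_cat ?xc ?orbT // -cat1s perm_sym perm_catCA.
by rewrite perm_sym perm_cat2l; exact: perm_to_rem.
Qed.

Definition invariant_mean n k : R :=
  cycle_mean predT n (fun a => (k \in subset_sums a)%:R).

Definition num_sums_lt k a := count (fun v => v < k)%N (undup (subset_sums a)).

Lemma symmetric_marked_sum (S : seq nat -> nat -> R) :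
  (forall x, symmetric_fun (fun a => S a x)) ->
  symmetric_fun (fun a => \sum_(x <- a) S (rem x a) x).
Proof.
move=> Ss a b ab; rewrite (perm_big b ab) big_seq [RHS]big_seq /=.
apply: eq_bigr => x xb; apply: Ss.
rewrite perm_rem ?(perm_mem ab) // (permPl ab).
exact: perm_to_rem.
Qed.

Lemma symmetric_mem_sums (T : Type) (f : bool -> T) v :
  symmetric_fun (fun a => f (v \in subset_sums a)).
Proof. by move=> a b ab; rewrite (perm_subset_sums ab). Qed.

(** Whether a cycle of length [x] and some cycles of [a] make up [k] points. The guard [x <= k] is
    there because subtraction truncates and [0] is always a subset sum. *)
Definition reach k x a : R := ((x <= k)%N && ((k - x)%N \in subset_sums a))%:R.

Lemma reach_sym k x : symmetric_fun (reach k x).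
Proof. by apply: (symmetric_mem_sums (fun e => ((x <= k)%N && e)%:R)). Qed.

(* Mark one cycle inside an invariant set of size [k] and one outside it: the lengths of the cycles on each side add up to [k] and [n - k]. *)
Lemma double_mark_le n k a : sumn a = n -> (k <= n)%N ->
  k%:R * (n - k)%:R * (k \in subset_sums a)%:R <=
  \sum_(x <- a) x%:R * \sum_(y <- rem x a) y%:R * reach k x (rem y (rem x a)).
Proof.
move=> an kn; have pos c x y : 0 <= y%:R * reach k x c by rewrite mulr_ge0 ?ler0n.
have [ka|_] := boolP (k \in subset_sums a); last first.
  by rewrite mulr0; apply: sumr_ge0 => x _; rewrite mulr_ge0 ?ler0n ?sumr_ge0.
rewrite mulr1; have [b [c [abc bk]]] := subset_sums_split ka.
have cn : sumn c = (n - k)%N.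
  by rewrite -an (perm_sumn abc) sumn_cat bk addKn.
pose S2 x a' := \sum_(y <- a') y%:R * reach k x (rem y a').
have S2s x : symmetric_fun (S2 x).
  apply: (symmetric_marked_sum (S := fun a' y => y%:R * reach k x a')) => y d e de.
  by rewrite (reach_sym _ _ de).
pose S1 a' := \sum_(x <- a') x%:R * S2 x (rem x a').
have S1s : symmetric_fun S1.
  apply: (symmetric_marked_sum (S := fun a' x => x%:R * S2 x a')) => y d e de.
  by rewrite (S2s _ _ _ de).
rewrite -[leRHS]/(S1 a) (S1s _ _ abc) /S1 big_cat /=.
apply: ler_wpDr.
  by apply: sumr_ge0 => x _; rewrite mulr_ge0 ?ler0n ?sumr_ge0.
rewrite -{1}bk sumnE natr_sum mulr_suml big_seq [leRHS]big_seq.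
apply: ler_sum => x xb; rewrite ler_wpM2l ?ler0n //.
rewrite (S2s _ _ _ (perm_rem_catl c xb)) /S2 big_cat /=.
apply: ler_wpDl; first exact: sumr_ge0.
rewrite -cn sumnE natr_sum big_seq [leRHS]big_seq.
apply: ler_sum => y yc; rewrite -[leLHS]mulr1 ler_wpM2l ?ler0n //.
rewrite (reach_sym _ _ (perm_rem_catr _ yc)) /reach.
have E : (k = x + sumn (rem x b))%N.
  by rewrite -bk (perm_sumn (perm_to_rem xb)).
by rewrite E leq_addr addKn mem_sumn_cat.
Qed.

Lemma sum_bool_size (P : pred nat) (s : seq nat) :
  (\sum_(x <- s) P x = size [seq x <- s | P x])%N.
Proof. by rewrite size_filter -sum1_count [RHS]big_mkcond; apply: eq_bigr => x _; case: (P x). Qed.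

(** The map from [x] to [k - x] is injective on [x <= k], and [1 <= x] puts its values below [k]. *)
Lemma sum_reach_le n k a :
  \sum_(1 <= x < n.+1) reach k x a <= (num_sums_lt k a)%:R.
Proof.
rewrite /reach -natr_sum ler_nat /num_sums_lt -size_filter.
rewrite (sum_bool_size (fun x => (x <= k)%N && (k - x \in subset_sums a)%N)).
rewrite -(size_map (fun x => k - x)%N); apply: uniq_leq_size.
  rewrite map_inj_in_uniq ?filter_uniq ?iota_uniq // => x y.
  by rewrite !mem_filter => /andP[/andP[xk _] _] /andP[/andP[yk _] _]; lia.
move=> v /mapP[x]; rewrite mem_filter mem_index_iota => /andP[/andP[xk xs] xn] ->.
by rewrite mem_filter mem_undup xs andbT; lia.
Qed.

Lemma num_sums_le_reach (J : pred nat) n k a :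
  (forall v, v \in subset_sums a -> [&& v < k, J (k - v)%N & k - v <= n]%N) ->
  (num_sums a)%:R <= \sum_(1 <= x < n.+1 | J x) reach k x a.
Proof.
move=> aJ; rewrite /reach -natr_sum ler_nat big_mkcond /=.
rewrite (eq_bigr (fun x => [&& J x, x <= k & k - x \in subset_sums a]%N : nat));
  last by move=> x _; case: (J x).
rewrite (sum_bool_size (fun x => [&& J x, x <= k & k - x \in subset_sums a]%N)).
rewrite -(size_map (fun x => k - x)%N); apply: uniq_leq_size.
  exact: undup_uniq.
move=> v; rewrite mem_undup => va; have /and3P[vk Jv vn] := aJ _ va.
apply/mapP; exists (k - v)%N; last by lia.
rewrite mem_filter mem_index_iota Jv subKn ?va; lia.
Qed.

(** Double marking gains [k (n - k)], and discarding the cycles longer than [k] costs [2 n / k]. The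
    constant [4] comes from [n <= 2 (n - k)]. *)
Lemma invariant_mean_le n k : (0 < k)%N -> (2 * k <= n)%N ->
  invariant_mean n k <=
  4 / k%:R ^+ 2 * cycle_total (fun j => j <= k)%N n (fun a => (num_sums a)%:R : R).
Proof.
move=> k0 kn.
have kR : 0 < k%:R :> R by rewrite ltr0n.
have nkR : 0 < (n - k)%:R :> R by rewrite ltr0n; lia.
have pos x a : 0 <= reach k x a by rewrite ler0n.
pose S2 x a' := \sum_(y <- a') y%:R * reach k x (rem y a').
have S2s x : symmetric_fun (S2 x).
  apply: (symmetric_marked_sum (S := fun a' y => y%:R * reach k x a')) => y d e de.
  by rewrite (reach_sym _ _ de).
pose U := cycle_total (fun j => j <= k)%N n (fun a => (num_sums a)%:R : R).
have U0 : 0 <= U by apply: cycle_total_ge0 => a; rewrite ler0n.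
suff main : k%:R * (n - k)%:R * invariant_mean n k <= 2 * n%:R / k%:R * U.
  have kn0 : 0 < k%:R * (n - k)%:R :> R by rewrite mulr_gt0.
  rewrite -(ler_pM2l kn0); apply: le_trans main _.
  rewrite -/U [leRHS]mulrA ler_wpM2r //.
  rewrite [leRHS](_ : _ = 4 * (n - k)%:R / k%:R); last first.
    by field; rewrite lt0r_neq0.
  rewrite ler_pM2r ?invr_gt0 // -!natrM ler_nat; lia.
rewrite /invariant_mean -cycle_meanZ.
apply: (@le_trans _ _ (cycle_mean predT n (fun a => \sum_(x <- a) x%:R * S2 x (rem x a)))).
  by apply: le_cycle_mean => a /and3P[_ _ /eqP an]; apply: double_mark_le; lia.
rewrite cycle_mean_mark //.
apply: (@le_trans _ _ (\sum_(1 <= x < n.+1) cycle_total predT n (reach k x))).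
  apply: ler_sum => x _.
  rewrite /S2 (cycle_mean_mark _ _ (g := fun y => reach k x)); last first.
    by move=> y; exact: reach_sym.
  apply: (@le_trans _ _ (cycle_total predT (n - x)
     (reach k x))); last by apply: cycle_total_mono => //; lia.
  (* As the second marked length [y] varies, the remainder [n - x - y] runs over all sizes below
     [n - x]. *)
  rewrite /cycle_total [leRHS]big_nat_rev [leRHS]big_ltn //=.
  apply: ler_wpDl; first by apply: cycle_mean_ge0.
  by apply: ler_sum => y _; rewrite add0n subSS.
rewrite -cycle_total_sum.
apply: (@le_trans _ _ (cycle_total predT n (fun a => (num_sums_lt k a)%:R))).
  by apply: le_cycle_total => a _ _ _; exact: sum_reach_le.
(* Separate the cycles longer than [k]: a subset sum below [k] cannot use them, so they contribute
   only their total weight. *)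
apply: le_trans (@cycle_total_split_le _ _ (fun j => j <= k)%N (fun j => k < j)%N _ _ _ _ _ _) _.
- by move=> j; rewrite ltnNge orbN.
- by move=> j; rewrite ltnNge andbN.
- move=> a b ab; congr (_%:R); rewrite /num_sums_lt; apply/seq.permP.
  apply: uniq_perm; rewrite ?undup_uniq // => v.
  by rewrite !mem_undup (perm_subset_sums ab).
- by move=> a; rewrite ler0n.
rewrite mulrC; apply: (@le_trans _ _ (cycle_total (fun j => j <= k)%N n
  (fun a => (num_sums a)%:R * (2 * n%:R / k%:R)))); last first.
  rewrite (eq_cycle_total (G := fun a => (2 * n%:R / k%:R) * (num_sums a)%:R)); last first.
    by move=> a _ _ _; rewrite mulrC.
  by rewrite cycle_totalZ mulrC.
apply: le_cycle_total => a _ _ _.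
apply: (@le_trans _ _ ((num_sums a)%:R * cycle_total (fun j => k < j)%N n (fun=> 1))); last first.
  by rewrite ler_wpM2l ?ler0n // long_cycles_total_le //; lia.
rewrite -cycle_totalZ; apply: le_cycle_total => b bk _ _.
rewrite mulr1 ler_nat /num_sums_lt /num_sums -size_filter.
apply: uniq_leq_size; first by rewrite filter_uniq ?undup_uniq.
move=> v; rewrite mem_filter !mem_undup => /andP[vk].
case/subset_sums_catP => u [w [ub wa E]].
suff : u = 0%N by move=> u0; rewrite E u0.
have {E vk wa} uk : (u < k)%N by lia.
elim: b bk ub => [|y b IHb] /=; first by rewrite inE => _ /eqP.
rewrite mem_cat => /andP[ky kb] /orP[/(IHb kb) //|/mapP[z _ E]]; lia.
Qed.

End LocalGlobal.

(** * The converse: completing short cycles to an invariant set *)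

Section LocalGlobalLower.
Variable R : realFieldType.
Implicit Types (J : pred nat) (F G : seq nat -> R) (a b c : seq nat).

(** The shape allowed for what is left after the short cycles and the marked one. A nonempty
    leftover of at most [k] points cannot consist of long cycles, hence the alternative of a single
    cycle. *)
Definition long_or_single k b := all (fun j => k < j)%N b || (size b == 1%N).

Lemma long_or_single_sym k : symmetric_fun (long_or_single k).
Proof.
by move=> b c bc; rewrite /long_or_single (perm_size bc) (perm_all _ bc).
Qed.

(** Bounds the ways to recover the marked cycle: if [b] has at least three cycles, the marked one is
    the only cycle of length at most [k]; otherwise there are at most two choices. *)
Lemma single_mark_le k a b :
  \sum_(x <- b) (reach R k x a * (long_or_single k (rem x b))%:R) <=
  2 * (k \in subset_sums (b ++ a))%:R.
Proof.
have [kba|kba] := boolP (k \in subset_sums (b ++ a)); last first.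
  rewrite mulr0 big_seq big1 // => x xb; rewrite /reach.
  case: andP => [[xk kx]|]; rewrite ?mul0r //.
  case/negP: kba; apply/subset_sums_catP; exists x, (k - x)%N.
  split; rewrite ?subnKC //.
  rewrite (perm_subset_sums (perm_to_rem xb)) mem_subset_sums_cons leqnn subnn.
  by rewrite mem_subset_sums0 orbT.
rewrite mulr1; have [b2|b3] := leqP (size b) 2.
  apply: (@le_trans _ _ (\sum_(x <- b) 1)).
    apply: ler_sum => x _; rewrite /reach -natrM (ler_nat _ _ 1).
    by case: andP; case: long_or_single.
  by rewrite big_const_seq count_predT iter_addr_0 ler_nat.
apply: (@le_trans _ _ (\sum_(x <- b) (x <= k)%N%:R * (all (fun j => k < j)%N (rem x b))%:R)).
  rewrite big_seq [leRHS]big_seq; apply: ler_sum => x xb.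
  rewrite /reach -!natrM ler_nat /long_or_single size_rem //.
  rewrite (_ : ((size b).-1 == 1)%N = false) ?orbF; last by apply/negbTE/eqP; move: b3; case: (size b) => [|[|[]]].
  by rewrite leq_mul2r; case: (x <= k)%N; case: (_ \in _); rewrite ?orbT.
have [/hasP[x xb xk]|nb] := boolP (has (fun x => (x <= k)%N && all (fun j => k < j)%N (rem x b)) b); last first.
  rewrite big_seq big1 ?ler0n // => x xb; rewrite -natrM.
  move: nb; rewrite -all_predC => /allP /(_ x xb) /=.
  by case: (x <= k)%N => //=; case: (all _ _) => // _; rewrite ?muln0 ?mul0n.
case/andP: xk => xk kb.
rewrite (perm_big _ (perm_to_rem xb)) big_cons /= big_seq big1 => [|y yb].
  by rewrite addr0 -natrM ler_nat; case: (x <= k)%N; case: (all _ _).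
by move: (allP kb y yb); rewrite ltnNge => /negPf ->; rewrite mul0r.
Qed.

Lemma cycle_mean_subpred (J J' : pred nat) n F : (forall a, 0 <= F a) ->
  (forall j, J' j -> J j) ->
  cycle_mean J' n F <= cycle_mean J n (fun a => (all J' a)%:R * F a).
Proof.
move=> F0 JJ; elim/ltn_ind: n F F0 => n IHn F F0.
have [->|n0] := posnP n; first by rewrite !cycle_mean0 mul1r.
have nR : 0 < n%:R :> R by rewrite ltr0n.
rewrite -(ler_pM2l nR) !cycle_meanS // big_mkcond [leRHS]big_mkcond /=.
rewrite big_nat_cond [leRHS]big_nat_cond.
apply: ler_sum => j /andP[/andP[j1 jn] _].
case: (boolP (J' j)) => [J'j|_]; last first.
  case: ifP => // _; apply: cycle_mean_ge0 => a _; by rewrite mulr_ge0.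
rewrite (JJ _ J'j); apply: le_trans (IHn (n - j)%N _ (fun a => F (j :: a)) _) _ => //; lia.
Qed.

(** For [n <= k] the single cycle of length [n] has weight [1 / n]; for larger [n], [long_cycles_ge]
    applies. *)
Lemma long_or_single_ge (J : pred nat) k n : (0 < n)%N -> (0 < k)%N ->
  (forall j, (k < j)%N -> J j) -> ((n <= k)%N -> J n) ->
  (2 * k).+1%:R^-1 <= cycle_mean J n (fun b => (long_or_single k b)%:R : R).
Proof.
move=> n0 k0 kJ nJ; have [nk|kn] := leqP n k.
  have nR : 0 < n%:R :> R by rewrite ltr0n.
  rewrite -(ler_pM2l nR) cycle_meanS //.
  rewrite big_mkcond big_nat_recr //= nJ // subnn cycle_mean0 [long_or_single _ _]orbT.
  rewrite -[leLHS]add0r lerD //.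
    apply: sumr_ge0 => j _; case: ifP => // _.
    by apply: cycle_mean_ge0 => a _; rewrite ler0n.
  by rewrite ler_pdivrMr ?ltr0n // mul1r ler_nat; lia.
apply: le_trans (long_cycles_ge R kn) _.
apply: le_trans (cycle_mean_subpred _ _ kJ) _ => //.
apply: le_cycle_mean => a _; rewrite mulr1 ler_nat /long_or_single.
by case: all.
Qed.

(** Each subset sum [v] of the short cycles is completed by a cycle of length [k - v], of weight at
    least [1 / k]; the leftover has weight at least [1 / (2 k + 1)], and the overcount is at most
    two. *)
Lemma invariant_mean_ge (J : pred nat) n k M : (0 < k)%N -> (2 * k <= n)%N ->
  (4 * M <= k)%N -> (forall j, J j -> 4 * j <= k)%N ->
  cycle_total J M (fun a => (num_sums a)%:R : R) / (2 * k%:R * (2 * k).+1%:R) <=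
  invariant_mean R n k.
Proof.
move=> k0 kn Mk Jk.
have kR : 0 < k%:R :> R by rewrite ltr0n.
pose J2 : pred nat := fun j => ~~ J j.
rewrite /invariant_mean (@cycle_mean_split R predT J J2); first last.
- by move=> a b ab; rewrite (perm_subset_sums ab).
- by move=> j; rewrite andbN.
- by move=> j; rewrite orbN.
rewrite [leRHS](@big_cat_nat _ _ _ M.+1) /=; [|lia|lia].
apply: ler_wpDr.
  by apply: sumr_ge0 => m _; do 2!apply: cycle_mean_ge0 => ? _; rewrite ler0n.
rewrite /cycle_total mulr_suml [leLHS]big_nat_cond [leRHS]big_nat_cond.
apply: ler_sum => m /andP[/andP[_ mM] _].
rewrite mulrC -cycle_meanZ; apply: le_cycle_mean => a /and3P[Ja _ /eqP am].
rewrite -(ler_pM2l (_ : 0 < 2)) //.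
rewrite -cycle_meanZ.
apply: le_trans (le_cycle_mean (fun b _ => single_mark_le k a b)).
rewrite (cycle_mean_mark_unweighted _ _ (g := fun x b => reach R k x a * (long_or_single k b)%:R)); last first.
  by move=> x b c bc; rewrite (long_or_single_sym _ bc).
apply: (@le_trans _ _ (\sum_(1 <= x < (n - m).+1 | J2 x) (k%:R^-1 * (2 * k).+1%:R^-1) * reach R k x a)).
  rewrite -mulr_sumr (_ : 2 * (_ * (num_sums a)%:R) = (k%:R^-1 * (2 * k).+1%:R^-1) * (num_sums a)%:R); last first.
    by field; rewrite (lt0r_neq0 kR) andbT -natrM nat1r pnatr_eq0.
  rewrite ler_wpM2l ?mulr_ge0 ?invr_ge0 ?ler0n //.
  apply: num_sums_le_reach => v va.
  (* Since [v <= k / 4], the length [k - v] exceeds every length allowed by [J]. *)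
  have vm : (v <= m)%N by rewrite -am; exact: subset_sums_le.
  rewrite /J2; apply/and3P; split; [|apply/negP => /Jk|]; lia.
rewrite big_nat_cond [leRHS]big_nat_cond.
apply: ler_sum => x /andP[/andP[x1 xn] J2x].
rewrite cycle_meanZ mulrA [leRHS]mulrAC mulrC [leRHS]mulrC.
rewrite /reach; case: andP => [[xk kx]|_]; rewrite ?mul0r // !mul1r.
apply: ler_pM; rewrite ?invr_ge0 ?ler0n //.
  by rewrite lef_pV2 ?posrE ?ltr0n // ler_nat.
(* The leftover [n - m - x] is at least [3 k / 4], so it is nonempty and too long for [J]. *)
have vm : (k - x <= m)%N by rewrite -am; exact: subset_sums_le.
apply: long_or_single_ge => //; first by lia.
  by move=> j kj; apply/negP => /Jk; lia.
move=> _; apply/negP => /Jk; lia.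
Qed.

End LocalGlobalLower.

(** * Walks with Poisson weights *)

Section PathSums.
Variable R : realFieldType.
Implicit Types (F G : seq nat -> R) (s : seq nat).

(** The law of [T] independent Poisson steps of mean one, without its factor [e^-T]; the bound [K]
    on the steps keeps the sums finite. *)
Fixpoint path_sum (K T : nat) F : R :=
  if T is T'.+1
  then \sum_(0 <= y < K) y`!%:R^-1 * path_sum K T' (fun s => F (y :: s))
  else F [::].

Lemma fact_inv_ge0 y : 0 <= y`!%:R^-1 :> R.
Proof. by rewrite invr_ge0 ler0n. Qed.

Lemma le_path_sum K T F G : (forall s, size s = T -> F s <= G s) ->
  path_sum K T F <= path_sum K T G.
Proof.
elim: T F G => [|T IHT] F G FG /=; first exact: FG.
apply: ler_sum => y _; rewrite ler_wpM2l ?fact_inv_ge0 //.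
by apply: IHT => s sT; apply: FG; rewrite /= sT.
Qed.

Lemma eq_path_sum K T F G : (forall s, size s = T -> F s = G s) ->
  path_sum K T F = path_sum K T G.
Proof.
by move=> FG; apply/eqP; rewrite eq_le !le_path_sum // => s sT; rewrite FG.
Qed.

Lemma path_sumZ K T c F : path_sum K T (fun s => c * F s) = c * path_sum K T F.
Proof.
elim: T F => [|T IHT] F //=; rewrite mulr_sumr.
by apply: eq_bigr => y _; rewrite IHT mulrCA.
Qed.

Lemma path_sum_sum K T (I : Type) (r : seq I) (Q : pred I) (F : I -> seq nat -> R) :
  path_sum K T (fun s => \sum_(i <- r | Q i) F i s) =
  \sum_(i <- r | Q i) path_sum K T (F i).
Proof.
elim: T F => [|T IHT] F //=; rewrite exchange_big /=.
by apply: eq_bigr => y _; rewrite IHT mulr_sumr.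
Qed.

Lemma path_sumD K T F G :
  path_sum K T (fun s => F s + G s) = path_sum K T F + path_sum K T G.
Proof.
elim: T F G => [|T IHT] F G //=; rewrite -big_split /=.
by apply: eq_bigr => y _; rewrite IHT mulrDr.
Qed.

Lemma path_sum_ge0 K T F : (forall s, 0 <= F s) -> 0 <= path_sum K T F.
Proof.
elim: T F => [|T IHT] F F0 /=; first exact: F0.
by apply: sumr_ge0 => y _; rewrite mulr_ge0 ?fact_inv_ge0 ?IHT.
Qed.

Lemma path_sum_mono K K' T F : (K <= K')%N -> (forall s, 0 <= F s) ->
  path_sum K T F <= path_sum K' T F.
Proof.
move=> KK'; elim: T F => [|T IHT] F F0 //=.
rewrite [leRHS](@big_cat_nat _ _ _ K) //=; apply: ler_wpDr.
  by apply: sumr_ge0 => y _; rewrite mulr_ge0 ?fact_inv_ge0 ?path_sum_ge0.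
by apply: ler_sum => y _; rewrite ler_wpM2l ?fact_inv_ge0 ?IHT.
Qed.

Lemma path_sum_cat K T1 T2 F : path_sum K (T1 + T2) F =
  path_sum K T1 (fun s2 => path_sum K T2 (fun s1 => F (s2 ++ s1))).
Proof.
by elim: T1 F => //= T1 IHT F; apply: eq_bigr => y _; rewrite IHT.
Qed.

(* The walk is [sumn] minus the number of steps, and step lists are written
   latest step first: [stays_below] constrains the suffixes, while
   [stays_above] and [first_hit] follow the list from its head, that is, they
   read the walk backwards in time. *)
Fixpoint stays_below s :=
  if s is x :: s' then stays_below s' && (x + sumn s' <= (size s').+1)%N else true.

Fixpoint stays_above (h : nat) s :=
  if s is x :: s' then (0 < h + x)%N && stays_above (h + x).-1 s' else true.

Fixpoint first_hit (v : nat) s :=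
  if s is x :: s' then (0 < v)%N && first_hit (v + x).-1 s' else (v == 0)%N.

Definition end_height (h : nat) s := (h + sumn s - size s)%N.

(* [r`! * park u r] is the number of parking functions of [r] cars on [u] spots. *)
Definition park (u r : nat) : R :=
  (u.+1 - r)%:R * u.+1%:R ^+ r / (u.+1%:R * r`!%:R).

Lemma fact_neq0 y : y`!%:R != 0 :> R.
Proof. by rewrite pnatr_eq0 -lt0n fact_gt0. Qed.

Lemma exp_binomial (U : R) r :
  \sum_(0 <= y < r.+1) y`!%:R^-1 * (U ^+ (r - y) / (r - y)`!%:R) =
  (U + 1) ^+ r / r`!%:R.
Proof.
rewrite exprDn big_mkord mulr_suml; apply: eq_bigr => i _.
rewrite expr1n mulr1 -mulr_natr.
have ir : (i <= r)%N by rewrite -ltnS.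
have E : 'C(r, i)%:R * (i`!%:R * (r - i)`!%:R) = r`!%:R :> R.
  by rewrite -!natrM bin_fact.
rewrite -E; by field; rewrite !fact_neq0 /= pnatr_eq0 -lt0n bin_gt0.
Qed.

(** This is [exp_binomial] after applying the operator [U d/dU]. *)
Lemma exp_binomial_deriv (U : R) r :
  \sum_(0 <= y < r.+1) y`!%:R^-1 * ((r - y)%:R * U ^+ (r - y) / (r - y)`!%:R) =
  r%:R * U * (U + 1) ^+ r.-1 / r`!%:R.
Proof.
case: r => [|r]; first by rewrite big_nat1 !mul0r mulr0.
rewrite big_nat_recr //= subnn !mul0r mulr0 addr0.
have -> : r.+1%:R * U * (U + 1) ^+ r / (r.+1)`!%:R = U * ((U + 1) ^+ r / r`!%:R).
  rewrite factS natrM; field; rewrite fact_neq0 /= addrC natr1 pnatr_eq0 //.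
rewrite -exp_binomial mulr_sumr; apply: eq_big_nat => y /andP[_ yr].
rewrite subSn // factS natrM exprS; field.
by rewrite !fact_neq0 /= addrC natr1 pnatr_eq0.
Qed.

(* A form of Abel's binomial identity. *)
Lemma park_rec u r : (r <= u.+1)%N ->
  \sum_(0 <= y < r.+1) y`!%:R^-1 * park u (r - y) = park u.+1 r.
Proof.
move=> ru; have [U UE] : exists U : R, u.+1%:R = U by exists u.+1%:R.
have U0 : U != 0 by rewrite -UE pnatr_eq0.
have U1 : U + 1 != 0 by rewrite -UE natr1 pnatr_eq0.
transitivity (\sum_(0 <= y < r.+1) y`!%:R^-1 * (U ^+ (r - y) / (r - y)`!%:R)
  - U^-1 * \sum_(0 <= y < r.+1) y`!%:R^-1 * ((r - y)%:R * U ^+ (r - y) / (r - y)`!%:R)).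
  rewrite mulr_sumr -sumrB; apply: eq_big_nat => y /andP[_ yr].
  rewrite /park natrB ?UE; last by lia.
  by field; rewrite U0 !fact_neq0.
rewrite exp_binomial exp_binomial_deriv /park natrB; last by lia.
rewrite -natr1 UE.
case: r ru => [|r] ru /=; first by field; rewrite U0 U1 fact_neq0.
by rewrite exprS; field; rewrite U0 U1 fact_neq0.
Qed.

Definition below_sum (K u r : nat) := path_sum K u (fun s => (stays_below s && (sumn s == r))%:R).

(** Removing the latest step leads to [park_rec]. With total [r < K], the bound on the steps
    excludes nothing. *)
Lemma below_sumE K u r : (r < K)%N -> below_sum K u r = park u r.
Proof.
rewrite /below_sum; elim: u r => [|u IHu] r rK /=.
  rewrite /park; case: r rK => [|r] rK; first by rewrite fact0 expr0 !mulr1 divr1.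
  by rewrite subSS sub0n !mul0r.
have [ru|ur] := leqP r u.+1; last first.
  rewrite /park (_ : (u.+2 - r = 0)%N) ?mul0r; last by lia.
  rewrite big1 // => y _; rewrite (@eq_path_sum _ _ _ (fun=> 0 * 0)); last first.
    move=> s su; rewrite mul0r su (_ : _ && _ = false) //.
    by apply/negbTE/negP => /andP[/andP[_ a] /eqP b]; lia.
  by rewrite path_sumZ mul0r mulr0.
rewrite -park_rec // (@big_cat_nat _ _ _ r.+1) //= [X in _ + X]big1_seq ?addr0; last first.
  move=> y /andP[_]; rewrite mem_index_iota => /andP[ry _].
  rewrite (@eq_path_sum _ _ _ (fun=> 0 * 0)) ?path_sumZ ?mul0r ?mulr0 // => s su.
  by rewrite (_ : (y + sumn s == r)%N = false) ?andbF ?mulr0 //; apply/eqP; lia.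
apply: eq_big_nat => y /andP[_ yr]; congr (_ * _).
rewrite -IHu; last by lia.
apply: eq_path_sum => s su; congr (_%:R); rewrite su.
case: (stays_below s) => //=.
have [->|ne] := eqVneq (sumn s) (r - y)%N; first by rewrite subnKC ?eqxx ?ru.
case: eqP => [E|]; last by rewrite andbF.
by move/eqP: ne; rewrite -E addKn.
Qed.

Lemma park_ge0 u r : 0 <= park u r.
Proof. by rewrite /park divr_ge0 ?mulr_ge0 ?exprn_ge0 ?ler0n. Qed.

Lemma below_sum_le K u r : below_sum K u r <= park u r.
Proof.
rewrite -(@below_sumE (maxn K r.+1)); last by lia.
by apply: path_sum_mono => [|s]; [lia|rewrite ler0n].
Qed.

Definition hit_sum K u v := path_sum K u (fun s => (first_hit v s)%:R).

(** Kemperman's formula: the first-passage weight is [v / (u + 1)] times the weight of a total of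
    [u + 1 - v]. Conditioning on the first step gives the same recursion [park_rec]. *)
Lemma hit_sumE K u v : (u < K)%N ->
  hit_sum K u.+1 v = if (v <= u.+1)%N then park u (u.+1 - v) else 0.
Proof.
rewrite /hit_sum; elim: u v => [|u IHu] v uK.
  rewrite /= big_ltn //= big_nat_cond big1 ?addr0; last first.
    move=> y /andP[/andP[y1 _] _]; case: v => [|v] /=; rewrite ?mulr0 //.
    by rewrite (_ : (v.+1 + y).-1 == 0 = false)%N ?mulr0 //; apply/eqP; lia.
  rewrite /park; case: v => [|[|v]] //=; rewrite ?addn0 ?fact0 ?invr1 ?mul1r.
  - by rewrite subn0 subnn !mul0r.
  - by rewrite invr1.
  - by [].
rewrite [LHS](_ : _ = \sum_(0 <= y < K) y`!%:R^-1 * path_sum K u.+1 (fun s => (first_hit v (y :: s))%:R)) //.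
have [->|v0] := posnP v.
  rewrite big1 => [|y _]; last by rewrite (@eq_path_sum _ _ _ (fun=> 0 * 0)) ?path_sumZ ?mul0r ?mulr0.
  by rewrite /= /park subn0 subnn !mul0r.
transitivity (\sum_(0 <= y < K) y`!%:R^-1 *
   (if ((v + y).-1 <= u.+1)%N then park u (u.+1 - (v + y).-1) else 0)).
  apply: eq_bigr => y _; congr (_ * _); rewrite -IHu; last by lia.
  by apply: eq_path_sum => s _; rewrite /= v0.
have [vu|uv] := leqP v u.+2; last first.
  rewrite big1 // => y _; case: ifP; rewrite ?mulr0 //; lia.
rewrite (@big_cat_nat _ _ _ (u.+2 - v).+1) /=; [|lia|lia].
rewrite [X in _ + X]big1_seq ?addr0; last first.
  move=> y /andP[_]; rewrite mem_index_iota => /andP[ry _].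
  case: ifP; rewrite ?mulr0 //; lia.
rewrite -park_rec; last by lia.
apply: eq_big_nat => y /andP[_ yr]; rewrite ifT; last by lia.
by congr (_ * park _ _); lia.
Qed.

Lemma hit_sum_le K u v : (v <= u.+1)%N -> hit_sum K u.+1 v <= park u (u.+1 - v).
Proof.
move=> vu; apply: (@le_trans _ _ (hit_sum (maxn K u.+1) u.+1 v)).
  by apply: path_sum_mono => [|s]; [lia|rewrite ler0n].
by rewrite hit_sumE ?vu //; lia.
Qed.

Lemma first_hit_cat h s z : stays_above h s ->
  first_hit h.+1 (s ++ z) = first_hit (end_height h s).+1 z.
Proof.
rewrite /end_height; elim: s h => [|x s IHs] h /=.
  by rewrite addn0 subn0.
move=> /andP[hx /IHs E].
transitivity (first_hit (h + x).-1.+1 (s ++ z)).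
  by congr (first_hit _ _); lia.
by rewrite E; congr (first_hit _ z); lia.
Qed.

(** Concatenation of the two pieces. Heights are shifted by one since [stays_above] allows height
    [0], at which [first_hit] would stop. *)
Lemma above_hit_le K t n h w :
  path_sum K t (fun s => (stays_above h s && (end_height h s == w))%:R) *
    hit_sum K n w.+1 <= hit_sum K (t + n) h.+1.
Proof.
rewrite {2}/hit_sum path_sum_cat mulrC -path_sumZ; apply: le_path_sum => s _.
have [/andP[sa /eqP <-]|_] := boolP (_ && _); last first.
  by rewrite mulr0 path_sum_ge0 // => z; rewrite ler0n.
by rewrite mulr1 le_path_sum // => z _; rewrite first_hit_cat.
Qed.

(** The terms of the exponential series at [u + 1] increase up to index [u]; the factor [w.+1] is
    the numerator [u.+1 - (u - w)]. *)
Lemma park_le u w : (w <= u)%N -> park u (u - w) <= w.+1%:R * park u u.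
Proof.
move=> wu; rewrite /park subSnn mul1r (_ : (u.+1 - (u - w) = w.+1)%N); last by lia.
have [U UE] : exists U : R, u.+1%:R = U by exists u.+1%:R.
have H : u.+1%:R ^+ (u - w) / (u - w)`!%:R <= u.+1%:R ^+ u / u`!%:R :> R.
  rewrite ler_pdivrMr ?ltr0n ?fact_gt0 // mulrAC ler_pdivlMr ?ltr0n ?fact_gt0 //.
  rewrite -!natrX -!natrM ler_nat -(ffact_fact wu).
  have -> : (u.+1 ^ u = u.+1 ^ (u - w) * u.+1 ^ w)%N by rewrite -expnD subnK.
  rewrite -mulnA leq_mul2l leq_mul2r ffact_prod; apply/orP; right; apply/orP; right.
  apply: (@leq_trans (\prod_(i < w) u.+1)); first by apply: leq_prod => i _; lia.
  by rewrite prod_nat_const card_ord.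
rewrite !UE in H *; have U0 : 0 < U by rewrite -UE ltr0n.
rewrite [leLHS](_ : _ = w.+1%:R / U * (U ^+ (u - w) / (u - w)`!%:R)); last first.
  by field; rewrite fact_neq0 lt0r_neq0.
rewrite [leRHS](_ : _ = w.+1%:R / U * (U ^+ u / u`!%:R)); last first.
  by field; rewrite fact_neq0 lt0r_neq0.
by rewrite ler_wpM2l // divr_ge0 ?ler0n // ltW.
Qed.

End PathSums.

(** * Sums and convolutions of the factor [n^(-3/2)] *)

Section Decay.
Variable R : rcfType.

(** The function [n^(-3/2)], shifted by one to make sense at [0]. *)
Definition decay (n : nat) : R := (n.+1%:R * Num.sqrt n.+1%:R)^-1.

Lemma sqrtS_gt0 n : 0 < Num.sqrt n.+1%:R :> R.
Proof. by rewrite sqrtr_gt0 ltr0n. Qed.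

Lemma decay_gt0 n : 0 < decay n.
Proof. by rewrite invr_gt0 mulr_gt0 ?ltr0n ?sqrtS_gt0. Qed.

Lemma decay_anti m n : (m <= n)%N -> decay n <= decay m.
Proof.
move=> mn; rewrite /decay lef_pV2 ?posrE ?mulr_gt0 ?ltr0n ?sqrtS_gt0 //.
by apply: ler_pM; rewrite ?ler0n ?sqrtr_ge0 ?ler_nat // ler_sqrt ?ltr0n ?ler_nat.
Qed.

Lemma decay_half t T : (T < 2 * t.+1)%N -> decay t <= 4 * decay T.
Proof.
move=> tT; rewrite /decay -[4 / _]invf_div lef_pV2 ?posrE ?divr_gt0 ?mulr_gt0 ?ltr0n ?sqrtS_gt0 //.
rewrite ler_pdivrMr //.
have s4 : Num.sqrt 4 = 2 :> R by rewrite (_ : 4 = 2 ^+ 2) ?sqrtr_sqr ?ger0_norm //; ring.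
have : Num.sqrt T.+1%:R <= 2 * Num.sqrt t.+1%:R :> R.
  rewrite -s4 -sqrtrM // ler_sqrt; last by rewrite -natrM ler0n.
  by rewrite -natrM ler_nat; lia.
have : T.+1%:R <= 2 * t.+1%:R :> R by rewrite -natrM ler_nat.
have := sqrtS_gt0 T; have := sqrtS_gt0 t.
have : 0 < T.+1%:R :> R by rewrite ltr0n.
have : 0 < t.+1%:R :> R by rewrite ltr0n.
move: (t.+1%:R : R) (T.+1%:R : R) (Num.sqrt t.+1%:R) (Num.sqrt T.+1%:R).
move=> d b a c d0 b0 a0 c0 bd ca.
have : b * c <= 2 * d * (2 * a) by apply: ler_pM => //; rewrite ltW.
by rewrite (_ : 2 * d * (2 * a) = d * a * 4) //; ring.
Qed.

(** A telescoping form of the comparison with the integral of [x^(-3/2)]. *)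
Lemma decay_sum N : \sum_(0 <= t < N) decay t <= 3.
Proof.
case: N => [|N]; first by rewrite big_nil.
suff : \sum_(0 <= t < N.+1) decay t <= 3 - 2 / Num.sqrt N.+1%:R.
  move/le_trans; apply; rewrite gerBl divr_ge0 // ltW ?sqrtS_gt0 //.
elim: N => [|N IHN]; first by rewrite big_nat1 /decay sqrtr1 !mulr1 invr1; lra.
rewrite big_nat_recr //=; apply: le_trans (lerD IHN (lexx _)) _.
have -> : decay N.+1 = (Num.sqrt N.+2%:R ^+ 3)^-1.
  by rewrite /decay exprSr sqr_sqrtr ?ler0n.
have := sqrtS_gt0 N; have := sqrtS_gt0 N.+1.
have : Num.sqrt N.+1%:R ^+ 2 = N.+1%:R :> R by rewrite sqr_sqrtr ?ler0n.
have : Num.sqrt N.+2%:R ^+ 2 = N.+1%:R + 1 :> R by rewrite sqr_sqrtr ?ler0n // natr1.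
move: (N.+1%:R : R) (Num.sqrt N.+2%:R) (Num.sqrt N.+1%:R) => x b a bx ax b0 a0.
have ab : b ^+ 2 = a ^+ 2 + 1 by rewrite bx ax.
have lab : a <= b by nra.
rewrite -subr_ge0.
have -> : 3 - 2 / b - (3 - 2 / a + (b ^+ 3)^-1) =
   (2 * b ^+ 2 * (b - a) - a) / (a * b ^+ 3).
  by field; rewrite !lt0r_neq0.
apply: divr_ge0; last by rewrite mulr_ge0 ?exprn_ge0 // ltW.
have E : (b - a) * (b + a) = 1 by rewrite -subr_sqr ab; ring.
have : 2 * b ^+ 2 * (b - a) = b * ((b - a) * (b + a) + (b - a) ^+ 2) by ring.
rewrite E; have : 0 <= b * (b - a) ^+ 2 by rewrite mulr_ge0 ?sqr_ge0 // ltW.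
lra.
Qed.

(** One of [t] and [T - t] is at least about [T / 2], so its factor is at most [4 * decay T]; the
    other factor sums to at most [3]. *)
Lemma decay_conv T : \sum_(0 <= t < T.+1) decay t * decay (T - t) <= 24 * decay T.
Proof.
apply: (@le_trans _ _ (\sum_(0 <= t < T.+1) 4 * decay T * (decay t + decay (T - t)))).
  rewrite big_nat_cond [leRHS]big_nat_cond.
  apply: ler_sum => t /andP[/andP[_ tT] _].
  have := decay_gt0 t; have := decay_gt0 (T - t); have := decay_gt0 T.
  have [tl|tg] := ltnP T (2 * t.+1).
    have := decay_half tl; nra.
  have tl : (T < 2 * (T - t).+1)%N by lia.
  have := decay_half tl; nra.
rewrite -mulr_sumr big_split /= [X in _ + X]big_nat_rev /=.
under [X in _ + X]eq_big_nat => t /andP[_ tT].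
  rewrite (_ : T - (0 + T.+1 - t.+1) = t)%N; last by lia.
  over.
have := decay_sum T.+1; have := decay_gt0 T; nra.
Qed.

Lemma sum_geom_deriv (x : R) N : 0 <= x < 1 ->
  \sum_(0 <= w < N) w.+1%:R * x ^+ w <= (1 - x) ^- 2.
Proof.
move=> /andP[x0 x1].
have y0 : 0 < 1 - x by lra.
suff E : (1 - x) ^+ 2 * (\sum_(0 <= w < N) w.+1%:R * x ^+ w) =
    1 - N.+1%:R * x ^+ N + N%:R * x ^+ N.+1.
  rewrite -(ler_pM2l (_ : 0 < (1 - x) ^+ 2)) ?exprn_gt0 // E mulfV ?lt0r_neq0 ?exprn_gt0 //.
  rewrite exprS -natr1; have : 0 <= x ^+ N by apply: exprn_ge0.
  have : 0 <= N%:R :> R by rewrite ler0n.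
  move: (N%:R) (x ^+ N) => n y n0 yy0.
  have : 0 <= n * y * (1 - x) by rewrite !mulr_ge0 // ltW.
  nra.
elim: N => [|N IHN]; first by rewrite big_nil expr0 mul0r; ring.
rewrite big_nat_recr //= mulrDr IHN !exprS -!natr1; ring.
Qed.

End Decay.

(** * Weighting walks by total cycle length, and cutting them at a maximum *)

Section PathBounds.
Variable R : rcfType.
Implicit Types (F G : seq nat -> R) (s : seq nat).

(* If [s] counts cycles by dyadic block, this bounds their total length. *)
Fixpoint weighted_total s :=
  if s is x :: s' then (x * 2 ^ (size s').+1 + weighted_total s')%N else 0%N.

Lemma le_path_sum_lt K T F G :
  (forall s, size s = T -> all (fun y => y < K)%N s -> F s <= G s) ->
  path_sum K T F <= path_sum K T G.
Proof.
elim: T F G => [|T IHT] F G FG /=; first exact: FG.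
rewrite big_nat_cond [leRHS]big_nat_cond.
apply: ler_sum => y /andP[/andP[_ yK] _]; rewrite ler_wpM2l ?fact_inv_ge0 //.
by apply: IHT => s sT sK; apply: FG; rewrite /= ?sT ?yK.
Qed.

Lemma sumn_le_mul K s : all (fun y => y < K)%N s -> (sumn s <= size s * K)%N.
Proof. by elim: s => //= y s IHs /andP[yK /IHs]; rewrite mulSn; lia. Qed.

(* [y / y`! = 1 / (y - 1)`!]: a factor [y] takes one unit off that step. *)
Lemma size_bias K (g : nat -> R) : (forall y, 0 <= g y) ->
  \sum_(0 <= y < K) y`!%:R^-1 * (y%:R * g y) <=
  \sum_(0 <= y < K) y`!%:R^-1 * g y.+1.
Proof.
move=> g0; case: K => [|K]; first by rewrite !big_nil.
rewrite big_nat_recl // mul0r mulr0 add0r [leRHS]big_nat_recr //=.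
apply: ler_wpDr; first by rewrite mulr_ge0 ?fact_inv_ge0.
apply: ler_sum => y _.
rewrite factS natrM invfM mulrA; apply: ler_wpM2r => //.
by rewrite mulrAC mulVf ?mul1r // pnatr_eq0.
Qed.

(** [size_bias] removes one unit from the weighted step, which is made up for by starting one
    higher. The powers of two over the steps add up to less than [2 ^+ t.+1]. *)
Lemma weighted_above K t h (f : nat -> R) : (forall m, 0 <= f m) ->
  path_sum K t (fun s => (weighted_total s)%:R * ((stays_above h s)%:R * f (sumn s))) <=
  2 ^+ t.+1 * path_sum K t (fun s => (stays_above h.+1 s)%:R * f (sumn s).+1).
Proof.
elim: t h f => [|t IHt] h f f0; first by rewrite /= mul0r !mul1r mulr_ge0 ?ler0n.
pose A y := path_sum K t (fun s => (stays_above h (y :: s))%:R * f (y + sumn s)%N).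
pose B y := path_sum K t (fun s => (stays_above h.+1 (y :: s))%:R * f (y + sumn s).+1).
have A0 y : 0 <= A y by apply: path_sum_ge0 => s; rewrite mulr_ge0 ?ler0n.
rewrite [leLHS](_ : _ =
    2 ^+ t.+1 * (\sum_(0 <= y < K) y`!%:R^-1 * (y%:R * A y)) +
    \sum_(0 <= y < K) y`!%:R^-1 * path_sum K t
      (fun s => (weighted_total s)%:R * ((stays_above h (y :: s))%:R * f (y + sumn s)%N))); last first.
  rewrite mulr_sumr -big_split /=; apply: eq_bigr => y _.
  rewrite mulrCA -mulrDr mulrA; congr (_ * _); rewrite -path_sumZ -path_sumD.
  apply: eq_path_sum => s st; rewrite st natrD natrM natrX; ring.
pose S := \sum_(0 <= y < K) y`!%:R^-1 * B y.
rewrite [leRHS](_ : _ = 2 ^+ t.+2 * S) //.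
rewrite [leRHS](_ : _ = 2 ^+ t.+1 * S + 2 ^+ t.+1 * S); last by rewrite exprS; ring.
apply: lerD.
  rewrite ler_wpM2l ?exprn_ge0 ?ler0n //; apply: le_trans (size_bias _ A0) _.
  rewrite le_eqVlt; apply/orP; left; apply/eqP; apply: eq_bigr => y _.
  congr (_ * _); apply: eq_path_sum => s _ /=.
  by rewrite !addnS !addSn.
rewrite mulr_sumr; apply: ler_sum => y _.
rewrite mulrCA ler_wpM2l ?fact_inv_ge0 //.
have [hy|hy] := posnP (h + y)%N.
  rewrite (@eq_path_sum _ _ _ _ (fun=> 0 * 0)) ?path_sumZ ?mul0r; last first.
    by move=> s _; rewrite /= hy !mul0r mulr0.
  rewrite mulr_ge0 ?exprn_ge0 ?ler0n //.
  by apply: path_sum_ge0 => s; rewrite mulr_ge0 ?ler0n.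
apply: le_trans (le_trans (IHt (h + y).-1 (fun m => f (y + m)%N) _) _) => //.
  by apply: le_path_sum => s _; rewrite /= hy.
rewrite ler_wpM2l ?exprn_ge0 ?ler0n //; apply: le_path_sum => s _ /=.
by rewrite ?addSn /= prednK // addnS.
Qed.

Lemma weighted_below K t (f : nat -> R) : (forall m, 0 <= f m) ->
  path_sum K t (fun s => (weighted_total s)%:R * ((stays_below s)%:R * f (sumn s))) <=
  2 ^+ t.+1 * path_sum K t (fun s => (stays_below s)%:R * f (sumn s).+1).
Proof.
elim: t f => [|t IHt] f f0; first by rewrite /= mul0r !mul1r mulr_ge0 ?ler0n.
pose A y := path_sum K t (fun s => (stays_below (y :: s))%:R * f (y + sumn s)%N).
pose B y := path_sum K t (fun s => (stays_below (y :: s))%:R * f (y + sumn s).+1).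
have A0 y : 0 <= A y by apply: path_sum_ge0 => s; rewrite mulr_ge0 ?ler0n.
rewrite [leLHS](_ : _ =
    2 ^+ t.+1 * (\sum_(0 <= y < K) y`!%:R^-1 * (y%:R * A y)) +
    \sum_(0 <= y < K) y`!%:R^-1 * path_sum K t
      (fun s => (weighted_total s)%:R * ((stays_below (y :: s))%:R * f (y + sumn s)%N))); last first.
  rewrite mulr_sumr -big_split /=; apply: eq_bigr => y _.
  rewrite mulrCA -mulrDr mulrA; congr (_ * _); rewrite -path_sumZ -path_sumD.
  apply: eq_path_sum => s st /=; rewrite st natrD natrM natrX; ring.
pose S := \sum_(0 <= y < K) y`!%:R^-1 * B y.
rewrite [leRHS](_ : _ = 2 ^+ t.+2 * S) //.
rewrite [leRHS](_ : _ = 2 ^+ t.+1 * S + 2 ^+ t.+1 * S); last by rewrite exprS; ring.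
apply: lerD.
  rewrite ler_wpM2l ?exprn_ge0 ?ler0n //; apply: le_trans (size_bias _ A0) _.
  apply: ler_sum => y _; rewrite ler_wpM2l ?fact_inv_ge0 //.
  apply: le_path_sum => s _ /=; rewrite addSn ler_wpM2r // ler_nat.
  by case: stays_below => //=; case: leqP => //=; case: leqP => //; lia.
rewrite mulr_sumr; apply: ler_sum => y _.
rewrite mulrCA ler_wpM2l ?fact_inv_ge0 //.
apply: le_trans (le_trans (IHt (fun m => (y + m <= t.+1)%N%:R * f (y + m)%N) _) _) => //.
- apply: le_path_sum => s st /=; rewrite st; case: stays_below; rewrite /= ?mul0r //.
  by rewrite mul1r.
- by move=> m; rewrite mulr_ge0 ?ler0n.
rewrite ler_wpM2l ?exprn_ge0 ?ler0n //; apply: le_path_sum => s st /=.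
rewrite addnS mulrA -natrM st ler_wpM2r // ler_nat.
by case: stays_below => //=; case: leqP => //=; case: leqP => //; lia.
Qed.

(* Split at a time at which the walk is maximal. *)
Lemma argmax_split s : exists s2 s1,
  [/\ s = s2 ++ s1, stays_below s2 & stays_above 0 s1].
Proof.
have above_cat h u v : stays_above (end_height h u) v -> stays_above h u ->
    stays_above h (u ++ v).
  elim: u h => [|x u IHu] h /=; first by rewrite /end_height addn0 subn0.
  move=> vP /andP[hx uP]; rewrite hx /=; apply: IHu => //.
  by move: vP; rewrite /end_height /= (_ : h + _ - _ = (h + x).-1 + sumn u - size u)%N //; lia.
have above_mono h h' v : (h <= h')%N -> stays_above h v -> stays_above h' v.
  elim: v h h' => //= x v IHv h h' hh /andP[hx /(IHv _ (h' + x).-1)].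
  by move=> ->; rewrite ?andbT; lia.
have below_above u h : stays_below u -> (size u <= h + sumn u)%N -> stays_above h u.
  elim: u h => //= x u IHu h /andP[ub xu] hu.
  have hx : (0 < h + x)%N by move: ub; case: u xu hu {IHu} => [|y u] /=; lia.
  rewrite hx IHu //; lia.
elim: s => [|x s [s2 [s1 [-> b2 a1]]]]; first by exists [::], [::].
have [le|gt] := leqP (x + sumn s2) (size s2).+1.
  by exists (x :: s2), s1; split=> //=; rewrite b2.
exists [::], (x :: s2 ++ s1); split=> //; rewrite -cat_cons.
apply: above_cat; first by apply: above_mono a1.
rewrite /= add0n; apply/andP; split; last by apply: below_above => //; lia.
have : (sumn s2 <= size s2)%N by case: s2 b2 {gt a1} => //= y u /andP[_].
lia.
Qed.

End PathBounds.

(** * One-sided walks with exponential weights *)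

Section CriticalPaths.
Variable R : rcfType.
Implicit Types (F G : seq nat -> R) (s : seq nat).

(** To be taken as Euler's number, [ln 2] and the constants in Stirling's bounds; here they are
    known only through the hypotheses below. *)
Variables (e rho c1 c2 : R).
Hypotheses (e_gt0 : 0 < e) (c1_gt0 : 0 < c1) (c2_gt0 : 0 < c2).
Hypothesis stirling : forall n, (0 < n)%N ->
  c1 * e ^+ n <= Num.sqrt n%:R * (n%:R ^+ n / n`!%:R) <= c2 * e ^+ n.
Hypotheses (rho_gt : 2^-1 < rho) (erho_lt : e * rho < 2).

Lemma park_diagE u : park R u u =
  Num.sqrt u.+1%:R * (u.+1%:R ^+ u.+1 / (u.+1)`!%:R) * decay R u.
Proof.
rewrite /park /decay subSnn mul1r factS natrM exprS.
have [U UE] : exists U : R, u.+1%:R = U by exists u.+1%:R.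
have s0 := sqrtS_gt0 R u; rewrite UE in s0 *.
have U0 : U != 0 by rewrite -UE pnatr_eq0.
by field; rewrite U0 fact_neq0 lt0r_neq0.
Qed.

Lemma park_diag_le u : park R u u <= c2 * e ^+ u.+1 * decay R u.
Proof.
rewrite park_diagE ler_wpM2r ?(ltW (decay_gt0 _ _)) //.
by have /andP[] := stirling (ltn0Sn u).
Qed.

Lemma park_diag_ge u : c1 * e ^+ u.+1 * decay R u <= park R u u.
Proof.
rewrite park_diagE ler_wpM2r ?(ltW (decay_gt0 _ _)) //.
by have /andP[] := stirling (ltn0Sn u).
Qed.

Definition below_const (sig : R) := c2 * e * (1 - sig^-1) ^- 2.

(** Sum over the final depth [w]: its weight is at most [(w + 1) sig^-w] times the bound for depth
    [0], and [sig > 1]. *)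
Lemma below_weighted (sig : R) K u : 1 < sig ->
  path_sum K u (fun s => (stays_below s)%:R * sig ^+ sumn s) <=
  below_const sig * (sig * e) ^+ u * decay R u.
Proof.
move=> sig1; have sig0 : 0 < sig by lra.
apply: (@le_trans _ _ (\sum_(0 <= w < u.+1) sig ^+ (u - w) * below_sum R K u (u - w))).
  under eq_bigr => w _ do rewrite -path_sumZ.
  rewrite -path_sum_sum; apply: le_path_sum => s su.
  have [sb|_] /= := boolP (stays_below s); last first.
    by rewrite mul0r; apply: sumr_ge0 => w _; rewrite mulr0.
  have ssu : (sumn s <= u)%N by rewrite -su; case: (s) sb => //= y v /andP[].
  rewrite mul1r (bigD1_seq (u - sumn s)%N) ?iota_uniq //=; last by rewrite mem_iota; lia.
  rewrite subKn // eqxx mulr1 lerDl; apply: sumr_ge0 => w _.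
  by rewrite mulr_ge0 ?ler0n // exprn_ge0 // ltW.
apply: (@le_trans _ _ (\sum_(0 <= w < u.+1) sig ^+ u * park R u u * (w.+1%:R * (sig^-1) ^+ w))).
  rewrite big_nat_cond [leRHS]big_nat_cond.
  apply: ler_sum => w /andP[/andP[_ wu] _].
  have -> : sig ^+ u = sig ^+ (u - w) * sig ^+ w by rewrite -exprD subnK.
  rewrite [leRHS](_ : _ = sig ^+ (u - w) * (w.+1%:R * park R u u)); last first.
    by rewrite exprVn; field; rewrite expf_neq0 // lt0r_neq0.
  rewrite ler_wpM2l ?exprn_ge0 ?(ltW sig0) //.
  by apply: le_trans (below_sum_le _ _ _ _) (park_le _ _).
rewrite -mulr_sumr /below_const exprMn.
have xP : 0 <= sig^-1 < 1 by rewrite invr_ge0 (ltW sig0) invf_lt1.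
have H1 := sum_geom_deriv u.+1 xP.
have H2 := park_diag_le u.
rewrite [leRHS](_ : _ = sig ^+ u * (c2 * e ^+ u.+1 * decay R u) * (1 - sig^-1) ^- 2); last first.
  by rewrite [e ^+ u.+1]exprS; ring.
apply: ler_pM => //.
- by rewrite mulr_ge0 ?park_ge0 // exprn_ge0 // ltW.
- by apply: sumr_ge0 => w _; rewrite mulr_ge0 ?ler0n // exprn_ge0 // invr_ge0 ltW.
by rewrite ler_wpM2l // exprn_ge0 // ltW.
Qed.

(** A walk absorbed from height [v = w.+1] after [2 v] steps has step total [v], so the weight is
    [(2 v)^v / (2 v!)]. Replacing [sqrt v] by [v] loses only a polynomial factor. *)
Lemma hit_sum_ge K w : (2 * w.+1 <= K)%N ->
  c1 / 2 * (2 * e) ^+ w.+1 / w.+1%:R <= hit_sum R K (2 * w.+1) w.+1.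
Proof.
move=> wK; rewrite (_ : (2 * w.+1 = (2 * w).+1.+1)%N) in wK *; last by lia.
rewrite hit_sumE // ifT; last by lia.
rewrite (_ : ((2 * w).+2 - w.+1 = w.+1)%N); last by lia.
rewrite /park (_ : ((2 * w).+2 - w.+1 = w.+1)%N); last by lia.
rewrite (_ : ((2 * w).+2 = 2 * w.+1)%N); last by lia.
have [v vE] : exists v, v = w.+1 by exists w.+1.
rewrite -vE; have v0 : (0 < v)%N by rewrite vE.
have vR : 0 < v%:R :> R by rewrite ltr0n.
rewrite natrM [leRHS](_ : _ = 2^-1 * 2 ^+ v * (v%:R ^+ v / v`!%:R)); last first.
  by rewrite exprMn; field; rewrite fact_neq0 lt0r_neq0.
have [S _] := andP (stirling v0).
have sv : Num.sqrt v%:R <= v%:R :> R.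
  have s0 : 0 < Num.sqrt v%:R :> R by rewrite sqrtr_gt0.
  have : Num.sqrt v%:R ^+ 2 = v%:R :> R by rewrite sqr_sqrtr ?ler0n.
  have : 1 <= v%:R :> R by rewrite ler1n.
  nra.
have X0 : 0 <= v%:R ^+ v / v`!%:R :> R by rewrite divr_ge0 ?exprn_ge0 ?ler0n.
have H : c1 * e ^+ v / v%:R <= v%:R ^+ v / v`!%:R.
  rewrite ler_pdivrMr // [leRHS]mulrC; apply: le_trans S _.
  by rewrite ler_wpM2r.
rewrite exprMn [leLHS](_ : _ = 2^-1 * 2 ^+ v * (c1 * e ^+ v / v%:R)); last by ring.
by rewrite ler_wpM2l // mulr_ge0 ?invr_ge0 ?exprn_ge0 ?ler0n.
Qed.

(* Continue a walk at height [w] by one that first reaches [-1] after [2 (w + 1)] steps;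
   the two first-passage sums are explicit, and the loss [(e / 2) ^+ w] is beaten by [rho ^+ w]. *)
Lemma above_height_le (K t h w : nat) : (h <= 1)%N ->
  path_sum K t (fun s => (stays_above h s && (end_height h s == w))%:R) <=
  h.+1%:R * (2 * c2 / c1) * e ^+ t * decay R t * (w.+1%:R * (e / 2) ^+ w.+1).
Proof.
move=> h1; set K' := maxn K (2 * w.+1).
pose g s : R := (stays_above h s && (end_height h s == w))%:R.
have g0 s : 0 <= g s by rewrite ler0n.
apply: (@le_trans _ _ (path_sum K' t g)); first by apply: path_sum_mono => //; lia.
have := above_hit_le R K' t (2 * w.+1) h w; rewrite -/g.
have hP := @hit_sum_ge K' w; rewrite leq_maxr in hP; have {}hP := hP isT.
set X := path_sum _ _ _ in hP *; move=> gX.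
have X0 : 0 <= X by exact: path_sum_ge0.
have vR : 0 < w.+1%:R :> R by rewrite ltr0n.
have low : 0 < c1 / 2 * (2 * e) ^+ w.+1 / w.+1%:R.
  apply: divr_gt0 => //; apply: mulr_gt0; first by rewrite divr_gt0.
  by rewrite exprn_gt0 // mulr_gt0.
rewrite -(ler_pM2r low).
apply: le_trans (ler_wpM2l X0 hP) _; apply: le_trans gX _.
have [u uE] : exists u, u = (t + (2 * w).+1)%N by exists (t + (2 * w).+1)%N.
rewrite (_ : (t + 2 * w.+1 = u.+1)%N); last by clear - uE h1; lia.
apply: le_trans (hit_sum_le _ _ _) _; first by clear - uE h1; lia.
rewrite (_ : (u.+1 - h.+1 = u - h)%N); last by clear - uE h1; lia.
apply: le_trans (park_le _ _) _; first by clear - uE h1; lia.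
apply: (@le_trans _ _ (h.+1%:R * (c2 * e ^+ u.+1 * decay R t))).
  rewrite ler_wpM2l ?ler0n //; apply: le_trans (park_diag_le _) _.
  rewrite ler_wpM2l ?mulr_ge0 ?exprn_ge0 ?(ltW e_gt0) ?(ltW c2_gt0) //.
  by apply: decay_anti; clear - uE h1; lia.
rewrite (_ : (u.+1 = t + w.+1 + w.+1)%N); last by clear - uE h1; lia.
rewrite !exprD !exprMn exprVn le_eqVlt; apply/orP; left; apply/eqP.
have : 2 ^+ w.+1 != 0 :> R by rewrite expf_neq0 ?pnatr_eq0.
move: (2 ^+ w.+1) (e ^+ w.+1) (e ^+ t) (decay R t) (h.+1%:R : R) => p2 ew et d hh p20.
move: (w.+1%:R : R) vR => v vR {low hP X X0}.
by field; rewrite p20 !lt0r_neq0.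
Qed.

Definition above_const := 2 * (2 * c2 / c1) * (e / 2) * (1 - e * rho / 2) ^- 2.

(** Sums [above_height_le] over the end height; the ratio [e rho / 2] is below one. Start height [1]
    is included because [weighted_above] raises the start by one. *)
Lemma above_weighted K t h : (h <= 1)%N ->
  path_sum K t (fun s => (stays_above h s)%:R * rho ^+ end_height h s) <=
  above_const * e ^+ t * decay R t.
Proof.
move=> h1; have rho0 : 0 < rho by apply: lt_trans rho_gt; rewrite invr_gt0.
set N := (h + t * K).+1.
pose g w s : R := (stays_above h s && (end_height h s == w))%:R.
apply: (@le_trans _ _ (\sum_(0 <= w < N) rho ^+ w * path_sum K t (g w))).
  under eq_bigr => w _ do rewrite -path_sumZ.
  rewrite -path_sum_sum; apply: le_path_sum_lt => s st sK; rewrite /g.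
  have [sa|_] /= := boolP (stays_above h s); last first.
    by rewrite mul0r; apply: sumr_ge0 => w _; rewrite mulr0.
  have ss := sumn_le_mul sK; rewrite st in ss.
  rewrite mul1r (bigD1_seq (end_height h s)) ?iota_uniq //=; last first.
    by rewrite mem_iota /end_height /N; lia.
  rewrite eqxx mulr1 lerDl; apply: sumr_ge0 => w _.
  by rewrite mulr_ge0 ?ler0n // exprn_ge0 // ltW.
pose c := h.+1%:R * (2 * c2 / c1) * e ^+ t * decay R t * (e / 2).
have c0 : 0 <= c.
  by rewrite /c; do ?apply: mulr_ge0; rewrite ?(ltW (decay_gt0 _ _)) ?invr_ge0 ?exprn_ge0 ?ler0n // ltW.
apply: (@le_trans _ _ (\sum_(0 <= w < N) c * (w.+1%:R * (e * rho / 2) ^+ w))).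
  apply: ler_sum => w _; apply: le_trans (ler_wpM2l _ (above_height_le _ _ _ h1)) _.
    by rewrite exprn_ge0 // ltW.
  rewrite le_eqVlt; apply/orP; left; apply/eqP.
  by rewrite /c exprS !exprMn; ring.
have xP : 0 <= e * rho / 2 < 1.
  by rewrite divr_ge0 ?mulr_ge0 ?ltW //= ltr_pdivrMr ?mul1r.
rewrite -mulr_sumr; apply: le_trans (ler_wpM2l c0 (sum_geom_deriv N xP)) _.
have D0 : 0 <= (1 - e * rho / 2) ^- 2 by rewrite invr_ge0 sqr_ge0.
rewrite /c /above_const [leRHS](_ : _ = 2 * (2 * c2 / c1) * e ^+ t * decay R t * (e / 2) * (1 - e * rho / 2) ^- 2); last by ring.
rewrite ler_wpM2r // -!mulrA ler_wpM2r ?ler_nat //.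
by do ?apply: mulr_ge0; rewrite ?(ltW (decay_gt0 _ _)) ?invr_ge0 ?exprn_ge0 ?ler0n // ltW.
Qed.

End CriticalPaths.

(** * The upper bound *)

Section DyadicCounts.
Implicit Types (a s : seq nat).

(** Open on the left so that the harmonic sum over a block is at most [ln 2]; the length [1] then
    lies in no block and is counted separately. *)
Definition in_block (T j : nat) := (2 ^ T < j <= 2 ^ T.+1)%N.

Fixpoint block_counts (T : nat) a : seq nat :=
  if T is T'.+1 then count (in_block T') a :: block_counts T' a else [::].

Lemma size_block_counts T a : size (block_counts T a) = T.
Proof. by elim: T => //= T ->. Qed.

Lemma perm_block_counts T a b : perm_eq a b -> block_counts T a = block_counts T b.
Proof. by move=> ab; elim: T => //= T ->; rewrite (seq.permP ab). Qed.

Lemma block_counts_cat T a b : all (in_block T) b ->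
  block_counts T (b ++ a) = block_counts T a.
Proof.
move=> bT; suff : forall t, (t <= T)%N -> block_counts t (b ++ a) = block_counts t a by apply.
elim=> //= t IHt tT; rewrite IHt; last by lia.
rewrite count_cat; congr (_ :: _); apply/eqP; rewrite -[X in _ == X]add0n eqn_add2r.
rewrite eqn0Ngt -has_count; apply/hasPn => j /(allP bT); rewrite /in_block.
have : (2 ^ t.+1 <= 2 ^ T)%N by rewrite leq_exp2l.
lia.
Qed.

Lemma drop_block_counts d t a : drop d (block_counts (d + t) a) = block_counts t a.
Proof. by elim: d => [|d IHd]; rewrite ?drop0 // addSn. Qed.

Lemma sumn_take_block_counts d t a :
  sumn (take d (block_counts (d + t) a)) =
  count (fun j => 2 ^ t < j <= 2 ^ (d + t))%N a.
Proof.
elim: d => [|d IHd].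
  by rewrite take0 /=; apply/esym/eqP; rewrite eqn0Ngt -has_count; apply/hasPn => j _ /=; rewrite add0n ltnNge; case: leqP.
rewrite addSn /= IHd -[LHS]count_predUI.
rewrite [X in (_ + X)%N](_ : _ = 0%N) ?addn0; last first.
  apply/eqP; rewrite eqn0Ngt -has_count; apply/hasPn => j _ /=.
  by apply/negP => /andP[/andP[j1 _] /andP[_ j2]]; rewrite ltnNge j2 in j1.
apply: eq_count => j /=; rewrite /in_block.
have : (2 ^ t <= 2 ^ (d + t))%N by rewrite leq_exp2l // leq_addl.
have : (2 ^ (d + t) <= 2 ^ (d + t).+1)%N by rewrite leq_exp2l.
lia.
Qed.

Lemma sumn_small_le t a : all (fun j => 0 < j)%N a ->
  (sumn [seq j <- a | (j <= 2 ^ t)%N] <=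
    count_mem 1%N a + weighted_total (block_counts t a))%N.
Proof.
move=> apos; elim: t => [|t IHt] /=.
  rewrite addn0 expn0; elim: a apos => //= j a IHa /andP[j0 /IHa {}IHa].
  by case: (leqP j 1) => /= j1; [rewrite (_ : j = 1%N)|]; lia.
have E : (sumn [seq j <- a | (j <= 2 ^ t.+1)%N] =
  sumn [seq j <- a | (j <= 2 ^ t)%N] + sumn [seq j <- a | in_block t j])%N.
  rewrite !sumnE !big_filter (bigID (fun j => j <= 2 ^ t)%N) /=; congr (_ + _)%N.
    apply: eq_bigl => j; have : (2 ^ t <= 2 ^ t.+1)%N by rewrite leq_exp2l.
    by lia.
  by apply: eq_bigl => j; rewrite /in_block; lia.
rewrite E; have : (sumn [seq j <- a | in_block t j] <= count (in_block t) a * 2 ^ t.+1)%N.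
  elim: (a) => //= j b IHb; rewrite /in_block in IHb *.
  by case: ifP => /= [/andP[_ jt]|_]; rewrite ?mulSn ?add0n //; lia.
by rewrite size_block_counts => H; rewrite addnCA addnC leq_add.
Qed.

(** Each cycle longer than [2 ^ t] at most doubles the number of sums; the others give at most their
    total length plus one, where fixed points are split off as a factor. *)
Lemma num_sums_split_le T t a : (t <= T)%N -> all (fun j => j <= 2 ^ T)%N a ->
  all (fun j => 0 < j)%N a ->
  (num_sums a <= (count_mem 1%N a).+1 *
    (2 ^ sumn (take (T - t) (block_counts T a)) *
     (weighted_total (drop (T - t) (block_counts T a))).+1))%N.
Proof.
move=> tT aT apos.
pose hi := [seq j <- a | predC (fun j => j <= 2 ^ t)%N j].
pose lo := [seq j <- a | (j <= 2 ^ t)%N].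
have -> : num_sums a = num_sums (hi ++ lo).
  by apply: perm_num_sums; rewrite perm_sym perm_catC perm_filterC.
apply: leq_trans (num_sums_cat _ _) _.
rewrite -{2 4}(subnK tT) sumn_take_block_counts drop_block_counts.
have -> : size hi = count (fun j => 2 ^ t < j <= 2 ^ (T - t + t))%N a.
  rewrite /hi size_filter; apply: eq_in_count => j /(allP aT) jT /=.
  by rewrite subnK // jT andbT ltnNge.
rewrite mulnCA leq_mul2l; apply/orP; right.
apply: leq_trans (num_sums_le_sumn _) _.
have := sumn_small_le t apos; rewrite -/lo; nia.
Qed.

Lemma above_size h s : stays_above h s -> (size s <= h + sumn s)%N.
Proof. by elim: s h => //= x s IHs h /andP[hx /IHs]; lia. Qed.

Lemma below_cat s2 s1 : stays_below (s2 ++ s1) -> stays_below s1.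
Proof. by elim: s2 => //= x s2 IHs /andP[/IHs]. Qed.

Lemma below_total s : stays_below s -> (sumn s <= size s)%N.
Proof. by case: s => //= x s /andP[]. Qed.

(** A suffix has nonpositive height and the whole walk ends at [-h] or above, so the steps after
    that suffix rise by at least [-h]. *)
Lemma below_cat_above s2 s1 h : stays_below (s2 ++ s1) ->
  (size s2 + size s1 <= h + sumn s2 + sumn s1)%N -> stays_above h s2.
Proof.
elim: s2 h => //= x s2 IHs h /andP[sb xs] hs.
have := below_total sb; rewrite size_cat sumn_cat in xs * => tot.
have hx : (0 < h + x)%N by lia.
by rewrite hx IHs //; lia.
Qed.

End DyadicCounts.

(** * The mean number of subset sums from above *)

Section UpperBound.
Variable R : rcfType.
Implicit Types (F G : seq nat -> R) (s a b : seq nat).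

Variables (e rho c1 c2 : R).
Hypotheses (e_gt0 : 0 < e) (c1_gt0 : 0 < c1) (c2_gt0 : 0 < c2).
Hypothesis stirling : forall n, (0 < n)%N ->
  c1 * e ^+ n <= Num.sqrt n%:R * (n%:R ^+ n / n`!%:R) <= c2 * e ^+ n.
Hypotheses (rho_gt : 2^-1 < rho) (erho_lt : e * rho < 2).
Hypothesis harmonic_le : forall T, \sum_((2 ^ T).+1 <= j < (2 ^ T.+1).+1) j%:R^-1 <= rho.

Let rho_gt0 : 0 < rho.
Proof. by apply: lt_trans rho_gt; rewrite invr_gt0. Qed.

Lemma harmonic_block_le T M : \sum_(1 <= j < M.+1 | in_block T j) j%:R^-1 <= rho.
Proof.
apply: le_trans (harmonic_le T).
rewrite [leRHS](big_nat_widenl _ 1) /=; last by lia.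
pose N := maxn M (2 ^ T.+1).
rewrite (big_nat_widen _ _ N.+1) /=; last by rewrite /N; lia.
rewrite [leRHS](big_nat_widen _ _ N.+1) /=; last by rewrite /N; lia.
rewrite [leLHS]big_mkcond [leRHS]big_mkcond /=; apply: ler_sum => j _.
have : 0 <= j%:R^-1 :> R by rewrite invr_ge0 ler0n.
rewrite /in_block ltnS; case: ifP => [/andP[-> _] //|_]; by case: ifP.
Qed.

(** Peel off the blocks from the top: [x] cycles in a block have weight at most [rho^x / x!]. Below
    all blocks only fixed points remain, of mass one. *)
Lemma cycle_total_block_counts T M K (Phi : nat -> seq nat -> R) :
  (forall c s, 0 <= Phi c s) -> (M < K)%N ->
  cycle_total (fun j => j <= 2 ^ T)%N M
    (fun a => Phi (count_mem 1%N a) (block_counts T a)) <=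
  \sum_(0 <= c < K) c`!%:R^-1 *
    path_sum K T (fun s => rho ^+ sumn s * Phi c s).
Proof.
elim: T Phi => [|T IHT] Phi Phi0 MK.
  rewrite /= expn0.
  apply: (@le_trans _ _ (cycle_total (fun j => j <= 1)%N M (fun a => Phi (size a) [::]))).
    apply: le_cycle_total => a a1 apos _.
    suff -> : count_mem 1%N a = size a by [].
    apply/eqP; rewrite -all_count; apply/allP => j ja /=.
    by move: (allP a1 _ ja) (allP apos _ ja); clear; lia.
  apply: le_trans (cycle_total_size (lam := 1) (K := K) (G := fun c => Phi c [::]) _ _ _) _ => //.
    case: (M) => [|M']; first by rewrite big_geq.
    rewrite big_mkcond big_nat_recl //= invr1 big1_seq ?addr0 // => j.
    by rewrite mem_index_iota; case: j.
  by apply: ler_sum => c _; rewrite expr1n !mul1r.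
pose Phi' x c s := Phi c (x :: s).
apply: le_trans (@cycle_total_split_le R _ (in_block T) (fun j => j <= 2 ^ T)%N M _ _ _ _ _) _.
- move=> j; rewrite /in_block; have : (2 ^ T <= 2 ^ T.+1)%N by rewrite leq_exp2l.
  by lia.
- by move=> j; rewrite /in_block; apply/negP => /andP[/andP[j1 _] j2]; rewrite ltnNge j2 in j1.
- by move=> a b ab; rewrite (perm_block_counts _ ab) (seq.permP ab).
- by [].
pose G x := \sum_(0 <= c < K) c`!%:R^-1 * path_sum K T (fun s => rho ^+ sumn s * Phi' x c s).
have G0 x : 0 <= G x.
  apply: sumr_ge0 => c _; rewrite mulr_ge0 ?fact_inv_ge0 //.
  by apply: path_sum_ge0 => s; apply: mulr_ge0; [rewrite exprn_ge0 // ltW|exact: Phi0].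
apply: (@le_trans _ _ (cycle_total (in_block T) M (fun b => G (size b)))).
  apply: le_cycle_total => b bT bpos _.
  apply: le_trans (IHT (Phi' (size b)) _ MK); last by move=> c s; exact: Phi0.
  apply: le_cycle_total => a aT _ _.
  have E : block_counts T.+1 (a ++ b) = size b :: block_counts T a.
    have ab : perm_eq (a ++ b) (b ++ a) by rewrite perm_catC.
    rewrite /= (perm_block_counts _ ab) block_counts_cat // count_cat.
    rewrite (_ : count _ a = 0%N).
      by move: bT; rewrite all_count add0n => /eqP ->.
    apply/eqP; rewrite eqn0Ngt -has_count; apply/hasPn => j ja.
    by have := allP aT _ ja; rewrite /= /in_block; case: leqP.
  have E1 : count_mem 1%N (a ++ b) = count_mem 1%N a.
    rewrite count_cat [X in (_ + X)%N](_ : _ = 0%N) ?addn0 //.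
    apply/eqP; rewrite eqn0Ngt -has_count; apply/hasPn => j /(allP bT) /=.
    rewrite /in_block; have : (0 < 2 ^ T)%N by rewrite expn_gt0.
    by case: eqP => // ->; clear; lia.
  by rewrite E1 E.
apply: le_trans (cycle_total_size (K := K) (harmonic_block_le T M) G0 MK) _.
rewrite le_eqVlt; apply/orP; left; apply/eqP.
rewrite /G; under eq_bigr => x _ do rewrite mulr_sumr.
rewrite exchange_big /=; apply: eq_bigr => c _.
rewrite mulr_sumr; apply: eq_bigr => x _.
rewrite mulrCA; congr (_ * _); rewrite mulrAC mulrC; congr (_ * _).
rewrite -path_sumZ; apply: eq_path_sum => s _.
by rewrite exprD mulrA.
Qed.

(** Summing over all cut positions avoids tracking which time is the maximising one; its term alone
    is the desired bound. *)
Definition split_bound s : R :=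
  \sum_(0 <= i < (size s).+1)
    ((stays_below (take i s))%:R * 2 ^+ sumn (take i s)) *
    ((stays_above 0 (drop i s))%:R * (weighted_total (drop i s)).+1%:R).

Lemma num_sums_le_split_bound T a : all (fun j => j <= 2 ^ T)%N a ->
  all (fun j => 0 < j)%N a ->
  (num_sums a)%:R <= (count_mem 1%N a).+1%:R * split_bound (block_counts T a).
Proof.
move=> aT apos; have [s2 [s1 [E b2 a1]]] := argmax_split (block_counts T a).
have sT : (size s2 + size s1 = T)%N by rewrite -size_cat -E size_block_counts.
have := num_sums_split_le (_ : size s1 <= T)%N aT apos.
rewrite (_ : (T - size s1 = size s2)%N); last by clear - sT; lia.
rewrite E take_size_cat // drop_size_cat // => H.
apply: (@le_trans _ _ ((count_mem 1%N a).+1 * (2 ^ sumn s2 * (weighted_total s1).+1))%N%:R).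
  by rewrite ler_nat; apply: H; clear - sT; lia.
rewrite natrM ler_wpM2l ?ler0n // /split_bound.
rewrite (bigD1_seq (size s2)) ?iota_uniq //=; last by rewrite mem_iota size_cat; clear; lia.
rewrite take_size_cat // drop_size_cat // b2 a1 !mul1r natrM natrX lerDl.
by apply: sumr_ge0 => i _; rewrite !mulr_ge0 ?exprn_ge0 ?ler0n.
Qed.

(** Staying above [0] makes [rho ^+ sumn s] equal to [rho ^+ t] times the end-height weight. The
    length factor costs [2 ^+ t.+1] by [weighted_above], and [1 + 2 ^+ t.+1 <= 3 * 2 ^+ t]. *)
Lemma above_weighted_total K t :
  path_sum K t (fun s => (stays_above 0 s)%:R * (weighted_total s).+1%:R * rho ^+ sumn s) <=
  3 * above_const e rho c1 c2 * (2 * rho * e) ^+ t * decay R t.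
Proof.
set C := above_const _ _ _ _.
have A0 : path_sum K t (fun s => (stays_above 0 s)%:R * rho ^+ sumn s) <=
    rho ^+ t * (C * e ^+ t * decay R t).
  apply: le_trans (ler_wpM2l _ (above_weighted e_gt0 c1_gt0 c2_gt0 stirling rho_gt erho_lt K t (leq0n 1))); last first.
    by rewrite exprn_ge0 // ltW.
  rewrite -path_sumZ; apply: le_path_sum => s st.
  have [sa|_] := boolP (stays_above 0 s); last by rewrite !mul0r mulr0.
  have := above_size sa; rewrite !mul1r -exprD /end_height st => ss.
  by rewrite (_ : (t + (0 + sumn s - t) = sumn s)%N) //; lia.
have A1 : path_sum K t (fun s => (stays_above 1 s)%:R * rho ^+ (sumn s).+1) <=
    rho ^+ t * (C * e ^+ t * decay R t).
  apply: le_trans (ler_wpM2l _ (above_weighted e_gt0 c1_gt0 c2_gt0 stirling rho_gt erho_lt K t (leqnn 1))); last first.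
    by rewrite exprn_ge0 // ltW.
  rewrite -path_sumZ; apply: le_path_sum => s st.
  have [sa|_] := boolP (stays_above 1 s); last by rewrite !mul0r mulr0.
  have := above_size sa; rewrite !mul1r -exprD /end_height st => ss.
  by rewrite (_ : (t + (1 + sumn s - t) = (sumn s).+1)%N) //; lia.
have W := @weighted_above R K t 0 (fun m => rho ^+ m) (fun m => exprn_ge0 m (ltW rho_gt0)).
rewrite (@eq_path_sum _ _ _ _ (fun s => (stays_above 0 s)%:R * rho ^+ sumn s +
   (weighted_total s)%:R * ((stays_above 0 s)%:R * rho ^+ sumn s))); last first.
  by move=> s _; rewrite -natr1; ring.
rewrite path_sumD; apply: le_trans (lerD A0 (le_trans W (ler_wpM2l _ A1))) _.
  by rewrite exprn_ge0.
have X0 : 0 <= rho ^+ t * (C * e ^+ t * decay R t).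
  apply: le_trans A0; apply: path_sum_ge0 => s.
  by rewrite mulr_ge0 ?ler0n // exprn_ge0 // ltW.
rewrite [leRHS](_ : _ = 3 * 2 ^+ t * (rho ^+ t * (C * e ^+ t * decay R t))); last first.
  by rewrite !exprMn; ring.
rewrite -{1}[rho ^+ t * _]mul1r -mulrDl ler_wpM2r // exprS.
have : 1 <= 2 ^+ t :> R by rewrite exprn_ege1 // ler1n.
lra.
Qed.

(** The later steps [s2] carry the weight [2 rho] per cycle and the earlier ones [rho]. The two
    decays are convolved, and [72 = 3 * 24]. *)
Lemma path_sum_split_bound K T :
  path_sum K T (fun s => rho ^+ sumn s * split_bound s) <=
  72 * above_const e rho c1 c2 * below_const e c2 (2 * rho) *
    (2 * rho * e) ^+ T * decay R T.
Proof.
set Ca := above_const _ _ _ _; set Cb := below_const _ _ _.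
have sig1 : 1 < 2 * rho by move: rho_gt; lra.
have q0 : 0 <= 2 * rho * e by rewrite !mulr_ge0 // ltW.
rewrite (@eq_path_sum _ _ _ _ (fun s => \sum_(0 <= i < T.+1)
    ((stays_below (take i s))%:R * (2 * rho) ^+ sumn (take i s)) *
    ((stays_above 0 (drop i s))%:R * (weighted_total (drop i s)).+1%:R * rho ^+ sumn (drop i s)))); last first.
  move=> s sT; rewrite /split_bound sT mulr_sumr; apply: eq_bigr => i _.
  by rewrite -{1}(cat_take_drop i s) sumn_cat exprD exprMn; ring.
rewrite path_sum_sum.
apply: (@le_trans _ _ (\sum_(0 <= i < T.+1) (3 * Ca * Cb * (2 * rho * e) ^+ T) * (decay R i * decay R (T - i)))).
  rewrite big_nat_cond [leRHS]big_nat_cond.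
  apply: ler_sum => i /andP[/andP[_ iT] _].
  rewrite -[T in path_sum K T](_ : (i + (T - i) = T)%N); last by lia.
  rewrite path_sum_cat.
  rewrite (@eq_path_sum _ _ _ _ (fun s2 =>
     path_sum K (T - i) (fun s => (stays_above 0 s)%:R * (weighted_total s).+1%:R * rho ^+ sumn s) *
     ((stays_below s2)%:R * (2 * rho) ^+ sumn s2))); last first.
    move=> s2 s2i; rewrite [RHS]mulrC -path_sumZ; apply: eq_path_sum => s1 _.
    by rewrite take_size_cat // drop_size_cat.
  rewrite path_sumZ.
  rewrite [leRHS](_ : _ = (3 * Ca * (2 * rho * e) ^+ (T - i) * decay R (T - i)) *
     (Cb * (2 * rho * e) ^+ i * decay R i)); last first.
    have -> : (2 * rho * e) ^+ T = (2 * rho * e) ^+ (T - i) * (2 * rho * e) ^+ i.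
      by rewrite -exprD subnK.
    by ring.
  apply: ler_pM.
  - by apply: path_sum_ge0 => s; rewrite !mulr_ge0 ?ler0n // exprn_ge0 // ltW.
  - apply: path_sum_ge0 => s; rewrite mulr_ge0 ?ler0n // exprn_ge0 // ltW //; lra.
  - exact: above_weighted_total.
  exact: (below_weighted e_gt0 c1_gt0 c2_gt0 stirling rho_gt erho_lt).
rewrite -mulr_sumr.
have P0 : 0 <= 3 * Ca * Cb * (2 * rho * e) ^+ T.
  rewrite mulr_ge0 ?exprn_ge0 // /Ca /Cb /above_const /below_const.
  do ?apply: mulr_ge0; rewrite ?invr_ge0 ?sqr_ge0 ?exprn_ge0 ?ler0n // ltW //.
apply: le_trans (ler_wpM2l P0 (decay_conv R T)) _.
by rewrite le_eqVlt; apply/orP; left; apply/eqP; ring.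
Qed.

(** The mean of the fixed-point factor is bounded, because [2^c <= 2 c!]. *)
Lemma sum_fact_inv K : \sum_(0 <= c < K) c`!%:R^-1 * c.+1%:R <= 8 :> R.
Proof.
apply: (@le_trans _ _ (\sum_(0 <= c < K) 2 * (c.+1%:R * (2^-1) ^+ c))).
  apply: ler_sum => c _.
  rewrite mulrCA mulrC ler_wpM2l ?ler0n // exprVn.
  rewrite -[leRHS]invf_div lef_pV2 ?posrE ?ltr0n ?fact_gt0 ?divr_gt0 ?exprn_gt0 //.
  rewrite ler_pdivrMr // -natrX -natrM ler_nat.
  elim: c => [|c IHc]; first by rewrite fact0.
  by rewrite expnS factS; case: c IHc => // c; nia.
rewrite -mulr_sumr.
have xP : 0 <= (2^-1 : R) < 1 by rewrite invr_ge0 ler0n invf_lt1 ?ltr1n.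
have := sum_geom_deriv K xP.
rewrite (_ : (1 - 2^-1) ^- 2 = 4); last by field.
lra.
Qed.

(** Here [576] is [72] from the walks times [8] from the fixed points. *)
Definition upper_const := 576 * above_const e rho c1 c2 * below_const e c2 (2 * rho).

Lemma cycle_total_num_sums_le n k T : (k <= 2 ^ T)%N ->
  cycle_total (fun j => j <= k)%N n (fun a => (num_sums a)%:R : R) <=
  upper_const * (2 * rho * e) ^+ T * decay R T.
Proof.
move=> kT.
apply: (@le_trans _ _ (cycle_total (fun j => j <= 2 ^ T)%N n (fun a => (num_sums a)%:R : R))).
  apply: ler_sum => m _.
  apply: le_trans (@cycle_mean_subpred R (fun j => j <= 2 ^ T)%N (fun j => j <= k)%N m _ _ _) _ => //.
    by move=> j jk; apply: leq_trans jk kT.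
  apply: le_cycle_mean => a _; case: all; by rewrite ?mul1r ?mul0r.
pose Phi c s : R := c.+1%:R * split_bound s.
have sb0 s : 0 <= split_bound s.
  by apply: sumr_ge0 => i _; rewrite !mulr_ge0 ?exprn_ge0 ?ler0n.
apply: (@le_trans _ _ (cycle_total (fun j => j <= 2 ^ T)%N n
    (fun a => Phi (count_mem 1%N a) (block_counts T a)))).
  by apply: le_cycle_total => a aT apos _; exact: num_sums_le_split_bound.
apply: le_trans (cycle_total_block_counts (K := n.+1) _ _ _) _ => //.
  by move=> c s; rewrite mulr_ge0 ?ler0n.
rewrite (eq_bigr (fun c => c`!%:R^-1 * c.+1%:R *
   path_sum n.+1 T (fun s => rho ^+ sumn s * split_bound s))); last first.
  move=> c _; rewrite -mulrA; congr (_ * _); rewrite -path_sumZ.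
  by apply: eq_path_sum => s _; rewrite /Phi mulrCA.
rewrite -mulr_suml.
have P0 : 0 <= path_sum n.+1 T (fun s => rho ^+ sumn s * split_bound s).
  by apply: path_sum_ge0 => s; rewrite mulr_ge0 // exprn_ge0 // ltW.
apply: le_trans (ler_wpM2r P0 (sum_fact_inv _)) _.
apply: le_trans (ler_wpM2l _ (path_sum_split_bound _ _)) _ => //.
by rewrite /upper_const le_eqVlt; apply/orP; left; apply/eqP; ring.
Qed.

End UpperBound.

(** * The lower bound *)

Section NestedSums.
Variable R : realFieldType.
Implicit Types (F G : seq nat -> R) (s a b : seq nat).

(** Closed on the left, unlike [in_block], so that the harmonic sum is at least [ln 2]; the length
    [1] belongs to block [0]. *)
Definition low_block (T j : nat) := (2 ^ T <= j < 2 ^ T.+1)%N.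

(** Here [s] prescribes the number of cycles in each block, top block first, and the lists are
    ordered within each block; the weight is the inverse product of the lengths. *)
Fixpoint nested_sum s F : R :=
  if s is x :: s'
  then nested_sum s' (fun a =>
    block_sum (low_block (size s')) (2 ^ (size s').+1) x (fun b => F (b ++ a)))
  else F [::].

Lemma le_nested_sum s F G : (forall a, size a = sumn s -> F a <= G a) ->
  nested_sum s F <= nested_sum s G.
Proof.
elim: s F G => [|x s IHs] F G FG /=; first exact: FG.
apply: IHs => a sa; apply: le_block_sum => b bx; apply: FG.
by rewrite size_cat bx sa.
Qed.

Lemma eq_nested_sum s F G : (forall a, size a = sumn s -> F a = G a) ->
  nested_sum s F = nested_sum s G.
Proof.
by move=> FG; apply/eqP; rewrite eq_le !le_nested_sum // => a sa; rewrite FG.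
Qed.

Lemma nested_sum_lin s c d F G :
  nested_sum s (fun a => c * F a + d * G a) = c * nested_sum s F + d * nested_sum s G.
Proof.
elim: s F G => [|x s IHs] F G //=; rewrite -IHs; apply: eq_nested_sum => a _.
by rewrite block_sum_lin.
Qed.

Lemma block_sum_ge0 (J : pred nat) w x F : (forall a, 0 <= F a) ->
  0 <= block_sum J w x F.
Proof.
elim: x F => [|x IHx] F F0 /=; first exact: F0.
by apply: IHx => a; apply: sumr_ge0 => j _; rewrite mulr_ge0 // invr_ge0 ler0n.
Qed.

Lemma nested_sum_ge0 s F : (forall a, 0 <= F a) -> 0 <= nested_sum s F.
Proof.
elim: s F => [|x s IHs] F F0 /=; first exact: F0.
by apply: IHs => a; apply: block_sum_ge0.
Qed.

Lemma block_sum_sym (J : pred nat) w x F : symmetric_fun F ->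
  symmetric_fun (fun a => block_sum J w x (fun b => F (b ++ a))).
Proof.
move=> Fs a a' aa; apply: eq_block_sum => b _.
by apply: Fs; rewrite perm_cat2l.
Qed.

(** The weights [1 / y!] of the path undo the orderings within the blocks, and
    [weighted_total s <= M] leaves room for every choice of lengths. *)
Lemma nested_sum_le_total K T M F : symmetric_fun F -> (forall a, 0 <= F a) ->
  path_sum K T (fun s => (weighted_total s <= M)%N%:R * nested_sum s F) <=
  cycle_total (fun j => j < 2 ^ T)%N M F.
Proof.
elim: T M F => [|T IHT] M F Fs F0 /=.
  rewrite mul1r /cycle_total big_nat_recl // cycle_mean0 lerDl.
  by apply: sumr_ge0 => m _; apply: cycle_mean_ge0.
pose w := (2 ^ T.+1)%N.
pose Fx x a := (count (low_block T) a == x)%:R * F a.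
have Fx0 x a : 0 <= Fx x a by rewrite mulr_ge0.
have Fxs x : symmetric_fun (Fx x).
  by move=> a b ab; rewrite /Fx (seq.permP ab) (Fs _ _ ab).
apply: (@le_trans _ _ (\sum_(0 <= x < K) cycle_total (fun j => j < 2 ^ T.+1)%N M (Fx x))); last first.
  rewrite -cycle_total_sum; apply: le_cycle_total => a _ _ _.
  rewrite -mulr_suml ler_piMl // -natr_sum (ler_nat _ _ 1).
  have [aK|aK] := ltnP (count (low_block T) a) K.
    rewrite (bigD1_seq (count (low_block T) a)) ?iota_uniq ?mem_iota ?subn0 //=.
    rewrite eqxx big1 // => x; by rewrite eq_sym => /negPf ->.
  rewrite big1_seq // => x; rewrite mem_index_iota => /= xK.
  by case: eqP => // E; rewrite E in aK; lia.
apply: ler_sum => x _.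
have [xM|xM] := leqP (x * w) M; last first.
  rewrite (@eq_path_sum _ _ _ _ (fun=> 0 * 0)); last first.
    move=> s sT; rewrite mul0r sT (_ : (_ <= M)%N = false) ?mul0r //.
    by apply/negbTE; rewrite -ltnNge; apply: leq_trans xM (leq_addr _ _).
  rewrite path_sumZ mul0r mulr0.
  by apply: cycle_total_ge0.
have low_le j : low_block T j -> (j <= w)%N by rewrite /low_block /w; lia.
have JE j : (j < 2 ^ T.+1)%N = (j < 2 ^ T)%N || low_block T j.
  rewrite /low_block; have : (2 ^ T <= 2 ^ T.+1)%N by rewrite leq_exp2l.
  by case: (ltnP j (2 ^ T)) => //=; lia.
have JD j : ~~ ((j < 2 ^ T)%N && low_block T j).
  by rewrite /low_block; case: (leqP (2 ^ T)%N j); rewrite ?andbF.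
apply: le_trans (cycle_total_split_ge (M1 := (M - x * w)%N) (M2 := (x * w)%N) JE JD (Fxs x) (Fx0 x) _); last by lia.
pose G a := block_sum (low_block T) w x (fun b => F (b ++ a)).
rewrite (@eq_path_sum _ _ _ _ (fun s => (weighted_total s <= M - x * w)%N%:R * nested_sum s G)); last first.
  move=> s sT; rewrite sT -/w; congr (_ * _); congr (nat_of_bool _)%:R.
  by move: xM; clear; set u := (x * w)%N; set v := weighted_total s; lia.
apply: le_trans (ler_wpM2l (fact_inv_ge0 R x) (IHT _ _ _ _)) _.
- exact: block_sum_sym.
- by move=> a; apply: block_sum_ge0.
rewrite -cycle_totalZ; apply: le_cycle_total => a aT _ _.
rewrite mulrC.
apply: le_trans (@block_sum_le_total R (low_block T) w x (x * w) (fun b => F (b ++ a)) low_le _ _ _) _ => //.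
  by move=> b b' bb; apply: Fs; rewrite perm_cat2r.
apply: le_cycle_total => b bT _ _; rewrite /Fx count_cat.
have -> : count (low_block T) a = 0%N.
  apply/eqP; rewrite eqn0Ngt -has_count; apply/hasPn => j /(allP aT) ja.
  by move: (JD j); rewrite ja.
by rewrite addn0; move: bT; rewrite all_count => /eqP ->.
Qed.

(** Normalised by the number of diagonal pairs. *)
Definition energy a : R := (sum_energy a)%:R / 2 ^+ size a.

Variable rho : R.
Hypothesis rho_gt0 : 0 < rho.

Definition block_mass T : R :=
  \sum_(1 <= j < (2 ^ T.+1).+1 | low_block T j) j%:R^-1.

Hypothesis block_mass_ge : forall T, rho <= block_mass T.

Lemma block_mass_gt0 T : 0 < block_mass T.
Proof. exact: lt_le_trans rho_gt0 _. Qed.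

(** A new cycle [j] adds the pairs whose sums differ by [j]; over all [j] these are at most
    [4 ^ size a] pairs, each with weight at most [1 / 2^T]. *)
Lemma energy_cons_sum T a :
  \sum_(1 <= j < (2 ^ T.+1).+1 | low_block T j) j%:R^-1 * energy (j :: a) <=
  block_mass T * energy a + 2 ^+ size a / 2 ^+ T.
Proof.
have p0 n : 0 < 2 ^+ n :> R by rewrite exprn_gt0.
have E j : energy (j :: a) = energy a + (sum_shift a j)%:R / 2 ^+ size a.
  rewrite /energy sum_energy_cons natrD !natrM /= exprS.
  by field; rewrite lt0r_neq0.
under eq_bigr => j _ do rewrite E mulrDr.
rewrite big_split /= -mulr_suml lerD2l.
apply: (@le_trans _ _ (\sum_(1 <= j < (2 ^ T.+1).+1) (2 ^+ T)^-1 * ((sum_shift a j)%:R / 2 ^+ size a))).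
  rewrite big_mkcond /= big_nat_cond [leRHS]big_nat_cond.
  apply: ler_sum => j /andP[/andP[j1 _] _].
  have X0 : 0 <= (sum_shift a j)%:R / 2 ^+ size a :> R by rewrite divr_ge0 // ltW.
  case: ifP => [/andP[Tj _]|_]; last by rewrite mulr_ge0 // invr_ge0 ltW.
  rewrite ler_wpM2r // lef_pV2 ?posrE ?ltr0n // -natrX ler_nat //.
rewrite -mulr_sumr -mulr_suml mulrC ler_wpM2r ?invr_ge0 ?(ltW (p0 _)) //.
rewrite ler_pdivrMr // -natr_sum -!natrX -natrM ler_nat.
by apply: leq_trans (sum_shift_range _ _ _) _; rewrite -expnMn.
Qed.

(** The increments of successive entries add up to [1 + 2 + ... + 2^(x - 1)]; since
    [rho <= block_mass T], the factor [1 / rho] restores the missing power of the block mass. *)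
Lemma block_sum_energy T x a :
  block_sum (low_block T) (2 ^ T.+1) x (fun b => energy (b ++ a)) <=
  block_mass T ^+ x * (energy a + rho^-1 * (2 ^+ size a / 2 ^+ T) * (2 ^+ x - 1)).
Proof.
have p0 n : 0 < 2 ^+ n :> R by rewrite exprn_gt0.
elim: x => [|x IHx] /=; first by rewrite !expr0 subrr mulr0 addr0 mul1r.
set m := block_mass T in IHx *; set q := 2 ^+ size a / 2 ^+ T in IHx *.
have q0 : 0 <= q by rewrite divr_ge0 // ltW.
have m0 : 0 < m := block_mass_gt0 T.
apply: (@le_trans _ _ (block_sum (low_block T) (2 ^ T.+1) x
   (fun b => m * energy (b ++ a) + (q * 2 ^+ x) * 1))).
  apply: le_block_sum => b bx; apply: le_trans (energy_cons_sum _ _) _.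
  rewrite lerD2l size_cat bx exprD mulr1 /q le_eqVlt; apply/orP; left; apply/eqP; ring.
rewrite block_sum_lin block_sum_cst mul1r -/(block_mass T) -/m.
apply: le_trans (lerD (ler_wpM2l (ltW m0) IHx) (lexx _)) _.
have mr : 1 <= rho^-1 * m by rewrite ler_pdivlMl // mulr1 block_mass_ge.
have mx : 0 <= m ^+ x by rewrite exprn_ge0 // ltW.
have H : q * 2 ^+ x * m ^+ x * 1 <= q * 2 ^+ x * m ^+ x * (rho^-1 * m).
  by rewrite ler_wpM2l // mulr_ge0 // mulr_ge0 // ltW.
rewrite mulr1 in H; apply: le_trans (lerD (lexx _) H) _.
by rewrite !exprS le_eqVlt; apply/orP; left; apply/eqP; ring.
Qed.

(** The sum of [2 ^ W_t] over the times [t >= 1], where [W_t] is the height of the walk. *)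
Fixpoint profile s : R :=
  if s is x :: s' then 2 ^+ (x + sumn s') / 2 ^+ (size s').+1 + profile s' else 0.

Definition energy_bound s := 1 + 2 / rho * profile s.

Fixpoint nested_mass s : R :=
  if s is x :: s' then nested_mass s' * block_mass (size s') ^+ x else 1.

Lemma nested_sum_cst s c : nested_sum s (fun=> c) = c * nested_mass s.
Proof.
elim: s c => [|x s IHs] c /=; first by rewrite mulr1.
rewrite block_sum_cst IHs -/(block_mass (size s)); ring.
Qed.

Lemma nested_mass_ge s : rho ^+ sumn s <= nested_mass s.
Proof.
elim: s => [|x s IHs] //=; rewrite exprD mulrC.
apply: ler_pM => //; try by rewrite exprn_ge0 // ltW.
by apply: lerXn2r; rewrite // nnegrE ltW // block_mass_gt0.
Qed.

(** Each block adds one term [2 ^ W_t], from [block_sum_energy] with the [- 1] dropped; the [2] in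
    [2 / rho] makes up for one more power of two in the denominator of [profile]. *)
Lemma nested_sum_energy s : nested_sum s energy <= nested_mass s * energy_bound s.
Proof.
have p0 n : 0 < 2 ^+ n :> R by rewrite exprn_gt0.
elim: s => [|x s IHs] /=.
  by rewrite mul1r /energy_bound mulr0 addr0 /energy /sum_energy /= big_seq1 /= expr0 divr1.
set m := block_mass (size s).
have mx : 0 <= m ^+ x by rewrite exprn_ge0 // ltW // block_mass_gt0.
pose d := rho^-1 * (2 ^+ sumn s / 2 ^+ size s) * 2 ^+ x.
apply: (@le_trans _ _ (nested_sum s (fun a => m ^+ x * energy a + (m ^+ x * d) * 1))).
  apply: le_nested_sum => a sa; apply: le_trans (block_sum_energy _ _ _) _.
  rewrite mulr1 -mulrDr ler_wpM2l // lerD2l sa /d ler_wpM2l ?gerBl //.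
  by rewrite mulr_ge0 ?invr_ge0 ?divr_ge0 // ltW.
rewrite nested_sum_lin nested_sum_cst mul1r.
apply: le_trans (lerD (ler_wpM2l mx IHs) (lexx _)) _.
rewrite le_eqVlt; apply/orP; left; apply/eqP.
rewrite /energy_bound /= /d exprS exprD; field.
by rewrite !lt0r_neq0.
Qed.

Lemma profile_ge0 s : 0 <= profile s.
Proof.
by elim: s => //= x s IHs; rewrite addr_ge0 // divr_ge0 ?exprn_ge0.
Qed.

(** Applies [num_sums_ge_energy] with the [al] that maximises [2 al - al^2 A], where [A] is the
    bound for the mean energy. *)
Lemma nested_sum_num_sums s :
  (2 * rho) ^+ sumn s / energy_bound s <= nested_sum s (fun a => (num_sums a)%:R).
Proof.
have A0 : 0 < energy_bound s.
  by apply: ltr_wpDr => //; rewrite mulr_ge0 ?profile_ge0 ?divr_ge0 // ltW.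
pose al := (energy_bound s)^-1.
have p0 : 0 < 2 ^+ sumn s :> R by rewrite exprn_gt0.
apply: (@le_trans _ _ (nested_sum s (fun a =>
   (2 * al * 2 ^+ sumn s) * 1 + (- (al ^+ 2 * 2 ^+ sumn s)) * energy a))); last first.
  apply: le_nested_sum => a sa; apply: le_trans (num_sums_ge_energy a al).
  rewrite natrX sa mulr1 mulNr /energy sa lerD2l lerN2.
  by rewrite le_eqVlt; apply/orP; left; apply/eqP; field; rewrite lt0r_neq0.
rewrite nested_sum_lin nested_sum_cst mul1r.
have c0 : 0 <= al ^+ 2 * 2 ^+ sumn s by rewrite mulr_ge0 ?sqr_ge0 // ltW.
have := ler_wpM2l c0 (nested_sum_energy s).
have E : al ^+ 2 * 2 ^+ sumn s * (nested_mass s * energy_bound s) =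
    al * 2 ^+ sumn s * nested_mass s.
  by rewrite /al; field; rewrite lt0r_neq0.
rewrite E => H.
have : (2 * rho) ^+ sumn s / energy_bound s <= al * 2 ^+ sumn s * nested_mass s.
  rewrite exprMn mulrC -/al -mulrA ler_wpM2l ?invr_ge0 ?(ltW A0) //.
  by rewrite ler_wpM2l ?nested_mass_ge // ltW.
move: H; rewrite mulNr; move: (nested_sum s energy) => X; lra.
Qed.

End NestedSums.

(** * Averages over walks that stay below zero and end at zero *)

Section LowerBound.
Variable R : rcfType.
Implicit Types (F G : seq nat -> R) (s a b : seq nat).

Variables (e rho c1 c2 : R).
Hypotheses (e_gt0 : 0 < e) (c1_gt0 : 0 < c1) (c2_gt0 : 0 < c2).
Hypothesis stirling : forall n, (0 < n)%N ->
  c1 * e ^+ n <= Num.sqrt n%:R * (n%:R ^+ n / n`!%:R) <= c2 * e ^+ n.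
Hypotheses (rho_gt : 2^-1 < rho) (erho_lt : e * rho < 2).
Hypothesis harmonic_ge : forall T, rho <= \sum_(2 ^ T <= j < 2 ^ T.+1) j%:R^-1.

Let rho_gt0 : 0 < rho.
Proof. by apply: lt_trans rho_gt; rewrite invr_gt0. Qed.

Lemma block_mass_harmonic T : rho <= block_mass R T.
Proof.
apply: le_trans (harmonic_ge T) _; rewrite /block_mass.
have T0 : (0 < 2 ^ T)%N by rewrite expn_gt0.
by rewrite (big_nat_widenl _ 1) //= (big_nat_widen _ _ (2 ^ T.+1).+1) //=.
Qed.

Lemma profileE s : profile R s =
  \sum_(0 <= i < size s) 2 ^+ sumn (drop i s) / 2 ^+ size (drop i s).
Proof.
elim: s => [|x s IHs]; first by rewrite big_nil.
by rewrite /= IHs big_nat_recl //= drop0.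
Qed.

Definition critical_path (T : nat) s := stays_below s && (sumn s == T).

(** Cut the walk at time [t], at height [-w]. The earlier part has depth [w] and the weight
    [2 ^- w]; the later part, read backwards, stays nonnegative and ends at height [w], so
    [above_weighted] applies. *)
Lemma profile_term_le K i t :
  path_sum K (i + t) (fun s => (critical_path (i + t) s)%:R *
    (2 ^+ sumn (drop i s) / 2 ^+ size (drop i s))) <=
  above_const e rho c1 c2 * below_const e c2 (2 * rho) * e ^+ (i + t) *
    (decay R i * decay R t).
Proof.
have sig0 : 0 < 2 * rho by rewrite mulr_gt0.
have sig1 : 1 < 2 * rho by move: rho_gt; lra.
rewrite path_sum_cat.
pose C := (1 - (2 * rho)^-1) ^- 2.
have C0 : 0 <= C by rewrite invr_ge0 sqr_ge0.
pose B := c2 * e ^+ t.+1 * decay R t.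
have B0 : 0 <= B.
  by rewrite /B !mulr_ge0 ?exprn_ge0 ?(ltW (decay_gt0 _ _)) ?(ltW e_gt0) ?(ltW c2_gt0).
apply: (@le_trans _ _ (path_sum K i (fun s2 => (C * B) *
    ((stays_above 0 s2)%:R * rho ^+ end_height 0 s2)))); last first.
  rewrite path_sumZ.
  have CB0 : 0 <= C * B by rewrite mulr_ge0.
  apply: le_trans (ler_wpM2l CB0 (above_weighted e_gt0 c1_gt0 c2_gt0 stirling rho_gt erho_lt K i (leq0n 1))) _.
  rewrite /B /below_const -/C exprD [e ^+ t.+1]exprS.
  by rewrite le_eqVlt; apply/orP; left; apply/eqP; ring.
apply: le_path_sum => s2 s2i.
pose w := end_height 0 s2.
have [sa|sna] := boolP (stays_above 0 s2); last first.
  rewrite mul0r mulr0 (@eq_path_sum _ _ _ _ (fun=> 0 * 0)); last first.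
    move=> s1 s1t; rewrite mul0r (_ : critical_path _ _ = false) ?mul0r //.
    apply/negbTE/negP => /andP[sb /eqP E]; case/negP: sna.
    apply: below_cat_above sb _; rewrite s2i s1t -E sumn_cat; clear; lia.
  by rewrite path_sumZ mul0r.
have ws : (size s2 + w = sumn s2)%N.
  by have := above_size sa; rewrite /w /end_height; clear; lia.
have [wt|tw] := leqP w t; last first.
  rewrite (@eq_path_sum _ _ _ _ (fun=> 0 * 0)); last first.
    move=> s1 s1t; rewrite mul0r (_ : critical_path _ _ = false) ?mul0r //.
    apply/negbTE/negP => /andP[sb /eqP].
    by rewrite sumn_cat -ws s2i; move: tw; clear; lia.
  rewrite path_sumZ mul0r; apply: mulr_ge0; first exact: mulr_ge0.
  by rewrite mul1r exprn_ge0 // ltW.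
apply: (@le_trans _ _ (path_sum K t (fun s1 => 2 ^- w *
    (stays_below s1 && (sumn s1 == t - w)%N)%:R))).
  apply: le_path_sum => s1 s1t; rewrite drop_size_cat //.
  have [/andP[sb /eqP]|_] := boolP (critical_path _ _); last first.
    by rewrite mul0r mulr_ge0 ?invr_ge0 ?exprn_ge0.
  rewrite (below_cat sb) sumn_cat -ws s2i => E.
  have E1 : (sumn s1 = t - w)%N by move: E; clear; lia.
  rewrite E1 eqxx !mulr1 mul1r s1t -{2}(subnK wt) exprD.
  rewrite le_eqVlt; apply/orP; left; apply/eqP; field.
  by rewrite !expf_neq0 ?pnatr_eq0.
rewrite path_sumZ mul1r.
have low := le_trans (below_sum_le R K t (t - w)) (park_le R wt).
have {}low := le_trans low (ler_wpM2l (ler0n _ w.+1) (park_diag_le stirling t)).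
have w2 : 0 <= 2 ^- w :> R by rewrite invr_ge0 exprn_ge0.
apply: le_trans (ler_wpM2l w2 low) _; rewrite -/B.
(* A single term of a series that converges because [2 rho > 1]; it trades [2 ^- w] for the weight
   [rho ^+ w] on the later part. *)
suff H : w.+1%:R * 2 ^- w <= C * rho ^+ w.
  rewrite mulrA [2 ^- w * _]mulrC [leRHS](_ : _ = C * rho ^+ w * B); last by rewrite -/w; ring.
  by rewrite ler_wpM2r.
have xP : 0 <= (2 * rho)^-1 < 1 by rewrite invr_ge0 (ltW sig0) invf_lt1.
have := sum_geom_deriv w.+1 xP; rewrite big_nat_recr //= -/C => H.
have {}H : w.+1%:R * (2 * rho)^-1 ^+ w <= C.
  apply: le_trans H; rewrite lerDr; apply: sumr_ge0 => j _.
  by rewrite mulr_ge0 ?ler0n // exprn_ge0 // invr_ge0 ltW.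
have rw : 0 <= rho ^+ w by rewrite exprn_ge0 // ltW.
apply: le_trans (ler_wpM2r rw H).
rewrite exprVn exprMn le_eqVlt; apply/orP; left; apply/eqP; field.
by rewrite !expf_neq0 ?pnatr_eq0 // lt0r_neq0.
Qed.

Definition profile_const := 24 * above_const e rho c1 c2 * below_const e c2 (2 * rho).

Lemma profile_const_ge0 : 0 <= profile_const.
Proof.
rewrite /profile_const /above_const /below_const.
by do ?apply: mulr_ge0; rewrite ?invr_ge0 ?sqr_ge0 ?ler0n // ltW.
Qed.

Lemma critical_profile_le K T :
  path_sum K T (fun s => (critical_path T s)%:R * profile R s) <=
  profile_const * e ^+ T * decay R T.
Proof.
rewrite (@eq_path_sum _ _ _ _ (fun s => \sum_(0 <= i < T) (critical_path T s)%:R *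
    (2 ^+ sumn (drop i s) / 2 ^+ size (drop i s)))); last first.
  by move=> s sT; rewrite profileE sT mulr_sumr.
rewrite path_sum_sum.
set C := above_const e rho c1 c2 * below_const e c2 (2 * rho).
have C0 : 0 <= C by have := profile_const_ge0; rewrite /profile_const -mulrA -/C; lra.
apply: (@le_trans _ _ (\sum_(0 <= i < T) (C * e ^+ T) * (decay R i * decay R (T - i)))).
  rewrite big_nat_cond [leRHS]big_nat_cond.
  apply: ler_sum => i /andP[/andP[_ iT] _].
  have E : (i + (T - i) = T)%N by lia.
  by have := profile_term_le K i (T - i); rewrite E.
rewrite -mulr_sumr.
have CT : 0 <= C * e ^+ T by rewrite mulr_ge0 // exprn_ge0 // ltW.
apply: le_trans (ler_wpM2l CT (_ : _ <= 24 * decay R T)) _.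
  apply: le_trans (decay_conv R T); rewrite big_nat_recr //= lerDl.
  by rewrite mulr_ge0 // ltW // decay_gt0.
rewrite /profile_const -[24 * above_const _ _ _ _ * _]mulrA -/C.
by rewrite le_eqVlt; apply/orP; left; apply/eqP; ring.
Qed.

(** For [T > 0], [size_bias] lowers the total from [T] to [T - 1], and [park T (T - 1)] is at most
    twice [park T T]. *)
Lemma critical_weight_le K T :
  path_sum K T (fun s => (critical_path T s)%:R * (weighted_total s)%:R) <=
  4 * 2 ^+ T * park R T T.
Proof.
rewrite (@eq_path_sum _ _ _ _ (fun s => (weighted_total s)%:R *
    ((stays_below s)%:R * (sumn s == T)%:R))); last first.
  by move=> s _; rewrite /critical_path -mulnb natrM mulrC.
apply: le_trans (@weighted_below R K T (fun m => (m == T)%:R) _) _.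
  by move=> m; rewrite ler0n.
case: T => [|T].
  by rewrite /= mulr0 mulr0 mulr_ge0 ?park_ge0 // mulr_ge0.
have -> : 4 * 2 ^+ T.+1 * park R T.+1 T.+1 = 2 ^+ T.+2 * (2 * park R T.+1 T.+1).
  by rewrite [in RHS]exprS; ring.
rewrite ler_wpM2l ?exprn_ge0 //.
apply: (@le_trans _ _ (below_sum R K T.+1 T)).
  by apply: le_path_sum => s _; rewrite eqSS -natrM mulnb.
apply: le_trans (below_sum_le _ _ _ _) _.
have := @park_le R T.+1 1 isT; by rewrite subSS subn0.
Qed.

Lemma critical_sumE K T : (T < K)%N ->
  path_sum K T (fun s => (critical_path T s)%:R) = park R T T.
Proof. exact: below_sumE. Qed.

Definition energy_const := 1 + 2 / rho * (profile_const / (c1 * e)).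

Lemma energy_const_gt0 : 0 < energy_const.
Proof.
rewrite /energy_const ltr_wpDr // mulr_ge0 // divr_ge0 ?profile_const_ge0 //.
  by rewrite ltW.
by rewrite mulr_ge0 // ltW.
Qed.

Lemma critical_energy_le K T : (T < K)%N ->
  path_sum K T (fun s => (critical_path T s)%:R * energy_bound rho s) <=
  energy_const * park R T T.
Proof.
move=> TK; rewrite (@eq_path_sum _ _ _ _ (fun s => (critical_path T s)%:R +
   2 / rho * ((critical_path T s)%:R * profile R s))); last first.
  by move=> s _; rewrite /energy_bound; ring.
rewrite path_sumD path_sumZ critical_sumE //.
rewrite /energy_const [leRHS]mulrDl [1 * park _ _ _]mul1r lerD2l -[leRHS]mulrA.
rewrite ler_wpM2l ?divr_ge0 ?(ltW rho_gt0) //.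
apply: le_trans (critical_profile_le _ _) _.
have ce : 0 < c1 * e by rewrite mulr_gt0.
rewrite -[leRHS]mulrA -[leLHS]mulrA ler_wpM2l ?profile_const_ge0 //.
rewrite ler_pdivlMl //.
have := park_diag_ge stirling T.
by rewrite exprS !mulrA.
Qed.

(* [1 / A >= 2 be - be ^+ 2 * A] with [be] the inverse of the mean of [A], and Markov's inequality for [weighted_total]. *)
Lemma critical_sum_ge K T M : (T < K)%N -> (16 * 2 ^ T <= M)%N ->
  (2 * energy_const)^-1 * park R T T <=
  path_sum K T (fun s => (critical_path T s && (weighted_total s <= M)%N)%:R /
    energy_bound rho s).
Proof.
move=> TK MT.
pose be := energy_const^-1.
have be0 : 0 < be by rewrite invr_gt0 energy_const_gt0.
have T0 : 0 < 2 ^+ T :> R by rewrite exprn_gt0.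
apply: (@le_trans _ _ (path_sum K T (fun s =>
   2 * be * (critical_path T s)%:R +
   ((- (2 * be / (16 * 2 ^+ T))) * ((critical_path T s)%:R * (weighted_total s)%:R) +
   (- be ^+ 2) * ((critical_path T s)%:R * energy_bound rho s))))); last first.
  apply: le_path_sum => s _.
  have [_|_] /= := boolP (critical_path T s); last by rewrite !mul0r !mulr0 !addr0.
  have A0 : 0 < energy_bound rho s.
    by rewrite ltr_wpDr // mulr_ge0 ?profile_ge0 ?divr_ge0 // ltW.
  have tang : 2 * be - be ^+ 2 * energy_bound rho s <= (energy_bound rho s)^-1.
    rewrite -subr_ge0 (_ : _ - _ = (1 - be * energy_bound rho s) ^+ 2 / energy_bound rho s).
      by rewrite divr_ge0 ?sqr_ge0 // ltW.
    by field; rewrite lt0r_neq0.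
  have t0 : 0 <= be ^+ 2 * energy_bound rho s by rewrite mulr_ge0 ?sqr_ge0 // ltW.
  have b2 : 0 <= 2 * be by rewrite mulr_ge0 // ltW.
  rewrite mulr1 mul1r !mul1r.
  have [wM|Mw] := leqP (weighted_total s) M.
    rewrite mul1r; apply: le_trans tang; rewrite lerD2l !mulNr gerDr.
    by rewrite oppr_le0 mulr_ge0 ?ler0n // divr_ge0 // ltW // mulr_gt0.
  rewrite mul0r !mulNr.
  have : 2 * be <= 2 * be / (16 * 2 ^+ T) * (weighted_total s)%:R.
    rewrite -[leLHS]mulr1 -[leRHS]mulrA ler_wpM2l // ler_pdivlMl ?mulr_gt0 // mulr1.
    by rewrite -natrX -natrM ler_nat ltnW // (leq_ltn_trans MT Mw).
  lra.
rewrite !path_sumD !path_sumZ critical_sumE //.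
have p0 := park_ge0 R T T.
have H1 := critical_weight_le K T; have H2 := critical_energy_le TK.
have Q0 : 0 <= 2 * be / (16 * 2 ^+ T) by rewrite divr_ge0 ?mulr_ge0 // ltW.
have {H1} := ler_wpM2l Q0 H1; have {H2} := ler_wpM2l (sqr_ge0 be) H2.
have -> : be ^+ 2 * (energy_const * park R T T) = be * park R T T.
  by rewrite /be; field; rewrite lt0r_neq0 // energy_const_gt0.
have -> : 2 * be / (16 * 2 ^+ T) * (4 * 2 ^+ T * park R T T) = 2^-1 * (be * park R T T).
  by field; rewrite lt0r_neq0.
have -> : (2 * energy_const)^-1 * park R T T = 2^-1 * (be * park R T T).
  by rewrite invfM -/be mulrA.
have -> : 2 * be * park R T T = 2 * (be * park R T T) by rewrite mulrA.
rewrite !mulNr; move: (be * park R T T) => x; lra.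
Qed.

Definition lower_const := (2 * energy_const)^-1 * (c1 * e).

(** On critical paths [sumn s = T], so all of them carry the same power [(2 rho)^T]; what remains is
    [critical_sum_ge]. *)
Lemma cycle_total_num_sums_ge T M : (16 * 2 ^ T <= M)%N ->
  lower_const * (2 * rho * e) ^+ T * decay R T <=
  cycle_total (fun j => j < 2 ^ T)%N M (fun a => (num_sums a)%:R : R).
Proof.
move=> MT.
have ns : symmetric_fun (fun a => (num_sums a)%:R : R).
  by move=> a b /perm_num_sums ->.
apply: le_trans (nested_sum_le_total T.+1 T M ns (fun a => ler0n _ _)).
have r2 : 0 <= (2 * rho) ^+ T by rewrite exprn_ge0 // mulr_ge0 // ltW.
apply: (@le_trans _ _ ((2 * rho) ^+ T * path_sum T.+1 T (fun s =>
   (critical_path T s && (weighted_total s <= M)%N)%:R / energy_bound rho s))).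
  rewrite [leLHS](_ : _ = (2 * rho) ^+ T * ((2 * energy_const)^-1 * (c1 * e ^+ T.+1 * decay R T))).
    rewrite ler_wpM2l //; apply: le_trans (critical_sum_ge (ltnSn T) MT).
    rewrite ler_wpM2l ?invr_ge0 ?mulr_ge0 ?(ltW energy_const_gt0) //.
    exact: (park_diag_ge stirling).
  by rewrite /lower_const exprMn [e ^+ T.+1]exprS; ring.
rewrite -path_sumZ; apply: le_path_sum => s sT.
have [/andP[/andP[_ /eqP sT'] ->]|_] := boolP (_ && _); last first.
  by rewrite mul0r mulr0 mulr_ge0 ?nested_sum_ge0 // => a; rewrite ler0n.
rewrite !mul1r -sT'.
exact: nested_sum_num_sums rho_gt0 block_mass_harmonic s.
Qed.

End LowerBound.

(** * Cycle lengths of permutations *)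

Section CycleLengths.
Variable T : finType.
Implicit Types (A B : {set T}) (s p c : {perm T}).

(** Permutations of a subset [A] are permutations of [T] supported on [A]; the recursion can thus
    pass from [A] to the complement of an orbit. *)
Definition cycle_lengths A s : seq nat :=
  [seq #|P| | P : {set T} <- enum (porbit s @: A)].

Lemma stable_astabs B s : {in B, forall x, s x \in B} -> s \in ('N(B | 'P))%g.
Proof.
move=> sB; rewrite !inE /=.
apply/fintype.subsetP => x xB; by rewrite inE; apply: sB.
Qed.

Lemma agree_porbit B s p x : {in B, s =1 p} -> {in B, forall y, p y \in B} ->
  x \in B -> porbit s x = porbit p x /\ porbit p x \subset B.
Proof.
move=> sp pB xB.
have agree i : (s ^+ i)%g x = (p ^+ i)%g x /\ (p ^+ i)%g x \in B.
  elim: i => [|i [IH1 IH2]]; first by rewrite !expg0 !perm1.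
  by rewrite !expgSr !permM IH1 sp // pB.
split; last by apply/fintype.subsetP => y /porbitP[i ->]; case: (agree i).
apply/setP => y; apply/porbitP/porbitP => -[i ->]; exists i; case: (agree i) => //.
Qed.

Lemma perm_enum_setU1 (I : finType) (S : {set I}) (x : I) : x \notin S ->
  perm_eq (enum (x |: S)) (x :: enum S).
Proof.
move=> xS; apply: uniq_perm; rewrite /= ?enum_uniq ?mem_enum ?xS // => y.
by rewrite inE !mem_enum in_setU1.
Qed.

Section SplitCycle.
Variables (A B : {set T}) (a : T).
Hypotheses (aB : a \in B) (BA : B \subset A).

Definition one_cycle c := perm_on B c && (porbit c a == B).

Section Product.
Variables (c p : {perm T}).
Hypotheses (cB : perm_on B c) (pAB : perm_on (A :\: B) p).

Lemma mul_in x : x \in B -> (c * p)%g x = c x.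
Proof.
move=> xB; rewrite permM (out_perm pAB) // inE (perm_closed x cB) xB //.
Qed.

Lemma mul_out x : x \notin B -> (c * p)%g x = p x.
Proof. by move=> xB; rewrite permM (out_perm cB). Qed.

Lemma mul_on : perm_on A (c * p)%g.
Proof.
apply: perm_onM; apply/fintype.subsetP => x.
  by move/(fintype.subsetP cB); apply: (fintype.subsetP BA).
by move/(fintype.subsetP pAB); rewrite inE => /andP[].
Qed.

Lemma mul_porbit_in : porbit (c * p)%g a = porbit c a.
Proof.
have [] // := @agree_porbit B (c * p)%g c a mul_in _ aB.
by move=> y yB; rewrite (perm_closed y cB).
Qed.

Lemma mul_porbit_out x : x \in A :\: B ->
  porbit (c * p)%g x = porbit p x /\ porbit p x \subset A :\: B.
Proof.
apply: agree_porbit => y yAB; last by rewrite (perm_closed y pAB).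
by apply: mul_out; move: yAB; rewrite inE => /andP[].
Qed.

Lemma restr_mul : restr_perm B (c * p)%g = c /\ restr_perm (A :\: B) (c * p)%g = p.
Proof.
split; apply/permP => x.
  have st : (c * p)%g \in ('N(B | 'P))%g.
    by apply: stable_astabs => y yB; rewrite mul_in // (perm_closed y cB).
  have [xB|xB] := boolP (x \in B); first by rewrite restr_permE // mul_in.
  by rewrite (out_perm (restr_perm_on _ _)) // (out_perm cB).
have st : (c * p)%g \in ('N(A :\: B | 'P))%g.
  apply: stable_astabs => y yB; rewrite mul_out; last by move: yB; rewrite inE => /andP[].
  by rewrite (perm_closed y pAB).
have [xB|xB] := boolP (x \in A :\: B).
  by rewrite restr_permE // mul_out //; move: xB; rewrite inE => /andP[].
by rewrite (out_perm (restr_perm_on _ _)) // (out_perm pAB).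
Qed.

Lemma cycle_lengths_mul : porbit c a = B ->
  perm_eq (cycle_lengths A (c * p)%g) (#|B| :: cycle_lengths (A :\: B) p).
Proof.
move=> ca; have caP : porbit (c * p)%g a = B by rewrite mul_porbit_in.
have E : porbit (c * p)%g @: A = B |: porbit p @: (A :\: B).
  apply/setP => P; rewrite in_setU1; apply/imsetP/orP.
    case=> x xA ->; have [xB|xB] := boolP (x \in B).
      by left; rewrite -caP eq_porbit_mem caP.
    have xAB : x \in A :\: B by rewrite inE xB.
    by right; apply/imsetP; exists x => //; case: (mul_porbit_out xAB).
  case=> [/eqP ->|/imsetP[x xAB ->]]; first by exists a; rewrite ?caP // (fintype.subsetP BA).
  have [E _] := mul_porbit_out xAB; exists x => //.
  by move: xAB; rewrite inE => /andP[].
rewrite /cycle_lengths E -[_ :: _]/([seq #|P| | P : {set T} <- B :: enum (porbit p @: (A :\: B))]).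
apply: perm_map; apply: perm_enum_setU1; apply/imsetP => -[x xAB BE].
have : x \in B by rewrite BE porbit_id.
by move: xAB; rewrite inE => /andP[/negPf ->].
Qed.

End Product.

Lemma split_cycle s : perm_on A s -> porbit s a = B ->
  (restr_perm B s * restr_perm (A :\: B) s)%g = s.
Proof.
move=> sA sa; apply/permP => x; rewrite permM.
have sB y : y \in B -> s y \in B.
  by rewrite -sa => /porbitP[i ->]; rewrite -permM -expgSr mem_porbit.
have stB : s \in ('N(B | 'P))%g by apply: stable_astabs.
have sBV y : s y \in B -> y \in B.
  have E : porbit s (s y) = porbit s y by have := porbit_perm s 1 y; rewrite expg1.
  by rewrite -sa -!eq_porbit_mem E.
have stAB : s \in ('N(A :\: B | 'P))%g.
  apply: stable_astabs => y; rewrite !inE => /andP[yB yA].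
  by rewrite (perm_closed y sA) yA andbT; apply: contra yB; apply: sBV.
have [xB|xB] := boolP (x \in B).
  rewrite [restr_perm B s x]restr_permE // (out_perm (restr_perm_on _ _)) //.
  by rewrite inE sB.
rewrite (out_perm (restr_perm_on _ _) xB).
have [xA|xA] := boolP (x \in A); first by rewrite restr_permE // inE xB.
rewrite (out_perm (restr_perm_on _ _)) ?(out_perm sA) //.
by rewrite inE (negPf xA) andbF.
Qed.

Variable R : realFieldType.

(** Restricting to [B] and to its complement in [A] is a bijection onto pairs of a single cycle on
    [B] and a permutation of the complement. *)
Lemma sum_fixed_cycle (F : seq nat -> R) : symmetric_fun F ->
  \sum_(s | perm_on A s && (porbit s a == B)) F (cycle_lengths A s) =
  #|[set c | one_cycle c]|%:R *
    \sum_(p | perm_on (A :\: B) p) F (#|B| :: cycle_lengths (A :\: B) p).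
Proof.
move=> Fs.
rewrite (reindex_onto (fun cp : {perm T} * {perm T} => (cp.1 * cp.2)%g)
  (fun s => (restr_perm B s, restr_perm (A :\: B) s))) /=; last first.
  by move=> s /andP[sA /eqP sa]; apply: split_cycle.
transitivity (\sum_(cp : {perm T} * {perm T} | one_cycle cp.1 && perm_on (A :\: B) cp.2)
   F (#|B| :: cycle_lengths (A :\: B) cp.2)).
  apply: eq_big => [[c p]|[c p]] /=.
    apply/idP/idP.
      move=> /andP[/andP[_ cpa] /eqP[cE pE]].
      have cB : perm_on B c by rewrite -cE restr_perm_on.
      have pAB : perm_on (A :\: B) p by rewrite -pE restr_perm_on.
      by rewrite /one_cycle cB pAB andbT -(mul_porbit_in cB pAB).
    move=> /andP[/andP[cB ca] pAB].
    have [E1 E2] := restr_mul cB pAB.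
    by rewrite mul_on // mul_porbit_in // ca /= E1 E2.
  move=> /andP[/andP[_ cpa] /eqP[cE pE]].
  have cB : perm_on B c by rewrite -cE restr_perm_on.
  have pAB : perm_on (A :\: B) p by rewrite -pE restr_perm_on.
  apply: Fs; apply: cycle_lengths_mul => //.
  by rewrite -(mul_porbit_in cB pAB); apply/eqP.
rewrite -(pair_big one_cycle (fun p => perm_on (A :\: B) p)
  (fun c p => F (#|B| :: cycle_lengths (A :\: B) p))) /=.
rewrite sumr_const mulr_natl; congr (_ *+ _); apply: eq_card => c; by rewrite inE.
Qed.
End SplitCycle.
Variable R : realFieldType.

Lemma sum_cycle_lengths_rec (F : seq nat -> R) A a : symmetric_fun F -> a \in A ->
  \sum_(s | perm_on A s) F (cycle_lengths A s) =
  \sum_(B : {set T} | (a \in B) && (B \subset A))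
    #|[set c | one_cycle B a c]|%:R *
      \sum_(p | perm_on (A :\: B) p) F (#|B| :: cycle_lengths (A :\: B) p).
Proof.
move=> Fs aA.
rewrite (partition_big (fun s => porbit s a) (fun B => (a \in B) && (B \subset A))) /=.
  by apply: eq_bigr => B /andP[aB BA]; apply: sum_fixed_cycle.
move=> s sA; rewrite porbit_id /=.
apply/fintype.subsetP => y /porbitP[i ->]; elim: i => [|i IHi]; first by rewrite expg0 perm1.
by rewrite expgSr permM (perm_closed _ sA).
Qed.

(** Here [j] counts the points of [B] other than [a], hence [g j.+1]. *)
Lemma sum_subsets_card A a (g : nat -> R) : a \in A ->
  \sum_(B : {set T} | (a \in B) && (B \subset A)) g #|B| =
  \sum_(0 <= j < #|A|) 'C(#|A|.-1, j)%:R * g j.+1.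
Proof.
move=> aA; have cA : #|A :\ a| = #|A|.-1 by rewrite (cardsD1 a A) aA.
rewrite (reindex_onto (fun B => a |: B) (fun B => B :\ a)) /=; last first.
  by move=> B /andP[aB _]; rewrite finset.setD1K.
transitivity (\sum_(B : {set T} | B \subset A :\ a) g #|B|.+1).
  have E B : (a |: B) :\ a == B = (a \notin B).
    apply/eqP/idP => [<-|aB]; first by rewrite !inE eqxx.
    by rewrite setU1K.
  apply: eq_big => B.
    rewrite E setU11 /= subsetD1 finset.subUset finset.sub1set aA /=; by rewrite andbC.
  by rewrite E => /andP[_ aB]; rewrite cardsU1 aB.
have A0 : (0 < #|A|)%N by apply/card_gt0P; exists a.
transitivity (\sum_(j < #|A|) \sum_(B : {set T} | (B \subset A :\ a) && (#|B| == j)) g #|B|.+1).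
  have lt (B : {set T}) : B \subset A :\ a -> (#|B| < #|A|)%N.
    by move=> /subset_leq_card; rewrite cA; lia.
  rewrite (partition_big (fun B : {set T} => inord #|B| : 'I_#|A|.-1.+1) predT) //=.
  rewrite -[#|A| in RHS]prednK //; apply: eq_bigr => j _; apply: eq_bigl => B.
  have [BA|//] := boolP (B \subset _); rewrite /= -(inj_eq val_inj) /= inordK //.
  by rewrite prednK // lt.
rewrite big_mkord; apply: eq_bigr => j _.
rewrite (eq_bigr (fun=> g j.+1)); last by move=> B /andP[_ /eqP ->].
rewrite sumr_const -[g j.+1 *+ _]mulr_natl; congr (_%:R * _).
by rewrite -cA -cards_draws; apply: eq_card => B; rewrite inE.
Qed.

Lemma choose_fact n j : (j < n)%N ->
  'C(n.-1, j)%:R * (j`!%:R * (n - j.+1)`!%:R) = n.-1`!%:R :> R.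
Proof.
case: n => // n jn; rewrite subSS /= -(@bin_fact n j) //.
by rewrite !natrM.
Qed.

(** Compares two decompositions of [|B|!] over the sets [C] containing [a]: by the orbit of [a], and
    as the binomial sum of [(|C| - 1)! (|B| - |C|)!]. By induction the terms with [C] proper agree,
    hence so do those with [C = B]. *)
Lemma card_one_cycle B a : a \in B -> #|[set c | one_cycle B a c]| = #|B|.-1`!.
Proof.
move: {2}#|B|.+1 (ltnSn #|B|) => n; elim: n B => // n IHn B Bn aB.
have B0 : (0 < #|B|)%N by apply/card_gt0P; exists a.
have E := @sum_cycle_lengths_rec (fun=> 1) B a (fun _ _ _ => erefl) aB.
rewrite sumr_const card_perm in E.
have Eg := @sum_subsets_card B a (fun j => j.-1`!%:R * (#|B| - j)`!%:R) aB.
rewrite (eq_big_nat _ _ (F2 := fun=> #|B|.-1`!%:R)) in Eg; last first.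
  by move=> j /andP[_ jB]; rewrite choose_fact.
rewrite sumr_const_nat subn0 in Eg.
have {}Eg : \sum_(C : {set T} | (a \in C) && (C \subset B)) (#|C|.-1)`!%:R * (#|B| - #|C|)`!%:R = (#|B|)`!%:R :> R.
  by rewrite Eg -{3}(prednK B0) factS prednK // natrM mulr_natl.
rewrite -{}Eg in E.
rewrite [X in X = _](bigD1 B) ?aB ?subxx //= [X in _ = X](bigD1 B) ?aB ?subxx //= in E.
have rest : \sum_(C : {set T} | (a \in C) && (C \subset B) && (C != B)) #|C|.-1`!%:R * (#|B| - #|C|)`!%:R =
  \sum_(C : {set T} | (a \in C) && (C \subset B) && (C != B))
    #|[set c | one_cycle C a c]|%:R * \sum_(p | perm_on (B :\: C) p) 1 :> R.
  apply: eq_bigr => C /andP[/andP[aC CB] CnB].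
  have ltC : (#|C| < #|B|)%N by apply: proper_card; rewrite finset.properEneq CnB.
  rewrite IHn //; last by lia.
  rewrite sumr_const; congr (_ * _); congr _%:R.
  rewrite -[RHS]/(#|perm_on (B :\: C)|) card_perm.
  by rewrite cardsD (finset.setIidPr CB).
rewrite rest in E; move/addIr: E.
have -> : \sum_(p | perm_on (B :\: B) p) 1 = 1 :> R.
  by rewrite sumr_const -[X in 1 *+ X]/(#|perm_on (B :\: B)|) card_perm finset.setDv cards0.
rewrite subnn fact0 !mulr1.
by move/eqP; rewrite eqr_nat eq_sym => /eqP.
Qed.

(** With [n = |A|], an orbit of size [j] through a given point accounts for [C(n - 1, j - 1) (j -
    1)! (n - j)! = (n - 1)!], whatever [j] is; this is the recursion of [cycle_mean]. *)
Lemma sum_cycle_lengths (F : seq nat -> R) A : symmetric_fun F ->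
  \sum_(s | perm_on A s) F (cycle_lengths A s) =
  (#|A|)`!%:R * cycle_mean predT #|A| F.
Proof.
move: {2}#|A|.+1 (ltnSn #|A|) => n; elim: n A F => // n IHn A F An Fs.
have [A0|[a aA]] := set_0Vmem A.
  rewrite A0 cards0 fact0 mul1r cycle_mean0.
  rewrite (big_pred1 1%g) => [|s].
    by rewrite /cycle_lengths imset0 enum_set0.
  apply/idP/eqP => [s0|->]; last exact: perm_on1.
  by apply: (perm_on_id s0); rewrite cards0.
have A0 : (0 < #|A|)%N by apply/card_gt0P; exists a.
rewrite (sum_cycle_lengths_rec Fs aA).
pose g j : R := j.-1`!%:R * ((#|A| - j)`!%:R * cycle_mean predT (#|A| - j) (fun b => F (j :: b))).
transitivity (\sum_(B : {set T} | (a \in B) && (B \subset A)) g #|B|).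
  apply: eq_bigr => B /andP[aB BA]; rewrite card_one_cycle // /g; congr (_ * _).
  have cAB : #|A :\: B| = (#|A| - #|B|)%N by rewrite cardsD (finset.setIidPr BA).
  have B0 : (0 < #|B|)%N by apply/card_gt0P; exists a.
  rewrite (IHn (A :\: B) (fun b => F (#|B| :: b))) ?cAB //; first by lia.
  by move=> b b' bb; apply: Fs; rewrite perm_cons.
rewrite sum_subsets_card //.
rewrite -{3}(prednK A0) factS prednK // natrM mulrAC cycle_meanS //.
rewrite mulrC big_add1 mulr_sumr; apply: eq_big_nat => j /andP[_ jA].
by rewrite /g /= mulrA mulrA -(mulrA _ _ (_`!%:R)) choose_fact.
Qed.

End CycleLengths.

(** * Invariant sets as unions of orbits *)

Section InvariantSets.
Variable T : finType.
Implicit Types (A : {set T}) (s : {perm T}) (k : nat).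

Lemma subset_sums_map (I : eqType) (f : I -> nat) (r : seq I) v :
  v \in subset_sums (map f r) ->
  exists2 r', subseq r' r & v = sumn (map f r').
Proof.
elim: r v => [|x r IHr] v; first by rewrite inE => /eqP ->; exists [::].
rewrite [map _ _]/= mem_subset_sums_cons => /orP[/IHr|/andP[xv /IHr]] [r' rr' E].
  exists r' => //; exact: subseq_trans rr' (subseq_cons _ _).
by exists (x :: r'); rewrite /= ?eqxx // -E subnKC.
Qed.

Lemma porbit_stable s A x : s @: A = A -> x \in A -> porbit s x \subset A.
Proof.
move=> sA xA; apply/fintype.subsetP => y /porbitP[i ->].
elim: i => [|i IHi]; first by rewrite expg0 perm1.
by rewrite expgSr permM -sA imset_f.
Qed.

Lemma card_cover_porbits s (Q : {set {set T}}) : Q \subset porbits s ->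
  #|finset.cover Q| = (\sum_(P in Q) #|P|)%N.
Proof.
move=> Qs; have triv : finset.trivIset (porbits s).
  apply/finset.trivIsetP => _ _ /imsetP[x _ ->] /imsetP[y _ ->]; apply: contraR.
  case/pred0Pn => z /andP[/=]; rewrite -!eq_porbit_mem => /eqP <- /eqP <-.
  exact: eqxx.
by apply/esym/eqP; apply: trivIsetS Qs triv.
Qed.

(** Orbits are disjoint, so the size of a union of orbits is the sum of the corresponding cycle
    lengths. *)
Lemma invariant_setE s k :
  [exists A : {set T}, (#|A| == k) && (s @: A == A)] =
  (k \in subset_sums (cycle_lengths [set: T] s)).
Proof.
have oT : porbit s @: [set: T] = porbits s.
  by apply/setP => P; apply/imsetP/imsetP => -[x _ ->]; exists x; rewrite ?inE.
apply/existsP/idP => [[A /andP[/eqP Ak /eqP sA]]|].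
  pose Q := porbit s @: A.
  have Qs : Q \subset porbits s by rewrite -oT; apply: imsetS; apply: finset.subsetT.
  have QA : finset.cover Q = A.
    apply/setP => x; apply/bigcupP/idP => [[P /imsetP[y yA ->]]|xA].
      by apply/fintype.subsetP; apply: porbit_stable.
    by exists (porbit s x); [apply: imset_f|apply: porbit_id].
  have := card_cover_porbits Qs; rewrite QA Ak => ->.
  have -> : (\sum_(P in Q) #|P|)%N = sumn [seq #|P| | P : {set T} <- enum Q].
    by rewrite sumnE big_map big_enum.
  rewrite /cycle_lengths oT (@perm_subset_sums _ ([seq #|P| | P : {set T} <- enum Q] ++
    [seq #|P| | P : {set T} <- enum (porbits s :\: Q)])) ?mem_sumn_cat //.
  rewrite -map_cat; apply: perm_map; apply: uniq_perm; rewrite ?enum_uniq //.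
    rewrite cat_uniq !enum_uniq andbT /=; apply/hasPn => P.
    by rewrite !mem_enum inE => /andP[].
  move=> P; rewrite mem_cat !mem_enum finset.in_setD.
  by have [PQ|] := boolP (P \in Q); rewrite //= (fintype.subsetP Qs).
case/subset_sums_map => r' rr' ->.
have ur : uniq r' := subseq_uniq rr' (enum_uniq _).
pose Q := [set P : {set T} | P \in r'].
have Qs : Q \subset porbits s.
  by rewrite -oT; apply/fintype.subsetP => P; rewrite inE => /(mem_subseq rr'); rewrite mem_enum.
exists (finset.cover Q); apply/andP; split.
  rewrite (card_cover_porbits Qs) sumnE big_map big_uniq //=.
  by apply/eqP; apply: eq_bigl => P; rewrite inE.
apply/eqP/setP => x; apply/imsetP/bigcupP => [[y /bigcupP[P PQ yP] ->]|[P PQ xP]].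
  exists P => //; have /imsetP[z _ E] := fintype.subsetP Qs _ PQ.
  have sy : porbit s (s y) = porbit s y by have := porbit_perm s 1 y; rewrite expg1.
  by rewrite E -eq_porbit_mem sy eq_porbit_mem -E.
exists ((s^-1)%g x); last by rewrite permKV.
apply/bigcupP; exists P => //; have /imsetP[z _ E] := fintype.subsetP Qs _ PQ.
have sx : porbit s ((s^-1)%g x) = porbit s x.
  by have := porbit_perm s 1 ((s^-1)%g x); rewrite expg1 permKV.
by rewrite E -eq_porbit_mem sx eq_porbit_mem -E.
Qed.

Lemma card_invariant_set (R : realFieldType) k :
  #|[set s : {perm T} | [exists A : {set T}, (#|A| == k) && (s @: A == A)]]|%:R =
  (#|T|)`!%:R * invariant_mean R #|T| k.
Proof.
rewrite /invariant_mean -cardsT -sum_cycle_lengths; last first.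
  by move=> a b ab; rewrite (perm_subset_sums ab).
rewrite -sum1_card natr_sum big_mkcond [RHS]big_mkcond /=.
apply: eq_bigr => s _; rewrite inE invariant_setE.
have -> : perm_on [set: T] s by apply/fintype.subsetP => x _; rewrite inE.
by case: (_ \in _).
Qed.

End InvariantSets.

(** * Logarithms and factorials *)

Section Analysis.
Variable R : realType.

(** From [1 + x < e^x] at [x = -1/2]; it makes the weight [2 rho] in [below_weighted] exceed one. *)
Lemma ln2_gt_half : 2^-1 < ln 2 :> R.
Proof.
rewrite -ltr_expR lnK ?posrE //.
have := @expR_gt1Dx R (- 2^-1); rewrite oppr_eq0 invr_eq0 pnatr_eq0 /= => /(_ isT).
rewrite expRN (_ : 1 - 2^-1 = 2^-1); last by field.
by rewrite ltf_pV2 ?posrE ?expR_gt0.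
Qed.

(** From [1 + x < e^x] at [x = 2 / e - 1]; it makes the series over end heights in [above_weighted]
    converge. *)
Lemma e_ln2_lt2 : expR 1 * ln 2 < 2 :> R.
Proof.
have e2 : 2 < expR 1 :> R by have := @expR_gt1Dx R 1; rewrite oner_eq0 => /(_ isT).
have e0 : 0 < expR 1 :> R := expR_gt0 1.
rewrite -ltr_pdivlMl // -ltr_expR lnK ?posrE //.
have ne : 2 / expR 1 - 1 != 0 :> R.
  rewrite subr_eq0; apply: contraTneq e2 => E.
  by rewrite -leNgt -[leRHS](divfK (lt0r_neq0 e0)) E mul1r.
have := expR_gt1Dx ne; rewrite addrC subrK expRB ltr_pdivlMr // divfK ?lt0r_neq0 //.
by rewrite mulrC.
Qed.

Lemma ln_ge_onesub (x : R) : 0 < x -> 1 - x^-1 <= ln x.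
Proof.
move=> x0; rewrite -[leRHS]opprK -lnV ?posrE // lerNr opprB.
have := @le_ln1Dx R (x^-1 - 1); rewrite addrCA subrr addr0; apply.
have : 0 < x^-1 by rewrite invr_gt0.
lra.
Qed.

Lemma ln_le_sub1 (x : R) : 0 < x -> ln x <= x - 1.
Proof.
by move=> x0; have := @le_ln1Dx R (x - 1); rewrite addrCA subrr addr0; apply; lra.
Qed.

Lemma ln_ratio_telescope (m n : nat) : (0 < m <= n)%N ->
  \sum_(m <= j < n) ln (j.+1%:R / j%:R) = ln (n%:R / m%:R) :> R.
Proof.
move=> /andP[m0 mn]; rewrite lnM ?lnV ?posrE ?invr_gt0 ?ltr0n //; last by lia.
rewrite -(telescope_sumr (fun j => ln j%:R)) //; apply: eq_big_nat => j /andP[mj _].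
by rewrite lnM ?lnV ?posrE ?invr_gt0 ?ltr0n //; lia.
Qed.

Lemma ln_dyadic T : ln ((2 ^ T.+1)%N%:R / (2 ^ T)%N%:R) = ln 2 :> R.
Proof. by rewrite expnS natrM mulfK // pnatr_eq0 -lt0n expn_gt0. Qed.

(** Since [1 / (j + 1) <= ln ((j + 1) / j)], and these logarithms telescope over the block. *)
Lemma harmonic_dyadic_le T :
  \sum_((2 ^ T).+1 <= j < (2 ^ T.+1).+1) j%:R^-1 <= ln 2 :> R.
Proof.
have T0 : (0 < 2 ^ T)%N by rewrite expn_gt0.
have TT : (2 ^ T <= 2 ^ T.+1)%N by rewrite leq_exp2l.
rewrite -(ln_dyadic T) -ln_ratio_telescope ?T0 // big_add1 /=.
rewrite big_nat_cond [leRHS]big_nat_cond.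
apply: ler_sum => j /andP[/andP[Tj _] _].
have j0 : 0 < j%:R :> R by rewrite ltr0n; lia.
have j1 : 0 < j.+1%:R :> R by rewrite ltr0n.
apply: le_trans (ln_ge_onesub _); last by rewrite divr_gt0.
by rewrite invf_div -natr1 le_eqVlt; apply/orP; left; apply/eqP; field; rewrite natr1 !lt0r_neq0.
Qed.

Lemma harmonic_dyadic_ge T :
  ln 2 <= \sum_(2 ^ T <= j < 2 ^ T.+1) j%:R^-1 :> R.
Proof.
have T0 : (0 < 2 ^ T)%N by rewrite expn_gt0.
have TT : (2 ^ T <= 2 ^ T.+1)%N by rewrite leq_exp2l.
rewrite -(ln_dyadic T) -ln_ratio_telescope ?T0 //.
rewrite big_nat_cond [leRHS]big_nat_cond.
apply: ler_sum => j /andP[/andP[Tj _] _].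
have j0 : 0 < j%:R :> R by rewrite ltr0n; lia.
apply: le_trans (ln_le_sub1 _) _; first by rewrite divr_gt0 // ltr0n.
by rewrite -natr1 le_eqVlt; apply/orP; left; apply/eqP; field; rewrite lt0r_neq0.
Qed.

Lemma nonneg_of_derive (f df : R -> R) (x : R) :
  (forall y : R, is_derive y 1 f (df y)) -> (forall y, 0 <= y -> 0 <= df y) ->
  0 <= x -> f 0 <= f x.
Proof.
move=> fd df0; rewrite le_eqVlt => /orP[/eqP <- //|x0].
have [|y] := @MVT R f df 0 x x0 (fun y _ => fd y).
  by apply: derivable_within_continuous => y _; case: (fd y).
move=> yI E; rewrite -subr_ge0 E mulr_ge0 ?subr0 ?(ltW x0) // df0 //.
by move: yI; rewrite in_itv /= => /andP[/ltW].
Qed.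

Lemma sinh_ge (t : R) : 0 <= t -> 2 * t <= expR t - expR (- t).
Proof.
move=> t0.
pose f : R -> R := expR - (expR \o -%R) - (2 \*: id).
have : f 0 <= f t.
  apply: (nonneg_of_derive (df := fun y => expR y + expR (- y) - 2) _ _ t0).
    by move=> y; apply: is_derive_eq; rewrite /GRing.scale /=; ring.
  move=> y _; have := expR_ge1Dx y; have := expR_ge1Dx (- y); lra.
rewrite /f !fctE /= oppr0 scaler0 /GRing.scale /=; lra.
Qed.

(** This is [tanh (t / 2) <= t / 2] cleared of denominators. *)
Lemma tanh_le (t : R) : 0 <= t -> 2 * (expR t - 1) <= t * (expR t + 1).
Proof.
move=> t0.
pose f : R -> R := id * expR + id - (2 \*: expR).
have : f 0 <= f t.
  apply: (nonneg_of_derive (df := fun y => y * expR y + 1 - expR y) _ _ t0).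
    by move=> y; apply: is_derive_eq; rewrite /GRing.scale /=; ring.
  move=> y y0.
  have := expR_ge1Dx (- y); rewrite expRN.
  have e0 := expR_gt0 y; rewrite -(ler_pM2l e0) mulfV ?lt0r_neq0 //; lra.
rewrite /f !fctE /= expR0 /GRing.scale /=; lra.
Qed.

(** With [t = ln (1 + 1/n)], [tanh_le] gives the lower bound and [sinh_ge] the upper one. The excess
    [1 / (4 n (n + 1))] is written as a difference so that it telescopes. *)
Lemma ln_ratio_bounds (n : nat) : (0 < n)%N ->
  1 <= (n%:R + 2^-1) * ln (n.+1%:R / n%:R : R) <=
    1 + (4 * n%:R)^-1 - (4 * n.+1%:R)^-1.
Proof.
move=> n0; set t : R := ln _.
have nR : 0 < n%:R :> R by rewrite ltr0n.
have n1R : 0 < n.+1%:R :> R by rewrite ltr0n.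
have uP : 0 < n.+1%:R / n%:R :> R by rewrite divr_gt0.
have t0 : 0 <= t by rewrite ln_ge0 // ler_pdivlMr // mul1r ler_nat.
have et : expR t = n.+1%:R / n%:R by rewrite lnK.
have S := sinh_ge t0; have Th := tanh_le t0.
rewrite expRN et invf_div -[n.+1%:R]natr1 in S; rewrite et -[n.+1%:R]natr1 in Th.
rewrite -[n.+1%:R]natr1; clear uP n1R; clearbody t.
have n1R : 0 < n%:R + 1 :> R by lra.
apply/andP; split.
  have : n%:R * (2 * ((n%:R + 1) / n%:R - 1)) <= n%:R * (t * ((n%:R + 1) / n%:R + 1)).
    by rewrite ler_wpM2l // ltW.
  have -> : n%:R * (2 * ((n%:R + 1) / n%:R - 1)) = 2 :> R by field; rewrite lt0r_neq0.
  have -> : n%:R * (t * ((n%:R + 1) / n%:R + 1)) = 2 * ((n%:R + 2^-1) * t).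
    by field; rewrite lt0r_neq0.
  lra.
have h0 : 0 <= (n%:R + 2^-1) / 2 :> R by lra.
have := ler_wpM2l h0 S.
have -> : (n%:R + 2^-1) / 2 * (2 * t) = (n%:R + 2^-1) * t by field.
move/le_trans; apply; rewrite le_eqVlt; apply/orP; left; apply/eqP.
by field; rewrite !lt0r_neq0.
Qed.

Definition stirling_ratio (n : nat) : R :=
  Num.sqrt n%:R * (n%:R ^+ n / n`!%:R) / expR 1 ^+ n.

Lemma stirling_ratioS n : (0 < n)%N ->
  stirling_ratio n.+1 =
  stirling_ratio n * expR ((n%:R + 2^-1) * ln (n.+1%:R / n%:R) - 1).
Proof.
move=> n0; rewrite /stirling_ratio.
have nR : 0 < n%:R :> R by rewrite ltr0n.
have n1R : 0 < n.+1%:R :> R by rewrite ltr0n.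
set t : R := ln _.
have et : expR t = n.+1%:R / n%:R by rewrite lnK // posrE divr_gt0.
have es : Num.sqrt n.+1%:R = Num.sqrt n%:R * expR (2^-1 * t).
  have h : expR (2^-1 * t) = Num.sqrt (n.+1%:R / n%:R).
    have tE : expR t = expR (2^-1 * t) ^+ 2.
      by rewrite -expRM_natl; congr expR; field.
    by rewrite -et tE sqrtr_sqr ger0_norm ?expR_ge0.
  by rewrite h -sqrtrM ?ler0n // mulrC divfK // lt0r_neq0.
rewrite es mulrDl expRB expRD expRM_natl et factS natrM !exprS expr_div_n.
have f0 : n`!%:R != 0 :> R by rewrite pnatr_eq0 -lt0n fact_gt0.
have p0 : n%:R ^+ n != 0 :> R by rewrite expf_neq0 // lt0r_neq0.
have q0 : expR 1 ^+ n != 0 :> R by rewrite expf_neq0 // lt0r_neq0 // expR_gt0.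
have e0 : expR 1 != 0 :> R by rewrite lt0r_neq0 // expR_gt0.
move: (expR (2^-1 * t)) (Num.sqrt n%:R) => x y.
move: (n%:R ^+ n) p0 (n.+1%:R ^+ n) (expR 1 ^+ n) q0 (n`!%:R : R) f0 => a a0 b c c0 f f0.
move: (n.+1%:R : R) n1R (expR 1 : R) e0 => m m0 e e0.
by field; rewrite a0 c0 f0 e0 lt0r_neq0.
Qed.

(** The ratio is [1 / e] at [n = 1] and never decreases; its logarithm grows by at most a
    telescoping sum. *)
Lemma stirling_ratio_bounds n : (0 < n)%N ->
  expR (-1) <= stirling_ratio n <= expR (-1 + 4^-1 - (4 * n%:R)^-1).
Proof.
elim: n => // n IHn _; have [->|n0] := posnP n.
  rewrite /stirling_ratio sqrtr1 !expr1 (_ : 1`! = 1%N) // divr1 !mul1r -expRN.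
  by rewrite mulr1 addrK lexx.
have /andP[lo hi] := IHn n0; have /andP[lo' hi'] := ln_ratio_bounds n0.
rewrite stirling_ratioS //.
set x := (_ + _) * ln _ in lo' hi' *.
have r0 : 0 <= stirling_ratio n by apply: le_trans lo; exact: expR_ge0.
apply/andP; split.
  apply: le_trans lo _; rewrite -[leLHS]mulr1 ler_wpM2l // -[X in X <= _]expR0 ler_expR; lra.
apply: le_trans (ler_wpM2r (expR_ge0 _) hi) _.
rewrite -expRD ler_expR; move: hi'; clearbody x.
move: (4 * n%:R)^-1 (4 * n.+1%:R)^-1 => y z; lra.
Qed.

Lemma stirling_bounds n : (0 < n)%N ->
  expR (-1) * expR 1 ^+ n <= Num.sqrt n%:R * (n%:R ^+ n / n`!%:R : R) <=
    1 * expR 1 ^+ n.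
Proof.
move=> n0; have /andP[lo hi] := stirling_ratio_bounds n0.
have p0 : 0 < expR 1 ^+ n :> R by rewrite exprn_gt0 // expR_gt0.
rewrite -ler_pdivlMr // lo /= -ler_pdivrMr //; apply: le_trans hi _.
rewrite -[X in _ <= X]expR0 ler_expR.
have : 0 <= (4 * n%:R)^-1 :> R by rewrite invr_ge0 mulr_ge0.
lra.
Qed.

End Analysis.

(** * Assembly *)

Section Assembly.
Variable R : realType.

Local Notation rho := (ln 2 : R).
Local Notation e := (expR 1 : R).
Local Notation c1 := (expR (-1) : R).

Lemma ipropE n k : iprop R n k = invariant_mean R n k.
Proof.
rewrite /iprop /has_invariant_set card_invariant_set card_ord.
by rewrite mulrAC mulfV ?mul1r // pnatr_eq0 -lt0n fact_gt0.
Qed.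

Let rho_gt0 : 0 < rho. Proof. by rewrite ln_gt0 // ltr1n. Qed.

Let rho_lt1 : rho < 1.
Proof.
have e2 : 2 < e by have := @expR_gt1Dx R 1; rewrite oner_eq0 => /(_ isT).
by rewrite -ltr_expR lnK ?posrE.
Qed.

(** The exponential rate: for [T] near [log_2 k], [(2 rho e)^T] is of order [k^(2 - delta)]. *)
Definition growth : R := ln (2 * rho * e).

Lemma growthE : growth = rho * (2 - delta R).
Proof.
rewrite /growth !lnM ?posrE ?mulr_gt0 ?expR_gt0 // expRK /delta.
by field; rewrite lt0r_neq0.
Qed.

Lemma growth_gt0 : 0 < growth.
Proof.
have r1 : 1 < 2 * rho by have := ln2_gt_half R; lra.
rewrite ln_gt0 //; apply: (lt_le_trans r1).
rewrite -[leLHS]mulr1 ler_wpM2l ?mulr_ge0 ?(ltW rho_gt0) //.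
by rewrite -[leLHS]expR0 ler_expR.
Qed.

Lemma delta_ge0 : 0 <= delta R.
Proof.
rewrite /delta subr_ge0 ler_pdivrMr // mul1r.
by have := ln_le_sub1 rho_gt0; lra.
Qed.

Lemma growth_pow T : (2 * rho * e) ^+ T = expR (T%:R * growth).
Proof. by rewrite expRM_natl lnK // posrE !mulr_gt0 ?expR_gt0. Qed.

Definition main_term (k : nat) : R :=
  k%:R `^ (- delta R) * ((1 + ln (k%:R : R)) `^ (- (3%:R / 2%:R))).

Lemma powR_three_halves (x : R) : 0 < x ->
  x `^ (- (3%:R / 2%:R)) = (x * Num.sqrt x)^-1.
Proof.
move=> x0; rewrite powRN (_ : 3%:R / 2%:R = 1 + 2^-1); last by field.
rewrite powRD ?powRr1 ?powR12_sqrt ?(ltW x0) //.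
by apply/implyP => _; rewrite lt0r_neq0.
Qed.

Section FixedK.
Variable k : nat.
Hypothesis k0 : (0 < k)%N.

Let kR : 0 < k%:R :> R. Proof. by rewrite ltr0n. Qed.

Let l0 : 0 <= ln (k%:R : R). Proof. by rewrite ln_ge0 // ler1n. Qed.

Lemma main_termE :
  main_term k = expR (- delta R * ln k%:R) *
    ((1 + ln k%:R) * Num.sqrt (1 + ln k%:R))^-1.
Proof.
rewrite /main_term powR_three_halves; last by have := l0; lra.
by rewrite /powR gt_eqF.
Qed.

Lemma main_term_ge0 : 0 <= main_term k.
Proof. by rewrite mulr_ge0 ?powR_ge0. Qed.

Lemma main_term_le1 : main_term k <= 1.
Proof.
rewrite main_termE mulr_ile1 ?expR_ge0 //.
- by rewrite invr_ge0 mulr_ge0 ?sqrtr_ge0 //; have := l0; lra.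
- by rewrite -[leRHS]expR0 ler_expR mulNr oppr_le0 mulr_ge0 ?delta_ge0.
have l1 : 1 <= 1 + ln (k%:R : R) by have := l0; lra.
have p : 1 <= (1 + ln k%:R) * Num.sqrt (1 + ln k%:R) :> R.
  rewrite -[leLHS]mulr1; apply: ler_pM => //.
  by rewrite -[leLHS]sqrtr1 ler_sqrt //; apply: le_trans l1.
by rewrite invf_le1 // (lt_le_trans _ p).
Qed.

Lemma growth_exp : expR (ln k%:R / rho * growth) = k%:R ^+ 2 * expR (- delta R * ln k%:R).
Proof.
have -> : k%:R ^+ 2 = expR (ln (k%:R : R) *+ 2).
  by rewrite -lnXn // lnK // posrE exprn_gt0.
by rewrite growthE -expRD; congr expR; field; exact: lt0r_neq0.
Qed.

Lemma ln_pow2_le T : (2 ^ T <= k)%N -> T%:R <= ln k%:R / rho.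
Proof.
move=> Tk; rewrite ler_pdivlMr // mulr_natl -lnXn //.
by rewrite ler_ln ?posrE ?exprn_gt0 // -natrX ler_nat.
Qed.

Lemma ln_pow2_ge T : (k <= 2 ^ T)%N -> ln k%:R / rho <= T%:R.
Proof.
move=> kT; rewrite ler_pdivrMr // mulr_natl -lnXn //.
by rewrite ler_ln ?posrE ?exprn_gt0 // -natrX ler_nat.
Qed.

Definition upper_factor : R := 4 * upper_const e rho c1 1 * (2 * rho * e).

Lemma upper_const_ge0 : 0 <= upper_const e rho c1 1.
Proof.
rewrite /upper_const /above_const /below_const.
by do ?apply: mulr_ge0; rewrite ?invr_ge0 ?sqr_ge0 ?expR_ge0 ?ler0n // ltW.
Qed.

Lemma iprop_le n : (2 * k <= n)%N -> iprop R n k <= upper_factor * main_term k.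
Proof.
move=> kn; rewrite ipropE.
(* The dyadic level [T.+1] covers [k]; the extra level costs the factor [2 rho e] in
   [upper_factor]. *)
have [T kT Tk] : exists2 T, (k <= 2 ^ T.+1)%N & (2 ^ T <= k)%N.
  by exists (trunc_log 2 k); [apply: ltnW; apply: trunc_log_ltn|apply: trunc_logP].
apply: le_trans (invariant_mean_le R k0 kn) _.
have U := cycle_total_num_sums_le (expR_gt0 1) (expR_gt0 (-1)) ltr01
  (@stirling_bounds R) (ln2_gt_half R) (e_ln2_lt2 R) (harmonic_dyadic_le R) n kT.
have q0 : 0 <= 4 / k%:R ^+ 2 :> R by rewrite divr_ge0 ?exprn_ge0.
apply: le_trans (ler_wpM2l q0 U) _.
have g1 : (2 * rho * e) ^+ T.+1 <= 2 * rho * e * (k%:R ^+ 2 * expR (- delta R * ln k%:R)).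
  rewrite [leLHS]exprS ler_wpM2l ?mulr_ge0 ?expR_ge0 ?(ltW rho_gt0) //.
  rewrite -growth_exp growth_pow ler_expR ler_wpM2r ?(ltW growth_gt0) //.
  exact: ln_pow2_le.
have d1 : decay R T.+1 <= ((1 + ln k%:R) * Num.sqrt (1 + ln k%:R))^-1.
  have lT : 1 + ln (k%:R : R) <= T.+2%:R.
    rewrite -natr1 addrC lerD2r; apply: le_trans (ln_pow2_ge kT).
    by rewrite ler_pdivlMr // ler_piMr // ltW.
  have l1 : 0 < 1 + ln (k%:R : R) by have := l0; lra.
  rewrite /decay lef_pV2 ?posrE ?mulr_gt0 ?sqrtr_gt0 ?ltr0n //.
  apply: ler_pM => //; rewrite ?sqrtr_ge0 ?(ltW l1) //.
  by rewrite ler_sqrt ?ler0n.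
have u0 := upper_const_ge0.
apply: (@le_trans _ _ (4 / k%:R ^+ 2 * (upper_const e rho c1 1 *
   (2 * rho * e * (k%:R ^+ 2 * expR (- delta R * ln k%:R))) *
   ((1 + ln k%:R) * Num.sqrt (1 + ln k%:R))^-1))).
  rewrite ler_wpM2l // ; apply: ler_pM => //.
  - by rewrite mulr_ge0 // exprn_ge0 // !mulr_ge0 ?expR_ge0 // ltW.
  - by rewrite ltW // decay_gt0.
  by rewrite ler_wpM2l.
rewrite main_termE /upper_factor le_eqVlt; apply/orP; left; apply/eqP.
move: ((1 + _) * _)^-1 (expR (- delta R * _)) => x y; field; exact: lt0r_neq0.
Qed.

Let lc := lower_const e rho c1 1.

Lemma lower_const_gt0 : 0 < lc.
Proof.
have E0 := energy_const_gt0 (expR_gt0 1) (expR_gt0 (-1)) ltr01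
  (ln2_gt_half R).
rewrite /lc /lower_const mulr_gt0 ?invr_gt0 ?mulr_gt0 ?expR_gt0 //.
Qed.

(** At most [7] levels are lost between [2 ^ T] and [k]; [24] combines [4] from the decay with [6]
    from [2 k (2 k + 1) <= 6 k^2]. *)
Definition lower_factor : R := lc * expR (- (7 * growth)) / 24.

Lemma iprop_ge_large n : (2 * k <= n)%N -> (64 <= k)%N ->
  lower_factor * main_term k <= iprop R n k.
Proof.
move=> kn k64; rewrite ipropE.
set T0 := trunc_log 2 k.
have T06 : (6 <= T0)%N by apply: trunc_log_max.
(* Six levels down, [64 * 2 ^ T <= k]: a factor [16] is for Markov's inequality and a factor [4] for
   [invariant_mean_ge]. *)
set T := (T0 - 6)%N.
have TE : T0 = (6 + T)%N by rewrite /T subnKC.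
have kT : (k <= 2 ^ (T + 7))%N.
  rewrite (_ : (T + 7 = T0.+1)%N); last by rewrite TE; lia.
  by apply: ltnW; apply: trunc_log_ltn.
have T0k : (2 ^ T0 <= k)%N by apply: trunc_logP.
have Tk : (64 * 2 ^ T <= k)%N by move: T0k; rewrite TE expnD.
have Jk j : (j < 2 ^ T)%N -> (4 * j <= k)%N by move: Tk; set X := (2 ^ T)%N; lia.
have M4 : (4 * (16 * 2 ^ T) <= k)%N by rewrite mulnA.
apply: le_trans (invariant_mean_ge R k0 kn M4 Jk).
have L := cycle_total_num_sums_ge (expR_gt0 1) (expR_gt0 (-1)) ltr01
  (@stirling_bounds R) (ln2_gt_half R) (e_ln2_lt2 R) (harmonic_dyadic_ge R)
  (leqnn (16 * 2 ^ T)).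
have lc0 := lower_const_gt0.
have g1 : expR (- (7 * growth)) * (k%:R ^+ 2 * expR (- delta R * ln k%:R)) <=
    (2 * rho * e) ^+ T.
  rewrite growth_pow -growth_exp -expRD ler_expR.
  have := ler_wpM2r (ltW growth_gt0) (ln_pow2_ge kT).
  by rewrite natrD mulrDl; lra.
have l1 : 0 < 1 + ln (k%:R : R) by have := l0; lra.
have d1 : ((1 + ln k%:R) * Num.sqrt (1 + ln k%:R))^-1 / 4 <= decay R T.
  have lT : T.+1%:R <= 2 * (1 + ln (k%:R : R)).
    have TT0 : (2 ^ T <= k)%N by apply: leq_trans T0k; rewrite leq_exp2l // leq_subr.
    have := ln_pow2_le TT0; have r2 : ln (k%:R : R) / rho <= ln k%:R * 2.
      by rewrite ler_wpM2l // -[leRHS]invrK lef_pV2 ?posrE ?invr_gt0 // ltW // ln2_gt_half.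
    rewrite -natr1; have := l0; lra.
  rewrite /decay -invfM lef_pV2 ?posrE ?mulr_gt0 ?sqrtr_gt0 ?ltr0n //.
  have sq : Num.sqrt T.+1%:R <= 2 * Num.sqrt (1 + ln (k%:R : R)).
    have -> : 2 = Num.sqrt 4 :> R.
      by rewrite (_ : 4 = 2 ^+ 2) ?sqrtr_sqr ?ger0_norm //; ring.
    rewrite -sqrtrM // ler_sqrt; last by rewrite mulr_ge0 // ltW.
    by apply: le_trans lT _; rewrite ler_wpM2r ?(ltW l1) // ler_nat.
  rewrite [leRHS](_ : _ = (2 * (1 + ln k%:R)) * (2 * Num.sqrt (1 + ln k%:R))); last by ring.
  by apply: ler_pM; rewrite ?sqrtr_ge0 ?ler0n.
rewrite main_termE.
set d := (_^-1) in d1 *; set y := expR (- delta R * _) in g1 *.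
have y0 : 0 <= y by exact: expR_ge0.
have d0 : 0 <= d by rewrite invr_ge0 mulr_ge0 ?sqrtr_ge0 // ltW.
have x0 : 0 <= expR (- (7 * growth)) by exact: expR_ge0.
have k2 : 0 < 2 * k%:R * (2 * k).+1%:R :> R by rewrite !mulr_gt0 ?ltr0n.
rewrite ler_pdivlMr //; apply: le_trans L.
rewrite -/lc.
apply: (@le_trans _ _ (lc * (expR (- (7 * growth)) * (k%:R ^+ 2 * y)) * (d / 4))); last first.
  apply: ler_pM => //; last by rewrite ler_wpM2l // ltW.
    by apply: mulr_ge0; [exact: ltW|rewrite !mulr_ge0 // exprn_ge0].
  exact: divr_ge0.
rewrite /lower_factor; move: (expR (- (7 * growth))) x0 => x x0.
move: lc lc0 => l lp {g1}; clearbody y d.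
have k3 : (2 * k).+1%:R <= 3 * k%:R :> R by rewrite -natrM ler_nat; move: k0; clear; lia.
have A0 : 0 <= l * x / 24 * (y * d) * (2 * k%:R).
  do ?apply: mulr_ge0; rewrite ?invr_ge0 ?ler0n //; exact: ltW.
rewrite [leLHS](_ : _ = l * x / 24 * (y * d) * (2 * k%:R) * (2 * k).+1%:R); last by ring.
apply: le_trans (ler_wpM2l A0 k3) _.
by rewrite le_eqVlt; apply/orP; left; apply/eqP; field.
Qed.

(* Inverse of a bound for [2 * k * (2 * k + 1)] when [k < 64]. *)
Definition small_factor : R := (2 * 64%:R * 129%:R)^-1.

(** With no short cycles the only subset sum is [0], which gives the lower bound
    [1 / (2 k (2 k + 1))]; and [main_term k] is at most one. *)
Lemma iprop_ge_small n : (2 * k <= n)%N -> (k < 64)%N ->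
  small_factor * main_term k <= iprop R n k.
Proof.
move=> kn k64; rewrite ipropE.
have H := @invariant_mean_ge R pred0 n k 0 k0 kn (leq0n _) (fun j (h : pred0 j) => False_ind _ (notF h)).
apply: le_trans H; rewrite /cycle_total big_nat1 cycle_mean0 /num_sums /= div1r.
apply: (@le_trans _ _ small_factor).
  rewrite -[leRHS]mulr1 ler_wpM2l ?main_term_le1 //.
  by rewrite invr_ge0 !mulr_ge0 ?ler0n.
have kr : k%:R <= 64%:R :> R by rewrite ler_nat ltnW.
have kr' : (2 * k).+1%:R <= 129%:R :> R by rewrite ler_nat; move: k64; clear; lia.
rewrite /small_factor lef_pV2 ?posrE; [|by rewrite !mulr_gt0 ?ltr0n..].
by apply: ler_pM; rewrite ?mulr_ge0 ?ler0n // ler_wpM2l.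
Qed.

End FixedK.

End Assembly.

Theorem theorem1p1 (R : realType) :
  exists c C : R, 0 < c /\ c < C /\
    forall n k : nat, (1 <= k)%N -> (2 * k <= n)%N ->
      c * (k%:R `^ (- delta R)) * ((1 + ln (k%:R : R)) `^ (- (3%:R / 2%:R)))
        <= iprop R n k /\
      iprop R n k <=
      C * (k%:R `^ (- delta R)) * ((1 + ln (k%:R : R)) `^ (- (3%:R / 2%:R))).
Proof.
have cl0 : 0 < lower_factor R.
  by apply: divr_gt0 => //; apply: mulr_gt0; [exact: lower_const_gt0|exact: expR_gt0].
pose c : R := Num.min (lower_factor R) (small_factor R).
(* The entry [c + 1] of the maximum makes the inequality between the two constants strict. *)
exists c, (Num.max (upper_factor R) (c + 1)).
have c0 : 0 < c by rewrite lt_min cl0 invr_gt0 !mulr_gt0 ?ltr0n.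
split => //; split; first by rewrite lt_max ltrDl ltr01 orbT.
move=> n k k0 kn; rewrite -!mulrA -/(main_term R k).
have m0 := main_term_ge0 R k.
split; last first.
  apply: le_trans (iprop_le R k0 kn) _.
  by rewrite ler_wpM2r // le_max lexx.
have [k64|k64] := ltnP k 64.
  apply: le_trans (iprop_ge_small R k0 kn k64).
  by rewrite ler_wpM2r // ge_min lexx orbT.
apply: le_trans (iprop_ge_large R k0 kn k64).
by rewrite ler_wpM2r // ge_min lexx.
Qed.
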